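(* Let $\Omega\subset\mathbb C^n$ be a bounded open set and $q\in\mathbb R$, $q>1$. Suppose that for every $\zeta\in\partial\Omega$ there exists $f_\zeta\in\bigcap_{p<q}\mathcal{O}L^p(\Omega)$ with $\lim_{z\to\zeta,\,z\in\Omega}f_\zeta(z)=\infty$. Then the set of functions $g\in\bigcap_{p<q}\mathcal{O}L^p(\Omega)$ which are totally unbounded in $\Omega$ is dense and $G_\delta$ in $\bigcap_{p<q}\mathcal{O}L^p(\Omega)$. Also the set of functions $h\in\bigcap_{p<q}\mathcal{O}L^p(\Omega)$ which are singular at every boundary point of $\Omega$ is dense and $G_\delta$ in $\bigcap_{p<q}\mathcal{O}L^p(\Omega)$. The same conclusions hold for $q=\infty$.
   Context: For a bounded open $\Omega\subset\mathbb C^n$ and $p\ge1$, $\mathcal{O}L^p(\Omega)$ is the Banach space of holomorphic $f:\Omega\to\mathbb C$ with $\|f\|_p=(\int_\Omega|f|^p\,dv)^{1/p}<\infty$ ($dv$ = Lebesgue measure); $\mathcal{O}L^\infty(\Omega)$ is the space of bounded holomorphic functions with the sup norm. For $1<q\le\infty$, $\bigcap_{p<q}\mathcal{O}L^p(\Omega)$ carries the complete metric $d(f,g)=\sum_j 2^{-j}\frac{\|f-g\|_{p_j}}{1+\|f-g\|_{p_j}}$ where $1<p_1<p_2<\dots<q$, $p_j\to q$; thus $f_k\to f$ iff $\|f_k-f\|_p\to0$ for every $p<q$; it is a topological vector space. A holomorphic $f$ is totally unbounded in $\Omega$ if for every $w\in\partial\Omega$, $\delta>0$ and every connected component $E$ of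 $B(w,\delta)\cap\Omega$, $\sup_E|f|=\infty$. A holomorphic $f$ on $\Omega$ is singular at every boundary point of $\Omega$ if whenever $U,V\subset\mathbb C^n$ are open, $U$ connected, $\emptyset\ne V\subseteq U\cap\Omega\ne U$, there is no holomorphic $F$ on $U$ with $F=f$ on $V$. *)

(* Defs.v *)
From HB Require Import structures.
From mathcomp Require Import all_boot all_order all_algebra.
From mathcomp Require Import all_classical all_reals all_analysis.
From mathcomp Require Import complex.
Import Order.TTheory GRing.Theory Num.Theory.
Import numFieldNormedType.Exports.

Set Implicit Arguments.
Unset Strict Implicit.
Unset Printing Implicit Defensive.

Local Open Scope ring_scope.
Local Open Scope classical_set_scope.

Notation Cn R n := (('rV[R[i]]_n : normedModType R[i]) : Type).

Section Defs.
Context {R : realType} {n : nat}.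

Local Notation Cn := (Cn R n).
Local Notation fn := (Cn -> (R[i])^o).

Definition cabs (z : R[i]) : R := Num.sqrt (complex.Re z ^+ 2 + complex.Im z ^+ 2).

Definition enorm (z : Cn) : R := Num.sqrt (\sum_(j < n) cabs (z ord0 j) ^+ 2).

Definition eball (w : Cn) (d : R) : set Cn := [set z | enorm (z - w) < d].

Definition bounded_Cn (Om : set Cn) : Prop :=
  exists M : R, forall z, Om z -> enorm z <= M.

Definition bdry (Om : set Cn) : set Cn := closure Om `\` interior Om.

(* holomorphic on U: complex (Frechet) differentiable over R[i] at every point of U *)
Definition holomorphic_on (U : set Cn) (f : fn) : Prop :=
  forall z, U z -> differentiable f z.

(* identification R^{2n} -> C^n : z_j = v(2j) + i v(2j+1) *)
Definition coords_to_Cn (v : nat -> R) : Cn :=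
  \row_(j < n) Complex (v (2 * j)%N) (v (2 * j).+1).

(* iterated Lebesgue integral over R^k (coordinates 0..k-1) of a
   nonnegative function; by Tonelli this is the Lebesgue integral on R^k *)
Fixpoint iint (k : nat) (g : (nat -> R) -> \bar R) : \bar R :=
  match k with
  | 0 => g (fun _ => 0)
  | k'.+1 => (\int[@lebesgue_measure R]_(t in [set: R])
               iint k' (fun v => g (fun i => if i == k' then t else v i)))%E
  end.

Definition intp (Om : set Cn) (p : R) (f : fn) : \bar R :=
  iint (2 * n) (fun v => ((\1_Om (coords_to_Cn v)) *
                          powR (cabs (f (coords_to_Cn v) : R[i])) p)%:E).

Definition Lpnorm (Om : set Cn) (p : R) (f : fn) : R :=
  powR (fine (intp Om p f)) p^-1.

Definition OLp (Om : set Cn) (p : R) (f : fn) : Prop :=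
  holomorphic_on Om f /\ (intp Om p f < +oo)%E.

Definition OLq (Om : set Cn) (q : \bar R) (f : fn) : Prop :=
  holomorphic_on Om f /\
  forall p : R, 1 <= p -> (p%:E < q)%E -> (intp Om p f < +oo)%E.

(* admissible exponent sequence: 1 < p_1 < p_2 < ... < q, p_j -> q
   (ps 0 is p_1) *)
Definition exponent_seq (q : \bar R) (ps : nat -> R) : Prop :=
  (forall j, 1 < ps j) /\ (forall j, ps j < ps j.+1) /\
  (forall j, ((ps j)%:E < q)%E) /\ ((fun j => (ps j)%:E) @ \oo --> q).

Definition OLdist (ps : nat -> R) (Om : set Cn) (f g : fn) : R :=
  fine (\sum_(j <oo)
          ((2%:R ^- j.+1 * (Lpnorm Om (ps j) (fun z => f z - g z) /
                (1 + Lpnorm Om (ps j) (fun z => f z - g z))))%:E))%E.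

Definition OL_open (ps : nat -> R) (Om : set Cn) (q : \bar R) (U : set fn) : Prop :=
  forall f, OLq Om q f -> U f ->
    exists2 e : R, 0 < e &
      forall g, OLq Om q g -> OLdist ps Om f g < e -> U g.

Definition OL_dense (ps : nat -> R) (Om : set Cn) (q : \bar R) (S : set fn) : Prop :=
  forall f, OLq Om q f -> forall e : R, 0 < e ->
    exists g, [/\ OLq Om q g, S g & OLdist ps Om f g < e].

Definition OL_Gdelta (ps : nat -> R) (Om : set Cn) (q : \bar R) (S : set fn) : Prop :=
  exists U : nat -> set fn, (forall k, OL_open ps Om q (U k)) /\
    forall g, OLq Om q g -> (S g <-> forall k, U k g).

Definition totally_unbounded (Om : set Cn) (f : fn) : Prop :=
  forall w, bdry Om w -> forall d : R, 0 < d ->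
    forall x, (eball w d `&` Om) x ->
      forall M : R, exists z,
        connected_component (eball w d `&` Om) x z /\ M < cabs (f z : R[i]).

Definition singular_everywhere (Om : set Cn) (f : fn) : Prop :=
  forall U V : set Cn, open U -> open V -> connected U ->
    V !=set0 -> V `<=` U `&` Om -> U `&` Om <> U ->
    ~ (exists F : fn, holomorphic_on U F /\ forall z, V z -> F z = f z).

Definition tends_to_infty_at (Om : set Cn) (zeta : Cn) (f : fn) : Prop :=
  forall M : R, exists2 d : R, 0 < d &
    forall z, Om z -> enorm (z - zeta) < d -> M < cabs (f z : R[i]).

End Defs.

(* Main.v *)
(** Cauchy's formula on rectangles bounds [|f a|^p] by a multiple of the
    integral of [|f|^p] over a polybox around [a]; hence convergence in the
    metric is locally uniform, point evaluations are continuous, and the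
    theorems of Weierstrass and Vitali and the identity theorem are available.

    If a ball [B] is not contained in [Om], every component of [B `&` Om] has a
    boundary point of [Om] in its closure and inside [B].  So [f] is totally
    unbounded iff it is unbounded on countably many such components, those of
    rational balls, and this is a countable intersection of open conditions.
    By hypothesis each of these components carries a function of the space
    unbounded on it.  Adding to a given function small multiples of these, one
    after the other, each negligible in the first norms and at the points where
    the previous ones were made large, gives a nearby function that is large on
    all of them.

    If [f] is not singular everywhere, then for some rational ball not contained
    in [Om], [f] extends from a smaller concentric ball to a holomorphic function
    bounded by an integer there; for fixed data this is a closed condition by
    Vitali's theorem.  By the identity theorem such an [f] would be bounded near
    a boundary point on one component, so totally unbounded functions are
    singular everywhere. *)

Require Import Defs.
From HB Require Import structures.
From mathcomp Require Import all_boot all_order all_algebra.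
From mathcomp Require Import all_classical all_reals all_analysis.
From mathcomp Require Import measurable_realfun.
From mathcomp Require Import complex.
From mathcomp Require Import ring lra.
Import Order.TTheory GRing.Theory Num.Theory.
Import numFieldNormedType.Exports.
Local Open Scope ring_scope.
Local Open Scope classical_set_scope.

Set Implicit Arguments.
Unset Strict Implicit.
Unset Printing Implicit Defensive.

(** Rectangles take the place of circles: Cauchy's formula then involves integrals over intervals
    only, and the four sides can be moved to where Tonelli's theorem makes the integral of [|f|^p]
    small. Constants are chosen for convenience. The integral of the Cauchy kernel enters through a
    lower bound of its modulus, and sums are estimated by [|a + b|^p <= 2^p (|a|^p + |b|^p)]; the
    factors lost there are paid for by choosing later corrections smaller. Several variables are
    handled along complex lines, with estimates uniform in the line. Vitali's theorem rests on a
    two-constants inequality: smallness on a small ball and boundedness on a large one give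
    smallness on a ball whose radius depends on the large one only, and this makes the set of good
    points closed. In the density argument the limit is built by hand, as a locally uniformly
    convergent series, and Fatou's lemma puts it into the space. Integrals being iterated over real
    coordinates, measurability is formulated so that any coordinate can be frozen or turned into a
    parameter. *)

Local Notation "x %:C" := (real_complex _ x) (format "x %:C") : ring_scope.
Local Notation Re := complex.Re.
Local Notation Im := complex.Im.

(** * The real-valued modulus of complex numbers *)

Section ComplexModulus.
Context {R : realType}.
Implicit Types (z w : R[i]) (x y : R).

Lemma normr_cabs z : `|z| = (cabs z)%:C.
Proof. by rewrite normc_def. Qed.

Lemma cabs_ge0 z : 0 <= cabs z.
Proof. exact: sqrtr_ge0. Qed.

Lemma cabs0 : cabs (0 : R[i]) = 0.
Proof. by apply: complexI; rewrite -normr_cabs normr0. Qed.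

Lemma cabs1 : cabs (1 : R[i]) = 1.
Proof. by apply: complexI; rewrite -normr_cabs normr1. Qed.

Lemma cabs_eq0 z : (cabs z == 0) = (z == 0).
Proof. by rewrite -(normr_eq0 z) normr_cabs -(inj_eq (@complexI R)). Qed.

Lemma cabs_gt0 z : (0 < cabs z) = (z != 0).
Proof. by rewrite lt_neqAle cabs_ge0 andbT eq_sym cabs_eq0. Qed.

Lemma cabsM z w : cabs (z * w) = cabs z * cabs w.
Proof. by apply: complexI; rewrite rmorphM /= -!normr_cabs normrM. Qed.

Lemma cabsV z : cabs z^-1 = (cabs z)^-1.
Proof. by apply: complexI; rewrite fmorphV /= -!normr_cabs normfV. Qed.

Lemma cabsX z k : cabs (z ^+ k) = cabs z ^+ k.
Proof. by apply: complexI; rewrite rmorphXn /= -!normr_cabs normrX. Qed.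

Lemma cabsN z : cabs (- z) = cabs z.
Proof. by apply: complexI; rewrite -!normr_cabs normrN. Qed.

Lemma cabsB z w : cabs (z - w) = cabs (w - z).
Proof. by rewrite -cabsN opprB. Qed.

Lemma cabsD z w : cabs (z + w) <= cabs z + cabs w.
Proof. by rewrite -lecR rmorphD /= -!normr_cabs ler_normD. Qed.

Lemma cabs_sub z w : cabs (z - w) <= cabs z + cabs w.
Proof. by rewrite -(cabsN w) cabsD. Qed.

Lemma cabs_dist z w : cabs z - cabs w <= cabs (z - w).
Proof. by rewrite lerBlDr; apply: le_trans (cabsD _ _); rewrite subrK. Qed.

Lemma cabs_trans u z w : cabs (z - w) <= cabs (z - u) + cabs (u - w).
Proof. by apply: le_trans (cabsD _ _); rewrite addrA subrK. Qed.

Lemma cabs_sum (I : Type) (r : seq I) (P : pred I) (F : I -> R[i]) :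
  cabs (\sum_(i <- r | P i) F i) <= \sum_(i <- r | P i) cabs (F i).
Proof.
elim/big_ind2 : _ => [|x1 x2 y1 y2 h1 h2|//]; first by rewrite cabs0.
by apply: le_trans (cabsD _ _) _; exact: lerD.
Qed.

Lemma cabs_real x : cabs x%:C = `|x|.
Proof. by rewrite /cabs /= expr0n addr0 sqrtr_sqr. Qed.

Lemma cabs_i : cabs ('i%C : R[i]) = 1.
Proof. by rewrite /cabs /= expr0n add0r expr1n sqrtr1. Qed.

Lemma ReD z w : Re (z + w) = Re z + Re w.
Proof. by case: z w => [a b] [c d]. Qed.
Lemma ImD z w : Im (z + w) = Im z + Im w.
Proof. by case: z w => [a b] [c d]. Qed.
Lemma ReN z : Re (- z) = - Re z.
Proof. by case: z. Qed.
Lemma ImN z : Im (- z) = - Im z.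
Proof. by case: z. Qed.

Lemma Re_le_cabs z : `|Re z| <= cabs z.
Proof. by rewrite -sqrtr_sqr ler_wsqrtr// lerDl sqr_ge0. Qed.

Lemma Im_le_cabs z : `|Im z| <= cabs z.
Proof. by rewrite -sqrtr_sqr ler_wsqrtr// lerDr sqr_ge0. Qed.

Lemma cabs_le_ReIm z : cabs z <= `|Re z| + `|Im z|.
Proof.
have -> : z = (Re z)%:C + 'i%C * (Im z)%:C by exact: complexE.
rewrite (le_trans (cabsD _ _))// cabsM cabs_i mul1r !cabs_real.
by rewrite -complexE.
Qed.

End ComplexModulus.

(** * Real-valued norms, and continuity and differentiability in terms of them *)

Section RealNorm.
Context {R : realType} {V : normedModType R[i]}.
Implicit Types u v w : V.

(** Over [R[i]] norms take values in [R[i]]. The real part loses nothing, since a norm is real, and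
    moves all order arguments to [R]. *)
Definition rnorm v : R := Re `|v|.

Lemma normr_rnorm v : `|v| = (rnorm v)%:C.
Proof. by rewrite /rnorm RRe_real ?normr_real. Qed.

Lemma rnorm_ge0 v : 0 <= rnorm v.
Proof. by rewrite -ler0c -normr_rnorm. Qed.

Lemma rnorm0 : rnorm 0 = 0.
Proof. by rewrite /rnorm normr0. Qed.

Lemma rnormD v w : rnorm (v + w) <= rnorm v + rnorm w.
Proof. by rewrite -lecR rmorphD /= -!normr_rnorm ler_normD. Qed.

Lemma rnormN v : rnorm (- v) = rnorm v.
Proof. by rewrite /rnorm normrN. Qed.

Lemma rnormB v w : rnorm (v - w) = rnorm (w - v).
Proof. by rewrite -rnormN opprB. Qed.

Lemma rnorm_trans u v w : rnorm (v - w) <= rnorm (v - u) + rnorm (u - w).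
Proof. by apply: le_trans (rnormD _ _); rewrite addrA subrK. Qed.

Lemma rnormZ (t : R[i]) v : rnorm (t *: v) = cabs t * rnorm v.
Proof.
by apply: complexI; rewrite rmorphM /= -normr_cabs -!normr_rnorm normrZ.
Qed.

Lemma rnorm_eq0 v : (rnorm v == 0) = (v == 0).
Proof. by rewrite -(normr_eq0 v) normr_rnorm -(inj_eq (@complexI R)). Qed.

Lemma nbhs_rnorm (x : V) (A : set V) :
  nbhs x A <-> exists2 d : R, 0 < d & forall y, rnorm (y - x) < d -> A y.
Proof.
rewrite -nbhs_ballE; split.
  move=> [e /= e0 eA]; exists (Re e).
    by move: e0; rewrite ltcE /= => /andP[].
  move=> y ye; apply: eA; rewrite -ball_normE /= normr_rnorm rnormB.
  by move: e0; rewrite !ltcE /= => /andP[/eqP -> _]; rewrite eqxx.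
move=> [d d0 dA]; exists d%:C; first by rewrite /= ltcR.
by move=> y; rewrite -ball_normE /= normr_rnorm rnormB ltcR => /dA.
Qed.

Lemma open_rnorm (A : set V) : open A <->
  forall x, A x -> exists2 d : R, 0 < d & forall y, rnorm (y - x) < d -> A y.
Proof. by rewrite openE; split => h x /h /nbhs_rnorm. Qed.

Lemma cvg_rnorm {T : Type} (F : set_system T) {FF : Filter F} (f : T -> V) (l : V) :
  (forall e : R, 0 < e -> \forall t \near F, rnorm (f t - l) < e) -> f @ F --> l.
Proof.
move=> h A /nbhs_rnorm[d d0 dA].
by apply: filterS (h _ d0) => t /dA.
Qed.

End RealNorm.

Section RealNormFun.
Context {R : realType} {V : normedModType R[i]}.

Lemma rnorm_cabs (z : R[i]) : rnorm (z : R[i]^o) = cabs z.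
Proof. by rewrite /rnorm normr_cabs. Qed.

Lemma continuous_rnorm (f : V -> R[i]^o) (x : V) :
  {for x, continuous f} <-> forall e : R, 0 < e ->
    exists2 d : R, 0 < d & forall y, rnorm (y - x) < d -> cabs (f y - f x) < e.
Proof.
split.
  move=> cf e e0; apply/nbhs_rnorm.
  suff: nbhs (f x) [set y : R[i]^o | cabs (y - f x) < e] by exact: cf.
  by apply/nbhs_rnorm; exists e => // y; rewrite rnorm_cabs.
move=> h A /nbhs_rnorm[d d0 dA]; apply/nbhs_rnorm.
have [d' d'0 H] := h _ d0; exists d' => // y /H hy.
by apply: dA; rewrite /rnorm normr_cabs.
Qed.

Lemma differentiable_rnorm (f : V -> R[i]^o) (x : V) : differentiable f x ->
  forall e : R, 0 < e -> exists2 d : R, 0 < d &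
   forall h, rnorm h < d -> cabs (f (x + h) - f x - 'd f x h) <= e * rnorm h.
Proof.
move=> /diff_locally df e e0.
have e0' : 0 < e%:C by rewrite ltcR.
move: df => /eqaddoP /(_ _ e0') /nbhs_rnorm[d d0 H].
exists d => // h hd; have := H h; rewrite subr0 => /(_ hd) /=.
rewrite -lecR rmorphM /= -!normr_rnorm -normr_cabs.
by rewrite (_ : (_ - _) h = f (x + h) - f x - 'd f x h)// -addrA -opprD (addrC x).
Qed.

Lemma differentiable_rnormP (f : V -> R[i]^o) (L : {linear V -> R[i]^o}) (x : V) :
  continuous L ->
  (forall e : R, 0 < e -> exists2 d : R, 0 < d &
   forall h, rnorm h < d -> cabs (f (x + h) - f x - L h) <= e * rnorm h) ->
  differentiable f x.
Proof.
move=> cL H.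
have E : f \o shift x = cst (f x) + L +o_ 0 id.
  apply/eqaddoP => e e0; apply/nbhs_rnorm.
  have er : e = (Re e)%:C by rewrite RRe_real// gtr0_real.
  have e0' : 0 < Re e by rewrite -ltcR -er.
  have [d d0 hd] := H _ e0'; exists d => // h; rewrite subr0 => /hd.
  rewrite /= er -lecR rmorphM /= -normr_rnorm -normr_cabs.
  by rewrite (_ : (_ - _) h = f (x + h) - f x - L h)// -addrA -opprD (addrC x).
apply/diff_locallyP; rewrite (diff_unique cL E); split => //.
Qed.

End RealNormFun.

(** * Cauchy's formula on rectangles *)

Section SegmentIntegral.
Context {R : realType}.
Local Notation mu := (@lebesgue_measure R).
Implicit Types (f g : R -> R[i]) (a b c : R).

Definition cint a b f : R[i] :=
  Complex (\int[mu]_(x in `[a, b]) Re (f x)) (\int[mu]_(x in `[a, b]) Im (f x)).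

Definition cintegrable a b f :=
  mu.-integrable `[a, b] (fun x => (Re (f x))%:E) /\
  mu.-integrable `[a, b] (fun x => (Im (f x))%:E).

(** Continuity at the points of the segment, but towards all real [y]: this is what the restriction
    to a line of a function continuous at these points satisfies. *)
Definition seg_continuous a b f := forall x, a <= x <= b -> forall e : R, 0 < e ->
  exists2 d : R, 0 < d & forall y, `|y - x| < d -> cabs (f y - f x) < e.

Lemma real_seg_continuous_within (h : R -> R) a b :
  (forall x, a <= x <= b -> forall e : R, 0 < e ->
    exists2 d : R, 0 < d & forall y, `|y - x| < d -> `|h y - h x| < e) ->
  {within `[a, b], continuous h}.
Proof.
move=> H; apply: continuous_in_subspaceT => x; rewrite inE /= in_itv /= => xab.
apply/cvgrPdist_lt => e e0; have [d d0 hd] := H _ xab _ e0.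
apply/nbhs_ballP; exists d => //= y; rewrite /ball /= distrC => /hd.
by rewrite distrC.
Qed.

Lemma real_seg_continuous_integrable (h : R -> R) a b :
  (forall x, a <= x <= b -> forall e : R, 0 < e ->
    exists2 d : R, 0 < d & forall y, `|y - x| < d -> `|h y - h x| < e) ->
  mu.-integrable `[a, b] (EFin \o h).
Proof.
move=> /real_seg_continuous_within H.
apply: continuous_compact_integrable => //; exact: segment_compact.
Qed.

Lemma seg_continuous_integrable a b f : seg_continuous a b f -> cintegrable a b f.
Proof.
move=> H; split; apply: real_seg_continuous_integrable => x xab e e0;
  have [d d0 hd] := H _ xab _ e0; exists d => // y /hd; apply: le_lt_trans.
  by rewrite -ReN -ReD Re_le_cabs.
by rewrite -ImN -ImD Im_le_cabs.
Qed.

Lemma cintegrableD a b f g : cintegrable a b f -> cintegrable a b g ->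
  cintegrable a b (fun x => f x + g x).
Proof.
move=> [f1 f2] [g1 g2]; split.
  have -> : (fun x => (Re (f x + g x))%:E) =
      ((fun x => (Re (f x))%:E) \+ (fun x => (Re (g x))%:E))%E.
    by apply/funext => x; rewrite ReD EFinD.
  exact: integrableD.
have -> : (fun x => (Im (f x + g x))%:E) =
    ((fun x => (Im (f x))%:E) \+ (fun x => (Im (g x))%:E))%E.
  by apply/funext => x; rewrite ImD EFinD.
exact: integrableD.
Qed.

Lemma cintegrableM a b f k : cintegrable a b f -> cintegrable a b (fun x => k * f x).
Proof.
case: k => k1 k2 [f1 f2]; split.
  have -> : (fun x => (Re (Complex k1 k2 * f x))%:E) =
    ((fun x => k1%:E * (Re (f x))%:E) \- (fun x => k2%:E * (Im (f x))%:E))%E.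
    by apply/funext => x; case: (f x) => u v; rewrite /= -!EFinM -EFinB.
  by apply: integrableB => //; exact: integrableZl.
have -> : (fun x => (Im (Complex k1 k2 * f x))%:E) =
    ((fun x => k1%:E * (Im (f x))%:E) \+ (fun x => k2%:E * (Re (f x))%:E))%E.
  by apply/funext => x; case: (f x) => u v; rewrite /= -!EFinM -EFinD.
by apply: integrableD => //; exact: integrableZl.
Qed.

Lemma cintegrableN a b f : cintegrable a b f -> cintegrable a b (fun x => - f x).
Proof.
by move=> /(cintegrableM (-1)); congr cintegrable; apply/funext => x; rewrite mulN1r.
Qed.

Lemma cintD a b f g : cintegrable a b f -> cintegrable a b g ->
  cint a b (fun x => f x + g x) = cint a b f + cint a b g.
Proof.
move=> [f1 f2] [g1 g2]; rewrite /cint; apply/eqP; rewrite eq_complex /=.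
under eq_Rintegral do rewrite ReD.
under [X in _ && (X == _)]eq_Rintegral do rewrite ImD.
by rewrite !RintegralD// !eqxx.
Qed.

Lemma cintM a b f k : cintegrable a b f ->
  cint a b (fun x => k * f x) = k * cint a b f.
Proof.
case: k => k1 k2 [f1 f2]; rewrite /cint; apply/eqP; rewrite eq_complex /=.
have g1 : mu.-integrable `[a, b] (fun x => (k1 * Re (f x))%:E).
  by apply: (integrableZl _ k1 f1).
have g2 : mu.-integrable `[a, b] (fun x => (k2 * Im (f x))%:E).
  by apply: (integrableZl _ k2 f2).
have g3 : mu.-integrable `[a, b] (fun x => (k1 * Im (f x))%:E).
  by apply: (integrableZl _ k1 f2).
have g4 : mu.-integrable `[a, b] (fun x => (k2 * Re (f x))%:E).
  by apply: (integrableZl _ k2 f1).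
have -> : \int[mu]_(x in `[a, b]) Re (Complex k1 k2 * f x) =
    \int[mu]_(x in `[a, b]) (k1 * Re (f x) - k2 * Im (f x)).
  by apply: eq_Rintegral => x _; case: (f x).
have -> : \int[mu]_(x in `[a, b]) Im (Complex k1 k2 * f x) =
    \int[mu]_(x in `[a, b]) (k1 * Im (f x) + k2 * Re (f x)).
  by apply: eq_Rintegral => x _; case: (f x).
by rewrite RintegralB// RintegralD// !RintegralZl// !eqxx.
Qed.

Lemma cintN a b f : cintegrable a b f -> cint a b (fun x => - f x) = - cint a b f.
Proof.
move=> fi; rewrite -[RHS]mulN1r -cintM//; congr cint.
by apply/funext => x; rewrite mulN1r.
Qed.

Lemma cintB a b f g : cintegrable a b f -> cintegrable a b g ->
  cint a b (fun x => f x - g x) = cint a b f - cint a b g.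
Proof. by move=> fi gi; rewrite cintD ?cintN//; exact: cintegrableN. Qed.

Lemma eq_cint a b f g : (forall x, a <= x <= b -> f x = g x) ->
  cint a b f = cint a b g.
Proof.
move=> fg; rewrite /cint; congr Complex; apply: eq_Rintegral => x;
  by rewrite inE /= in_itv /= => /fg ->.
Qed.

Lemma cint_cst a b k : a <= b -> cint a b (fun=> k) = (b - a)%:C * k.
Proof.
move=> ab; rewrite /cint !Rintegral_cst//= lebesgue_measure_itv/= lte_fin.
have -> : fine (if (a < b) then (b%:E - a%:E)%E else 0%E) = b - a.
  case: ltP => // ba; rewrite /= (_ : b = a) ?subrr//.
  by apply/eqP; rewrite eq_le ab ba.
by case: k => k1 k2; rewrite /= mulrC (mulrC k2); apply/eqP;
  rewrite eq_complex /= !mul0r subr0 addr0 !eqxx.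
Qed.

Lemma cint_split a b c f : a <= c <= b -> cintegrable a b f ->
  cint a b f = cint a c f + cint c b f.
Proof.
move=> /andP[ac cb] [f1 f2].
have S (h : R -> R) : mu.-integrable `[a, b] (EFin \o h) ->
    \int[mu]_(x in `[a, b]) h x = \int[mu]_(x in `[a, c]) h x + \int[mu]_(x in `[c, b]) h x.
  move=> hi; rewrite -(Rintegral_itv_obnd_cbnd (r := c)); last first.
    by apply: integrableS hi => //; apply: subset_itvr; rewrite bnd_simp.
  rewrite -(@Rintegral_itvB _ _ (BLeft a) (BRight b) c) ?bnd_simp//.
  by rewrite addrC subrK.
by rewrite /cint; apply/eqP; rewrite eq_complex /= -!S// !eqxx.
Qed.

(** The real and the imaginary part are estimated separately, hence the factor 2, which recurs in
    all later constants. *)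
Lemma cabs_cint_le_int a b f (h : R -> R) : cintegrable a b f ->
  mu.-integrable `[a, b] (EFin \o h) -> (forall x, a <= x <= b -> cabs (f x) <= h x) ->
  cabs (cint a b f) <= 2 * \int[mu]_(x in `[a, b]) h x.
Proof.
move=> [f1 f2] hi fh; apply: le_trans (cabs_le_ReIm _) _.
rewrite mulr_natl mulr2n; apply: lerD => /=.
  apply: le_trans (le_normr_Rintegral _ _) _ => //; apply: le_Rintegral => //.
    exact: (integrable_norm f1).
  move=> x; rewrite /= in_itv /= => /fh; exact/le_trans/Re_le_cabs.
apply: le_trans (le_normr_Rintegral _ _) _ => //; apply: le_Rintegral => //.
  exact: (integrable_norm f2).
move=> x; rewrite /= in_itv /= => /fh; exact/le_trans/Im_le_cabs.
Qed.

Lemma cabs_cint_le a b f (M : R) : a <= b -> cintegrable a b f ->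
  (forall x, a <= x <= b -> cabs (f x) <= M) ->
  cabs (cint a b f) <= 2 * (M * (b - a)).
Proof.
move=> ab fi fM.
have := @cabs_cint_le_int a b f (fun=> M) fi _ fM.
have -> : \int[mu]_(x in `[a, b]) M = M * (b - a).
  have := congr1 (@complex.Re R) (@cint_cst a b M%:C ab).
  by rewrite /= mul0r subr0 (mulrC (b - a)).
apply; apply: (@real_seg_continuous_integrable (fun=> M)) => x _ e e0.
by exists 1 => // y _; rewrite subrr normr0.
Qed.

End SegmentIntegral.

Lemma nested_intervals (R : realType) (a b : nat -> R) :
  (forall k, a k <= a k.+1) -> (forall k, b k.+1 <= b k) ->
  (forall k, a k <= b k) -> exists x, forall k, a k <= x <= b k.
Proof.
move=> aS bS ab.
have am : {homo a : i j / (i <= j)%N >-> i <= j} by exact: homo_leq (@lexx _ _) (@le_trans _ _) aS.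
have bm : {homo b : i j / (i <= j)%N >-> j <= i}.
  by apply: (@homo_leq _ b (fun x y => y <= x)) => // x y z xy yz; exact: le_trans yz xy.
have abij i j : a i <= b j.
  apply: le_trans (am _ _ (leq_maxl i j)) _; apply: le_trans (ab _) _.
  exact: bm (leq_maxr i j).
have ubj j : ubound (range a) (b j) by move=> _ [i _ <-].
exists (sup (range a)) => k; apply/andP; split.
  by apply: ub_le_sup; [exists (b 0%N)|exists k].
by apply: ge_sup => //; exists (a 0%N); exists 0%N.
Qed.

Lemma exists_halving_lt (R : realType) (C e : R) : 0 < e -> exists k, C / 2 ^+ k < e.
Proof.
move=> e0; have [k hk] : exists k : nat, C / e < k%:R.
  by exists (Num.bound `|C / e|); apply: le_lt_trans (ler_norm _) _; exact: archi_boundP.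
exists k; rewrite ltr_pdivrMr ?exprn_gt0// mulrC -ltr_pdivrMr//.
by apply: lt_trans hk _; rewrite -natrX ltr_nat ltn_expl.
Qed.

(** * Integrals along boundaries of rectangles, and bisection *)

Section RectangleIntegral.
Context {R : realType}.
Implicit Types (f g : R[i]^o -> R[i]^o).

(* Integral along the boundary of the rectangle, counterclockwise. *)
Definition rect_int f (x0 x1 y0 y1 : R) : R[i] :=
  cint x0 x1 (fun x => f (Complex x y0) - f (Complex x y1)) +
  'i%C * cint y0 y1 (fun y => f (Complex x1 y) - f (Complex x0 y)).

Definition rect (x0 x1 y0 y1 : R) : set R[i]^o :=
  [set z | x0 <= Re z <= x1 /\ y0 <= Im z <= y1].

Definition rect_boundary (x0 x1 y0 y1 : R) : set R[i]^o := [set z |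
  (x0 <= Re z <= x1 /\ (Im z = y0 \/ Im z = y1)) \/
  (y0 <= Im z <= y1 /\ (Re z = x0 \/ Re z = x1))].

Definition continuous_on_boundary f x0 x1 y0 y1 :=
  forall z, rect_boundary x0 x1 y0 y1 z -> {for z, continuous f}.

Lemma Complex_sub (x y x' y' : R) :
  Complex x y - Complex x' y' = Complex (x - x') (y - y').
Proof. by []. Qed.

Lemma cabs_Complexr (x : R) : cabs (Complex x 0) = `|x|.
Proof. exact: cabs_real. Qed.

Lemma cabs_Complexi (x : R) : cabs (Complex 0 x) = `|x|.
Proof. by rewrite /cabs /= expr0n add0r sqrtr_sqr. Qed.

Lemma seg_continuousH f x0 x1 y :
  (forall x, x0 <= x <= x1 -> {for Complex x y, continuous f}) ->
  seg_continuous x0 x1 (fun x => f (Complex x y)).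
Proof.
move=> H x xx e e0; have /continuous_rnorm /(_ _ e0)[d d0 hd] := H _ xx.
by exists d => // x' hx; apply: hd; rewrite rnorm_cabs Complex_sub subrr cabs_Complexr.
Qed.

Lemma seg_continuousV f y0 y1 x :
  (forall y, y0 <= y <= y1 -> {for Complex x y, continuous f}) ->
  seg_continuous y0 y1 (fun y => f (Complex x y)).
Proof.
move=> H y yy e e0; have /continuous_rnorm /(_ _ e0)[d d0 hd] := H _ yy.
by exists d => // x' hx; apply: hd; rewrite rnorm_cabs Complex_sub subrr cabs_Complexi.
Qed.

Lemma cintegrableH f x0 x1 y0 y1 y : continuous_on_boundary f x0 x1 y0 y1 ->
  y = y0 \/ y = y1 -> cintegrable x0 x1 (fun x => f (Complex x y)).
Proof.
by move=> cf yy; apply/seg_continuous_integrable/seg_continuousH => x xx;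
  apply: cf; left.
Qed.

Lemma cintegrableV f x0 x1 y0 y1 x : continuous_on_boundary f x0 x1 y0 y1 ->
  x = x0 \/ x = x1 -> cintegrable y0 y1 (fun y => f (Complex x y)).
Proof.
by move=> cf xx; apply/seg_continuous_integrable/seg_continuousV => y yy;
  apply: cf; right.
Qed.

Lemma rect_intE f x0 x1 y0 y1 : continuous_on_boundary f x0 x1 y0 y1 ->
  rect_int f x0 x1 y0 y1 =
  (cint x0 x1 (fun x => f (Complex x y0)) - cint x0 x1 (fun x => f (Complex x y1))) +
  'i%C * (cint y0 y1 (fun y => f (Complex x1 y)) - cint y0 y1 (fun y => f (Complex x0 y))).
Proof.
move=> cf; rewrite /rect_int.
rewrite (cintB (cintegrableH cf (or_introl erefl)) (cintegrableH cf (or_intror erefl))).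
by rewrite (cintB (cintegrableV cf (or_intror erefl)) (cintegrableV cf (or_introl erefl))).
Qed.

Lemma rect_int_splitx f x0 x1 y0 y1 c : x0 <= c -> c <= x1 ->
  continuous_on_boundary f x0 x1 y0 y1 ->
  (forall y, y0 <= y <= y1 -> {for Complex c y, continuous f}) ->
  rect_int f x0 x1 y0 y1 = rect_int f x0 c y0 y1 + rect_int f c x1 y0 y1.
Proof.
move=> ac cb cf cc.
have c1 : continuous_on_boundary f x0 c y0 y1.
  move=> [x y] [[/= /andP[h1 h2] h]|[/= h [->|->]]]; last exact: cc.
    by apply: cf; left; split => //=; rewrite h1 (le_trans h2).
  by apply: cf; right; split => //=; left.
have c2 : continuous_on_boundary f c x1 y0 y1.
  move=> [x y] [[/= /andP[h1 h2] h]|[/= h [->|->]]]; [|exact: cc|].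
    by apply: cf; left; split => //=; rewrite h2 (le_trans ac).
  by apply: cf; right; split => //=; right.
rewrite !rect_intE//.
have acb : x0 <= c <= x1 by rewrite ac.
rewrite (cint_split acb (cintegrableH cf (or_introl erefl))).
by rewrite (cint_split acb (cintegrableH cf (or_intror erefl))); ring.
Qed.

Lemma rect_int_splity f x0 x1 y0 y1 c : y0 <= c -> c <= y1 ->
  continuous_on_boundary f x0 x1 y0 y1 ->
  (forall x, x0 <= x <= x1 -> {for Complex x c, continuous f}) ->
  rect_int f x0 x1 y0 y1 = rect_int f x0 x1 y0 c + rect_int f x0 x1 c y1.
Proof.
move=> ac cb cf cc.
have c1 : continuous_on_boundary f x0 x1 y0 c.
  move=> [x y] [[/= h [->|->]]|[/= /andP[h1 h2] h]]; [|exact: cc|].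
    by apply: cf; left; split => //=; left.
  by apply: cf; right; split => //=; rewrite h1 (le_trans h2).
have c2 : continuous_on_boundary f x0 x1 c y1.
  move=> [x y] [[/= h [->|->]]|[/= /andP[h1 h2] h]]; [exact: cc| |].
    by apply: cf; left; split => //=; right.
  by apply: cf; right; split => //=; rewrite h2 (le_trans ac).
rewrite !rect_intE//.
have acb : y0 <= c <= y1 by rewrite ac.
rewrite (cint_split acb (cintegrableV cf (or_introl erefl))).
by rewrite (cint_split acb (cintegrableV cf (or_intror erefl))); ring.
Qed.

Lemma rect_intB f g x0 x1 y0 y1 :
  continuous_on_boundary f x0 x1 y0 y1 -> continuous_on_boundary g x0 x1 y0 y1 ->
  rect_int (fun z => f z - g z) x0 x1 y0 y1 =
  rect_int f x0 x1 y0 y1 - rect_int g x0 x1 y0 y1.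
Proof.
move=> cf cg.
have cfg : continuous_on_boundary (fun z => f z - g z) x0 x1 y0 y1.
  by move=> z zr; exact: (continuousB (cf _ zr) (cg _ zr)).
rewrite !rect_intE//.
rewrite (cintB (cintegrableH cf (or_introl erefl)) (cintegrableH cg (or_introl erefl))).
rewrite (cintB (cintegrableH cf (or_intror erefl)) (cintegrableH cg (or_intror erefl))).
rewrite (cintB (cintegrableV cf (or_introl erefl)) (cintegrableV cg (or_introl erefl))).
rewrite (cintB (cintegrableV cf (or_intror erefl)) (cintegrableV cg (or_intror erefl))).
by ring.
Qed.

Lemma rect_intM k f x0 x1 y0 y1 : continuous_on_boundary f x0 x1 y0 y1 ->
  rect_int (fun z => k * f z) x0 x1 y0 y1 = k * rect_int f x0 x1 y0 y1.
Proof.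
move=> cf.
have cfg : continuous_on_boundary (fun z => k * f z) x0 x1 y0 y1.
  by move=> z zr; exact: (continuousM (@cst_continuous _ _ k _) (cf _ zr)).
rewrite !rect_intE//.
rewrite (cintM _ (cintegrableH cf (or_introl erefl))).
rewrite (cintM _ (cintegrableH cf (or_intror erefl))).
rewrite (cintM _ (cintegrableV cf (or_introl erefl))).
rewrite (cintM _ (cintegrableV cf (or_intror erefl))).
by ring.
Qed.

Lemma rect_int_bound f x0 x1 y0 y1 (M : R) : x0 <= x1 -> y0 <= y1 ->
  continuous_on_boundary f x0 x1 y0 y1 ->
  (forall z, rect_boundary x0 x1 y0 y1 z -> cabs (f z) <= M) ->
  cabs (rect_int f x0 x1 y0 y1) <= 4 * (M * ((x1 - x0) + (y1 - y0))).
Proof.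
move=> xx yy cf fM.
rewrite rect_intE//.
have b0 : cabs (cint x0 x1 (fun x => f (Complex x y0))) <= 2 * (M * (x1 - x0)).
  by apply: cabs_cint_le (cintegrableH cf (or_introl erefl)) _ => // x xh;
    apply: fM; left; split => //; left.
have b1 : cabs (cint x0 x1 (fun x => f (Complex x y1))) <= 2 * (M * (x1 - x0)).
  by apply: cabs_cint_le (cintegrableH cf (or_intror erefl)) _ => // x xh;
    apply: fM; left; split => //; right.
have b2 : cabs (cint y0 y1 (fun y => f (Complex x0 y))) <= 2 * (M * (y1 - y0)).
  by apply: cabs_cint_le (cintegrableV cf (or_introl erefl)) _ => // x xh;
    apply: fM; right; split => //; left.
have b3 : cabs (cint y0 y1 (fun y => f (Complex x1 y))) <= 2 * (M * (y1 - y0)).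
  by apply: cabs_cint_le (cintegrableV cf (or_intror erefl)) _ => // x xh;
    apply: fM; right; split => //; right.
apply: le_trans (cabsD _ _) _; rewrite cabsM cabs_i mul1r.
apply: le_trans (lerD (cabs_sub _ _) (cabs_sub _ _)) _.
by apply: le_trans (lerD (lerD b0 b1) (lerD b3 b2)) _; rewrite le_eqVlt; apply/orP; left; apply/eqP; ring.
Qed.

Lemma rect_int_affine (a b : R[i]) x0 x1 y0 y1 : x0 <= x1 -> y0 <= y1 ->
  rect_int (fun z => a + b * z) x0 x1 y0 y1 = 0.
Proof.
move=> xx yy; rewrite /rect_int.
have -> : cint x0 x1 (fun x => a + b * Complex x y0 - (a + b * Complex x y1)) =
    (x1 - x0)%:C * (b * Complex 0 (y0 - y1)).
  rewrite -cint_cst//; apply: eq_cint => x _.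
  rewrite opprD addrACA subrr add0r -mulrBr; congr (_ * _).
  by rewrite Complex_sub subrr.
have -> : cint y0 y1 (fun y => a + b * Complex x1 y - (a + b * Complex x0 y)) =
    (y1 - y0)%:C * (b * Complex (x1 - x0) 0).
  rewrite -cint_cst//; apply: eq_cint => x _.
  rewrite opprD addrACA subrr add0r -mulrBr; congr (_ * _).
  by rewrite Complex_sub subrr.
by case: b => b1 b2; apply/eqP; rewrite eq_complex /=; apply/andP; split; apply/eqP; ring.
Qed.

(* A rectangle is encoded as [((x0, x1), (y0, y1))]. *)
Lemma rect_bisection (P : (R * R) * (R * R) -> Prop) q0 :
  q0.1.1 <= q0.1.2 -> q0.2.1 <= q0.2.2 -> P q0 ->
  (forall q, q.1.1 <= q.1.2 -> q.2.1 <= q.2.2 -> P q ->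
    let xm := (q.1.1 + q.1.2) / 2 in let ym := (q.2.1 + q.2.2) / 2 in
    exists I J, [/\ I = (q.1.1, xm) \/ I = (xm, q.1.2),
      J = (q.2.1, ym) \/ J = (ym, q.2.2) & P (I, J)]) ->
  exists z, forall d : R, 0 < d -> exists q,
    [/\ P q, [/\ q0.1.1 <= q.1.1, q.1.2 <= q0.1.2,
        q0.2.1 <= q.2.1 & q.2.2 <= q0.2.2], rect q.1.1 q.1.2 q.2.1 q.2.2 z,
        (q.1.2 - q.1.1) + (q.2.2 - q.2.1) < d &
        (q.1.1 <= q.1.2) && (q.2.1 <= q.2.2)].
Proof.
move=> hx0 hy0 P0 step.
pose good (q : (R * R) * (R * R)) := [/\ q.1.1 <= q.1.2, q.2.1 <= q.2.2 & P q].
pose sub (q q' : (R * R) * (R * R)) := [/\ q.1.1 <= q'.1.1, q'.1.2 <= q.1.2,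
   q.2.1 <= q'.2.1, q'.2.2 <= q.2.2 &
   (q'.1.2 - q'.1.1) + (q'.2.2 - q'.2.1) = ((q.1.2 - q.1.1) + (q.2.2 - q.2.1)) / 2].
(* The successor function has to be total; on rectangles that are not [good] it is the identity and
   nothing is claimed. *)
have /choice[nx hnx] : forall q, exists q', good q -> good q' /\ sub q q'.
  move=> q.
  have [g|ng] := pselect (good q); last by exists q => /ng.
  case: (g) => a b Pq; have [I [J [hI hJ PIJ]]] := step q a b Pq.
  exists (I, J) => _; split; [split|split] => //=;
    case: hI => hI; case: hJ => hJ; rewrite ?hI ?hJ /=; lra.
pose s k := iter k nx q0.
have sg k : good (s k) by elim: k => [//|k IH]; have [] := hnx _ IH.
have ss k : sub (s k) (s k.+1) by have [] := hnx _ (sg k).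
have [x hx] : exists x, forall k, (s k).1.1 <= x <= (s k).1.2.
  by apply: nested_intervals => k; [have [] := ss k|have [] := ss k|have [] := sg k].
have [y hy] : exists y, forall k, (s k).2.1 <= y <= (s k).2.2.
  by apply: nested_intervals => k; [have [] := ss k|have [] := ss k|have [] := sg k].
have s0 k : [/\ q0.1.1 <= (s k).1.1, (s k).1.2 <= q0.1.2,
    q0.2.1 <= (s k).2.1, (s k).2.2 <= q0.2.2 &
    ((s k).1.2 - (s k).1.1) + ((s k).2.2 - (s k).2.1) =
    ((q0.1.2 - q0.1.1) + (q0.2.2 - q0.2.1)) / 2 ^+ k].
  elim: k => [|k [h1 h2 h3 h4 h5]]; first by rewrite expr0 divr1; split.
  have [a b c d e] := ss k; split.
  - exact: le_trans a.
  - exact: le_trans b _.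
  - exact: le_trans c.
  - exact: le_trans d _.
  by rewrite e h5 exprS invfM -!mulrA [2^-1 * _]mulrC.
exists (Complex x y) => d d0.
have [k hk] := exists_halving_lt ((q0.1.2 - q0.1.1) + (q0.2.2 - q0.2.1)) d0.
have [a b c e h] := s0 k; have [sx sy Ps] := sg k.
exists (s k); split.
- by [].
- by split.
- by split; [exact: hx|exact: hy].
- by rewrite h.
- by rewrite sx.
Qed.

End RectangleIntegral.

(** * Goursat's theorem *)

Section Goursat.
Context {R : realType}.
Implicit Types (f g : R[i]^o -> R[i]^o).

Lemma rect_boundary_sub (x0 x1 y0 y1 : R) : x0 <= x1 -> y0 <= y1 ->
  rect_boundary x0 x1 y0 y1 `<=` rect x0 x1 y0 y1.
Proof.
by move=> xx yy z [[h1 [h2|h2]]|[h1 [h2|h2]]]; split => //; rewrite h2 ?lexx ?andbT ?xx ?yy.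
Qed.

Lemma linear_mul1 (L : {linear R[i]^o -> R[i]^o}) (h : R[i]^o) : L h = L 1 * h.
Proof. by rewrite -[h in LHS]mulr1 -[h * 1]/(h *: (1 : R[i]^o)) linearZ /= mulrC. Qed.

Lemma continuous_affine (a b : R[i]) (z : R[i]^o) :
  {for z, continuous (fun w : R[i]^o => a + b * w : R[i]^o)}.
Proof.
apply/continuous_rnorm => e e0; have b0 := cabs_ge0 b.
exists (e / (cabs b + 1)) => [|w]; first by rewrite divr_gt0// ltr_wpDl.
rewrite rnorm_cabs ltr_pdivlMr ?ltr_wpDl// => h.
rewrite opprD addrACA subrr add0r -mulrBr cabsM.
by have := cabs_ge0 (w - z); nra.
Qed.

(** Bisection with the invariant that the integral has modulus at least [kap * W ^+ 2], where [W] is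
    the half-perimeter. [W] halves at each step, so one of the four quarters inherits the invariant.
    Near the limit point [f] differs little from an affine function, whose integral vanishes, and
    the invariant breaks down. *)
Lemma goursat f (x0 x1 y0 y1 : R) : x0 < x1 -> y0 < y1 ->
  (forall z, rect x0 x1 y0 y1 z -> differentiable f z) -> rect_int f x0 x1 y0 y1 = 0.
Proof.
move=> xx yy df; apply/eqP; rewrite -cabs_eq0; apply/negPn/negP => nz.
set eta := cabs (rect_int f x0 x1 y0 y1) in nz.
have eta0 : 0 < eta by rewrite lt_neqAle eq_sym nz cabs_ge0.
pose W (q : (R * R) * (R * R)) := (q.1.2 - q.1.1) + (q.2.2 - q.2.1).
pose I (q : (R * R) * (R * R)) := rect_int f q.1.1 q.1.2 q.2.1 q.2.2.
pose q0 := ((x0, x1), (y0, y1)).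
have W0 : 0 < W q0 by rewrite /W /=; lra.
pose kap := eta / W q0 ^+ 2.
have kap0 : 0 < kap by rewrite divr_gt0// exprn_gt0.
pose P q := [/\ kap * W q ^+ 2 <= cabs (I q), 0 < W q,
  x0 <= q.1.1 /\ q.1.2 <= x1 & y0 <= q.2.1 /\ q.2.2 <= y1].
have cf x0' x1' y0' y1' : x0 <= x0' -> x0' <= x1' -> x1' <= x1 -> y0 <= y0' ->
    y0' <= y1' -> y1' <= y1 -> forall z, rect x0' x1' y0' y1' z -> {for z, continuous f}.
  move=> a1 a2 a3 a4 a5 a6 z [/andP[h1 h2] /andP[h3 h4]].
  apply/differentiable_continuous/df; split; apply/andP; split; lra.
have [||z hz] := @rect_bisection R P q0 (ltW xx) (ltW yy).
- split => //=; first by rewrite /kap divfK// expf_neq0// gt_eqF.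
- move=> [[a b] [c d]] /= ab cd [h1 h2 [h3 h4] [h5 h6]].
  set xm := (a + b) / 2; set ym := (c + d) / 2.
  have E : I ((a, b), (c, d)) = I ((a, xm), (c, ym)) + I ((a, xm), (ym, d)) +
     (I ((xm, b), (c, ym)) + I ((xm, b), (ym, d))).
    have Bd u v s t : a <= u -> u <= v -> v <= b -> c <= s -> s <= t -> t <= d ->
       forall z, rect u v s t z -> {for z, continuous f}.
      by move=> *; apply: (cf u v s t) => //=; move: h3 h4 h5 h6 => /=; lra.
    have CB u v s t : a <= u -> u <= v -> v <= b -> c <= s -> s <= t -> t <= d ->
       continuous_on_boundary f u v s t.
      by move=> l1 l2 l3 l4 l5 l6 w /(rect_boundary_sub l2 l5); exact: Bd.
    have [axm xmb] : a <= xm /\ xm <= b by rewrite /xm; lra.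
    have [cym ymd] : c <= ym /\ ym <= d by rewrite /ym; lra.
    have s1 : rect_int f a b c d = rect_int f a xm c d + rect_int f xm b c d.
      apply: rect_int_splitx => //; first exact: CB.
      by move=> y hy; apply: (Bd a b c d) => //; split => //=; rewrite axm.
    have s2 : rect_int f a xm c d = rect_int f a xm c ym + rect_int f a xm ym d.
      apply: rect_int_splity => //; first exact: CB.
      by move=> x hx; apply: (Bd a xm c d) => //; split => //=; rewrite cym.
    have s3 : rect_int f xm b c d = rect_int f xm b c ym + rect_int f xm b ym d.
      apply: rect_int_splity => //; first exact: CB.
      by move=> x hx; apply: (Bd xm b c d) => //; split => //=; rewrite cym.
    by rewrite /I /= s1 s2 s3.
  have [[p Pp]|none] := pselect (exists p : bool * bool,
     kap * (W ((a, b), (c, d)) / 2) ^+ 2 <=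
     cabs (I ((if p.1 then (a, xm) else (xm, b)), (if p.2 then (c, ym) else (ym, d))))).
    exists (if p.1 then (a, xm) else (xm, b)), (if p.2 then (c, ym) else (ym, d)).
    move: h2 h3 h4 h5 h6; rewrite /W /= => h2 h3 h4 h5 h6.
    have Wp : W ((if p.1 then (a, xm) else (xm, b)), (if p.2 then (c, ym) else (ym, d)))
       = W ((a, b), (c, d)) / 2.
      by rewrite /W; case: p.1; case: p.2; rewrite /= /xm /ym; lra.
    split; [by case: p.1; [left|right]|by case: p.2; [left|right]|split].
    + by rewrite Wp.
    + by rewrite Wp /W /=; lra.
    + by case: p.1; split; rewrite /= /xm; lra.
    + by case: p.2; split; rewrite /= /ym; lra.
  have lt p1 p2 : cabs (I ((if p1 then (a, xm) else (xm, b)), (if p2 then (c, ym) else (ym, d))))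
     < kap * (W ((a, b), (c, d)) / 2) ^+ 2.
    by rewrite ltNge; apply/negP => h; apply: none; exists (p1, p2).
  have := h1; rewrite E.
  have := cabsD (I ((a, xm), (c, ym)) + I ((a, xm), (ym, d))) (I ((xm, b), (c, ym)) + I ((xm, b), (ym, d))).
  have := cabsD (I ((a, xm), (c, ym))) (I ((a, xm), (ym, d))).
  have := cabsD (I ((xm, b), (c, ym))) (I ((xm, b), (ym, d))).
  have := lt true true; have := lt true false; have := lt false true; have := lt false false.
  move: (W _) => w /=.
  move: (I ((a, xm), (c, ym))) (I ((a, xm), (ym, d))) (I ((xm, b), (c, ym))) (I ((xm, b), (ym, d))).
  move=> A1 A2 A3 A4.
  have -> : kap * (w / 2) ^+ 2 = kap * w ^+ 2 / 4 by field.
  by lra.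
(* An error of [kap / 8] per unit of distance, at points at distance at most [W], gives through
   [rect_int_bound] the value [kap * W ^+ 2 / 2], half of what the invariant demands. *)
have e0 : 0 < kap / 8 by rewrite divr_gt0.
have z0 : rect x0 x1 y0 y1 z.
  have [q [_ [h1 h2 h3 h4] [/andP[h5 h6] /andP[h7 h8]] _ _]] := hz 1 ltr01.
  by move: h1 h2 h3 h4 => /= h1 h2 h3 h4; split; apply/andP; split; lra.
have [d d0 hd] := differentiable_rnorm (df z z0) e0.
have [[[a b] [c e]] [[P1 P2 _ _] [h1 h2 h3 h4] [/= /andP[h5 h6] /andP[h7 h8]] wd /andP[ab ce]]] := hz d d0.
rewrite /= in P1 P2 h1 h2 h3 h4 wd ab ce.
set L := 'd f z in hd.
pose g : R[i]^o -> R[i]^o := fun w => (f z - L 1 * z) + L 1 * w.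
have cfb : continuous_on_boundary f a b c e.
  by move=> w /(rect_boundary_sub ab ce); exact: cf.
have cgb : continuous_on_boundary g a b c e.
  by move=> w _; exact: continuous_affine.
have Ifg : I ((a, b), (c, e)) = rect_int (fun w => f w - g w) a b c e.
  by rewrite rect_intB// rect_int_affine// subr0.
move: P1; rewrite Ifg; apply/negP; rewrite -ltNge.
set w := W _.
have := @rect_int_bound _ (fun w => f w - g w) a b c e (kap / 8 * w) ab ce.
move=> /(_ _ _)/le_lt_trans; apply.
- by move=> u ub; exact: (continuousB (cfb _ ub) (cgb _ ub)).
- move=> u /(rect_boundary_sub ab ce) [/andP[u1 u2] /andP[u3 u4]].
  have uz : cabs (u - z) <= w.
    apply: le_trans (cabs_le_ReIm _) _; rewrite ReD ReN ImD ImN; apply: lerD; rewrite /= ler_norml; lra.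
  have -> : f u - g u = f (z + (u - z)) - f z - L (u - z).
    by rewrite (linear_mul1 L (u - z)) [z + _]addrC subrK /g; ring.
  apply: le_trans (hd _ _) _; rewrite rnorm_cabs; first exact: le_lt_trans uz _.
  by apply: ler_wpM2l => //; exact: ltW.
have -> : b - a + (e - c) = w by [].
have w0 : 0 < w by [].
rewrite expr2 (_ : 4 * _ = kap * (w * w) / 2); last by field.
by have := mulr_gt0 kap0 (mulr_gt0 w0 w0); lra.
Qed.

End Goursat.

(** * Cauchy's formula at an interior point *)

Section Cauchy.
Context {R : realType}.
Implicit Types (f g : R[i]^o -> R[i]^o).

(** Cut the outer rectangle along [x = u0] and [x = u1], then the middle strip along [y = v0] and
    [y = v1]. Besides the inner rectangle this leaves four rectangles, on each of which Goursat's
    theorem applies. *)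
Lemma rect_int_annulus f (x0 x1 y0 y1 u0 u1 v0 v1 : R) :
  x0 < u0 -> u0 < u1 -> u1 < x1 -> y0 < v0 -> v0 < v1 -> v1 < y1 ->
  (forall z, rect x0 x1 y0 y1 z -> ~ (u0 < Re z < u1 /\ v0 < Im z < v1) ->
    differentiable f z) ->
  rect_int f x0 x1 y0 y1 = rect_int f u0 u1 v0 v1.
Proof.
move=> a1 a2 a3 b1 b2 b3 df.
have dfx x y : x0 <= x <= x1 -> y0 <= y <= y1 -> (x <= u0 \/ u1 <= x) \/ (y <= v0 \/ v1 <= y) ->
    differentiable f (Complex x y : R[i]^o).
  move=> hx hy h; apply: df; first by split.
  move=> /= [/andP[? ?] /andP[? ?]]; lra.
have cfx x y : x0 <= x <= x1 -> y0 <= y <= y1 -> (x <= u0 \/ u1 <= x) \/ (y <= v0 \/ v1 <= y) ->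
    {for (Complex x y : R[i]^o), continuous f}.
  by move=> *; apply: differentiable_continuous; exact: dfx.
have cb p q r s : x0 <= p -> p <= q -> q <= x1 -> y0 <= r -> r <= s -> s <= y1 ->
   (p <= u0 \/ u1 <= p) -> (q <= u0 \/ u1 <= q) -> (r <= v0 \/ v1 <= r) -> (s <= v0 \/ v1 <= s) ->
   continuous_on_boundary f p q r s.
  move=> c1 c2 c3 c4 c5 c6 d1 d2 d3 d4 [x y] [[/= /andP[e1 e2] [->|->]]|[/= /andP[e1 e2] [->|->]]];
    apply: cfx; first [by apply/andP; split; lra | by right | by left].
have e1 : rect_int f x0 x1 y0 y1 = rect_int f x0 u0 y0 y1 + rect_int f u0 x1 y0 y1.
  apply: rect_int_splitx; [lra|lra| |].
    by apply: cb; lra.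
  by move=> y hy; apply: cfx => //; [apply/andP; split; lra|left; left].
have e2 : rect_int f u0 x1 y0 y1 = rect_int f u0 u1 y0 y1 + rect_int f u1 x1 y0 y1.
  apply: rect_int_splitx; [lra|lra| |].
    by apply: cb; lra.
  by move=> y hy; apply: cfx => //; [apply/andP; split; lra|left; right].
have e3 : rect_int f u0 u1 y0 y1 = rect_int f u0 u1 y0 v0 + rect_int f u0 u1 v0 y1.
  apply: rect_int_splity; [lra|lra| |].
    by apply: cb; lra.
  move=> x /andP[? ?]; apply: cfx => //; [apply/andP; split; lra|apply/andP; split; lra|right; left => //].
have e4 : rect_int f u0 u1 v0 y1 = rect_int f u0 u1 v0 v1 + rect_int f u0 u1 v1 y1.
  apply: rect_int_splity; [lra|lra| |].
    by apply: cb; lra.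
  move=> x /andP[? ?]; apply: cfx => //; [apply/andP; split; lra|apply/andP; split; lra|right; right => //].
rewrite e1 e2 e3 e4 (@goursat _ f x0 u0); [|lra|lra|]; last first.
  by move=> [x y] [/= /andP[? ?] /andP[? ?]]; apply: dfx;
    [apply/andP; split; lra|apply/andP; split; lra|left; left].
rewrite (@goursat _ f u1 x1); [|lra|lra|]; last first.
  by move=> [x y] [/= /andP[? ?] /andP[? ?]]; apply: dfx;
    [apply/andP; split; lra|apply/andP; split; lra|left; right].
rewrite (@goursat _ f u0 u1 y0 v0); [|lra|lra|]; last first.
  by move=> [x y] [/= /andP[? ?] /andP[? ?]]; apply: dfx;
    [apply/andP; split; lra|apply/andP; split; lra|right; left].
rewrite (@goursat _ f u0 u1 v1 y1); [|lra|lra|]; last first.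
  by move=> [x y] [/= /andP[? ?] /andP[? ?]]; apply: dfx;
    [apply/andP; split; lra|apply/andP; split; lra|right; right].
by rewrite !add0r !addr0.
Qed.

Lemma differentiable_cauchy_kernel f (a z : R[i]^o) : differentiable f z -> z != a ->
  differentiable (fun w : R[i]^o => (f w * (w - a)^-1 : R[i]^o)) z.
Proof.
move=> df za.
have h : differentiable (fun w : R[i]^o => (w - a : R[i]^o)) z.
  by apply: differentiableB.
by apply: (differentiableM df); apply: (differentiableV h); rewrite subr_eq0.
Qed.

Lemma differentiable_pole f (z : R[i]^o) m : differentiable f z -> z != 0 ->
  differentiable (fun w : R[i]^o => (f w * w ^- m : R[i]^o)) z.
Proof.
move=> df z0.
have h : differentiable (fun w : R[i]^o => (w ^+ m : R[i]^o)) z.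
  elim: m => [|m IH]; first exact: differentiable_cst.
  have -> : (fun w : R[i]^o => (w ^+ m.+1 : R[i]^o)) = (fun w : R[i]^o => w * w ^+ m).
    by apply/funext => w; rewrite exprS.
  exact: differentiableM.
by apply: (differentiableM df); apply: (differentiableV h); rewrite expf_neq0.
Qed.

Lemma rect_boundary_neq (x0 x1 y0 y1 : R) (a z : R[i]^o) :
  x0 < Re a < x1 -> y0 < Im a < y1 -> rect_boundary x0 x1 y0 y1 z -> z != a.
Proof.
move=> /andP[h1 h2] /andP[h3 h4] zb; apply/eqP => za; move: zb; rewrite za.
by case=> [[_ [h|h]]|[_ [h|h]]]; move: h1 h2 h3 h4; rewrite h ltxx.
Qed.

(** On the sides of the square [u ^+ 2 + s ^+ 2 <= 2 * s ^+ 2], so the two integrands coming from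
    opposite sides add up to at least [s^-1] in the component that feeds the imaginary part of the
    total. Over a length [2 * s] each of the two pairs of sides contributes at least 2. *)
Lemma kernel_lower_bound (a : R[i]^o) (s : R) : 0 < s ->
  4 <= cabs (rect_int (fun z => (z - a)^-1) (Re a - s) (Re a + s) (Im a - s) (Im a + s)).
Proof.
move=> s0; case: a => p q /=.
set f : R[i]^o -> R[i]^o := fun z => _.
have cf : continuous_on_boundary f (p - s) (p + s) (q - s) (q + s).
  move=> z zb; apply: differentiable_continuous.
  have -> : f = (fun w : R[i]^o => cst 1 w * (w - Complex p q)^-1) by apply/funext => w; rewrite mul1r.
  apply: differentiable_cauchy_kernel => //.
  by apply: rect_boundary_neq zb => /=; lra.
have int (h k : R -> R[i]^o) a b : cintegrable a b h -> cintegrable a b k ->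
   cintegrable a b (fun x => h x - k x).
  by move=> hi ki; apply: cintegrableD => //; exact: cintegrableN.
have hH := int _ _ _ _ (cintegrableH cf (or_introl erefl)) (cintegrableH cf (or_intror erefl)).
have hV := int _ _ _ _ (cintegrableV cf (or_intror erefl)) (cintegrableV cf (or_introl erefl)).
have key (u : R) : - s <= u <= s -> s^-1 <= s / (u ^+ 2 + s ^+ 2) + s / (u ^+ 2 + s ^+ 2).
  move=> /andP[u1 u2].
  have d0 : 0 < u ^+ 2 + s ^+ 2 by have := sqr_ge0 u; have := exprn_gt0 2 s0; lra.
  rewrite -mulrDl ler_pdivlMr// -ler_pdivlMl ?invr_gt0// invrK; nra.
have cst_int (k : R) a b : (@lebesgue_measure R).-integrable `[a, b] (EFin \o (fun=> k)).
  by apply: real_seg_continuous_integrable => x _ e e0; exists 1 => // y _; rewrite subrr normr0.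
have cstE (k : R) a b : a <= b -> \int[lebesgue_measure]_(x in `[a, b]) k = k * (b - a).
  move=> ab; have := congr1 (@complex.Re R) (cint_cst k%:C ab).
  by rewrite /= mul0r subr0 (mulrC (b - a)).
have B1 : 2 <= Im (cint (p - s) (p + s) (fun x => f (Complex x (q - s)) - f (Complex x (q + s)))).
  apply: (@le_trans _ _ (\int[lebesgue_measure]_(x in `[p - s, p + s]) s^-1)).
    rewrite cstE; [|lra]; rewrite (_ : _ - _ = s * 2); last by ring.
    by rewrite mulrA mulVf ?mul1r// gt_eqF.
  rewrite /=; apply: le_Rintegral; [by []|exact: cst_int|exact: hH.2|].
  move=> x; rewrite /= in_itv /= => /andP[x1 x2].
  have := key (x - p) _; rewrite (_ : - s <= x - p <= s); last by lra.
  move=> /(_ isT); rewrite opprK.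
  have -> : q - s - q = - s by ring.
  have -> : q + s - q = s by ring.
  by rewrite sqrrN mulNr opprK.
have B2 : 2 <= Re (cint (q - s) (q + s) (fun y => f (Complex (p + s) y) - f (Complex (p - s) y))).
  apply: (@le_trans _ _ (\int[lebesgue_measure]_(x in `[q - s, q + s]) s^-1)).
    rewrite cstE; [|lra]; rewrite (_ : _ - _ = s * 2); last by ring.
    by rewrite mulrA mulVf ?mul1r// gt_eqF.
  rewrite /=; apply: le_Rintegral; [by []|exact: cst_int|exact: hV.1|].
  move=> x; rewrite /= in_itv /= => /andP[x1 x2].
  have := key (x - q) _; rewrite (_ : - s <= x - q <= s); last by lra.
  move=> /(_ isT).
  have -> : p - s - p = - s by ring.
  have -> : p + s - p = s by ring.
  by rewrite sqrrN mulNr opprK (addrC (s ^+ 2)).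
apply: le_trans (Im_le_cabs _); rewrite /rect_int.
set A := cint _ _ _; set B := cint _ _ _.
have -> : Im (A + 'i%C * B) = Im A + Re B.
  by rewrite ImD; case: B {B2} => b1 b2 /=; rewrite mul0r mul1r add0r.
by apply: le_trans (ler_norm _); move: B1 B2; rewrite -/A -/B; lra.
Qed.

Lemma cabs_le_all_eq0 (z : R[i]) : (forall e : R, 0 < e -> cabs z <= e) -> z = 0.
Proof.
move=> h; apply/eqP; rewrite -cabs_eq0; apply/negPn/negP => nz.
have z0 : 0 < cabs z by rewrite lt_neqAle eq_sym nz cabs_ge0.
by have := h (cabs z / 2); rewrite divr_gt0// => /(_ isT); lra.
Qed.

Lemma square_boundary_dist (a z : R[i]^o) (s : R) : 0 < s ->
  rect_boundary (Re a - s) (Re a + s) (Im a - s) (Im a + s) z ->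
  s <= cabs (z - a) <= 2 * s.
Proof.
move=> s0 zb; apply/andP; split.
  have h1 := Re_le_cabs (z - a); have h2 := Im_le_cabs (z - a).
  move: h1 h2; rewrite ReD ImD ReN ImN.
  case: zb => [[_ [->|->]]|[_ [->|->]]].
  - by rewrite addrAC subrr add0r normrN (gtr0_norm s0).
  - by rewrite addrAC subrr add0r (gtr0_norm s0).
  - by rewrite addrAC subrr add0r normrN (gtr0_norm s0).
  - by rewrite addrAC subrr add0r (gtr0_norm s0).
apply: le_trans (cabs_le_ReIm _) _; rewrite ReD ImD ReN ImN mulr_natl mulr2n.
have [] : rect (Re a - s) (Re a + s) (Im a - s) (Im a + s) z.
  by apply: rect_boundary_sub zb; lra.
by move=> /andP[? ?] /andP[? ?]; apply: lerD; rewrite ler_norml; lra.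
Qed.

Lemma differentiable_kernel (a z : R[i]^o) : z != a ->
  differentiable (fun w : R[i]^o => ((w - a)^-1 : R[i]^o)) z.
Proof.
move=> za; have -> : (fun w : R[i]^o => ((w - a)^-1 : R[i]^o)) = (fun w => cst 1 w * (w - a)^-1).
  by apply/funext => w; rewrite mul1r.
exact: differentiable_cauchy_kernel.
Qed.

Lemma continuous_on_boundaryM k f x0 x1 y0 y1 : continuous_on_boundary f x0 x1 y0 y1 ->
  continuous_on_boundary (fun z => k * f z) x0 x1 y0 y1.
Proof. by move=> cf z zb; exact: (continuousM (@cst_continuous _ _ k _) (cf _ zb)). Qed.

Lemma continuous_on_boundaryB f g x0 x1 y0 y1 : continuous_on_boundary f x0 x1 y0 y1 ->
  continuous_on_boundary g x0 x1 y0 y1 ->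
  continuous_on_boundary (fun z => f z - g z) x0 x1 y0 y1.
Proof. by move=> cf cg z zb; exact: (continuousB (cf _ zb) (cg _ zb)). Qed.

(** The small square is chosen before the integrand [h], so that the same [s] serves the kernel and
    its product with [f]. The bound [c] lets the square be taken as small as an estimate
    requires. *)
Lemma rect_int_punctured (a : R[i]^o) (x0 x1 y0 y1 c : R) :
  x0 < Re a < x1 -> y0 < Im a < y1 -> 0 < c -> exists s : R, [/\ 0 < s, s <= c,
    rect (Re a - s) (Re a + s) (Im a - s) (Im a + s) `<=` rect x0 x1 y0 y1 &
    forall h, (forall z, rect x0 x1 y0 y1 z -> z != a -> differentiable h z) ->
      rect_int h x0 x1 y0 y1 = rect_int h (Re a - s) (Re a + s) (Im a - s) (Im a + s)].
Proof.
move=> /andP[hx1 hx2] /andP[hy1 hy2] c0.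
have [m m0 [m1 m2 m3 m4]] : exists2 m : R, 0 < m &
    [/\ m <= Re a - x0, m <= x1 - Re a, m <= Im a - y0 & m <= y1 - Im a].
  exists (Num.min (Num.min (Re a - x0) (x1 - Re a)) (Num.min (Im a - y0) (y1 - Im a))).
    by rewrite !lt_min !subr_gt0 hx1 hx2 hy1.
  by split; rewrite !ge_min lexx ?orbT.
have [s s0 [sm sc]] : exists2 s : R, 0 < s & s < m /\ s <= c.
  exists (Num.min (m / 2) c); first by rewrite lt_min divr_gt0.
  split; last by rewrite ge_min lexx orbT.
  by apply: (@le_lt_trans _ _ (m / 2)); [rewrite ge_min lexx|lra].
exists s; split => // [z [/andP[z1 z2] /andP[z3 z4]]|h dh].
  by clear -sm m1 m2 m3 m4 z1 z2 z3 z4; split; apply/andP; split; lra.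
apply: rect_int_annulus; [| | | | | |move=> z zr hz]; try (clear -s0 sm m1 m2 m3 m4; lra).
apply: (dh z zr); apply/eqP => za; apply: hz; rewrite za.
by clear -s0; split; apply/andP; split; lra.
Qed.

(** By differentiability at [a] the quotient [(f z - f a) / (z - a)] is bounded by [M] near [a], so
    its integral over a small square around [a] tends to 0 with the side of the square. *)
Lemma cauchy_formula f (x0 x1 y0 y1 : R) (a : R[i]^o) :
  (forall z, rect x0 x1 y0 y1 z -> differentiable f z) ->
  x0 < Re a < x1 -> y0 < Im a < y1 ->
  rect_int (fun z => f z * (z - a)^-1) x0 x1 y0 y1 =
  f a * rect_int (fun z => (z - a)^-1) x0 x1 y0 y1.
Proof.
move=> df ax ay; pose k : R[i]^o -> R[i]^o := fun z => (z - a)^-1.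
have fa : differentiable f a.
  by move: ax ay => /andP[? ?] /andP[? ?]; apply: df; split; apply/andP; split; exact: ltW.
have [d d0 hd] := differentiable_rnorm fa ltr01.
set L := 'd f a in hd.
pose M := cabs (L 1) + 1.
have M0 : 0 < M by rewrite ltr_wpDl ?cabs_ge0.
apply/eqP; rewrite -subr_eq0; apply/eqP; apply: cabs_le_all_eq0 => e e0.
(* The bound [d / 4] keeps the boundary, at distance at most [2 * s] from [a], inside the ball of
   differentiability. The bound [e / (16 * M)] is adapted to [rect_int_bound], which yields
   [16 * M * s] on a square of side [2 * s]. *)
have [|s [s0 sc sq ann]] := @rect_int_punctured a x0 x1 y0 y1
    (Num.min (d / 4) (e / (16 * M))) ax ay.
  by rewrite lt_min !divr_gt0// mulr_gt0.
have p16 : 0 < 16 * M by rewrite mulr_gt0.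
move: sc; rewrite le_min (ler_pdivlMr _ _ p16) => /andP[sd se].
have {}sd : 2 * s < d by clear -sd d0; lra.
have ha : Re a - s < Re a < Re a + s /\ Im a - s < Im a < Im a + s.
  by clear -s0; split; apply/andP; split; lra.
have E1 : rect_int (fun z => f z * (z - a)^-1) x0 x1 y0 y1 =
    rect_int (fun z => f z * (z - a)^-1) (Re a - s) (Re a + s) (Im a - s) (Im a + s).
  by apply: ann => z zr za; exact: differentiable_cauchy_kernel (df z zr) za.
have E2 : rect_int k x0 x1 y0 y1 = rect_int k (Re a - s) (Re a + s) (Im a - s) (Im a + s).
  by apply: ann => z zr za; exact: differentiable_kernel.
have le_s : Re a - s <= Re a + s /\ Im a - s <= Im a + s.
  by clear -s0; split; lra.
have bn z : rect_boundary (Re a - s) (Re a + s) (Im a - s) (Im a + s) z -> z != a.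
  by case: ha => ? ?; exact: rect_boundary_neq.
have br z : rect_boundary (Re a - s) (Re a + s) (Im a - s) (Im a + s) z -> rect x0 x1 y0 y1 z.
  by case: le_s => ? ? /rect_boundary_sub h; apply: sq; exact: h.
have c1 : continuous_on_boundary (fun z => f z * (z - a)^-1) (Re a - s) (Re a + s) (Im a - s) (Im a + s).
  move=> z zb; apply: differentiable_continuous; apply: differentiable_cauchy_kernel; last exact: bn.
  exact/df/br.
have c2 : continuous_on_boundary k (Re a - s) (Re a + s) (Im a - s) (Im a + s).
  by move=> z zb; apply: differentiable_continuous; apply: differentiable_kernel; exact: bn.
have c3 := @continuous_on_boundaryM (f a) _ _ _ _ _ c2.
have c4 := continuous_on_boundaryB c1 c3.
have E3 := rect_intM (f a) c2.
have E4 := rect_intB c1 c3.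
rewrite E1 -[X in _ - f a * X]/(rect_int k x0 x1 y0 y1) E2 -E3 -E4.
case: le_s => l1 l2.
have B : forall z, rect_boundary (Re a - s) (Re a + s) (Im a - s) (Im a + s) z ->
    cabs (f z * (z - a)^-1 - f a * k z) <= M.
  move=> z zb; have /andP[za1 za2] := square_boundary_dist s0 zb.
  rewrite -mulrBl cabsM cabsV ler_pdivrMr; last exact: lt_le_trans za1.
  have := hd (z - a); rewrite rnorm_cabs => /(_ (le_lt_trans za2 sd)).
  rewrite mul1r [a + _]addrC subrK (linear_mul1 L) => h.
  have -> : f z - f a = (f z - f a - L 1 * (z - a)) + L 1 * (z - a) by rewrite subrK.
  by apply: le_trans (cabsD _ _) _; rewrite cabsM /M mulrDl mul1r addrC lerD.
apply: le_trans (rect_int_bound l1 l2 c4 B) _.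
have -> : 4 * (M * (Re a + s - (Re a - s) + (Im a + s - (Im a - s)))) = s * (16 * M) by ring.
exact: se.
Qed.

Lemma kernel_rect_lower_bound (x0 x1 y0 y1 : R) (a : R[i]^o) :
  x0 < Re a < x1 -> y0 < Im a < y1 ->
  4 <= cabs (rect_int (fun z => (z - a)^-1) x0 x1 y0 y1).
Proof.
move=> ax ay; have [s [s0 _ _ ->]] := rect_int_punctured ax ay ltr01.
  exact: kernel_lower_bound.
by move=> z _; exact: differentiable_kernel.
Qed.

End Cauchy.

(** * Quantitative consequences of Cauchy's formula on the square of half-side 2 *)

Section CauchySquare.
Context {R : realType}.
Implicit Types (f g : R[i]^o -> R[i]^o).

(* Its value, [2 i pi], is not needed, only the lower bound [4] of its modulus. *)
Definition cauchy_const : R[i] := rect_int (fun z => z^-1) (-2) 2 (-2) 2.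

Lemma inv_subr0 : (fun z : R[i]^o => z^-1 : R[i]^o) = (fun z : R[i]^o => (z - 0)^-1 : R[i]^o).
Proof. by apply/funext => z; rewrite subr0. Qed.

Lemma square2_boundary (z t : R[i]^o) : rect_boundary (-2) 2 (-2) 2 z -> cabs t <= 1 ->
  2 <= cabs z /\ 1 <= cabs (z - t).
Proof.
move=> zb t1; have := @square_boundary_dist _ 0 z 2 (ltr0Sn _ 1).
rewrite /= !add0r subr0 => /(_ zb)/andP[h _]; split => //.
by apply: le_trans (cabs_dist _ _); lra.
Qed.

(** The difference [1/(z - t) - 1/z] is of order [|z|^-2]. Its integral is unchanged when the square
    is enlarged to half-side [N], where it is of order [1/N]. *)
Lemma rect2_kernel (t : R[i]^o) : cabs t <= 1 ->
  rect_int (fun z => (z - t)^-1) (-2) 2 (-2) 2 = cauchy_const.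
Proof.
move=> t1; apply/eqP; rewrite -subr_eq0; apply/eqP/cabs_le_all_eq0 => e e0.
have k_diff (u z : R[i]^o) : z != u -> differentiable (fun z : R[i]^o => ((z - u)^-1 : R[i]^o)) z.
  move=> zu; have -> : (fun w : R[i]^o => ((w - u)^-1 : R[i]^o)) = (fun w : R[i]^o => cst 1 w * (w - u)^-1).
    by apply/funext => w; rewrite mul1r.
  exact: differentiable_cauchy_kernel.
have Ret : - 1 <= Re t <= 1 by rewrite -ler_norml; exact: le_trans (Re_le_cabs _) _.
have Imt : - 1 <= Im t <= 1 by rewrite -ler_norml; exact: le_trans (Im_le_cabs _) _.
have cb (u : R[i]^o) N : 1 < N -> cabs u <= 1 ->
    continuous_on_boundary (fun z => (z - u)^-1) (- N) N (- N) N.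
  move=> N1 u1 z zb; apply/differentiable_continuous/k_diff.
  apply: rect_boundary_neq zb;
   [have := Re_le_cabs u|have := Im_le_cabs u]; move/le_trans/(_ u1); rewrite ler_norml; lra.
have E : cauchy_const = rect_int (fun z : R[i]^o => (z - 0)^-1) (-2) 2 (-2) 2.
  by rewrite /cauchy_const inv_subr0.
have z1 : cabs (0 : R[i]) <= 1 by rewrite cabs0.
have l12 : (1 : R) < 2 by lra.
rewrite E -(rect_intB (cb t 2 l12 t1) (cb 0 2 l12 z1)).
(* The integral over the large square is at most [16 / (N - 1)]. *)
pose N := 3 + 16 / e.
have N3 : 3 < N by rewrite /N ltrDl divr_gt0.
rewrite -(@rect_int_annulus _ _ (- N) N (- N) N); try lra; last first.
  move=> z zr hz.
  have zn (u : R[i]^o) : cabs u <= 1 -> z != u.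
    move=> u1; apply/eqP => zu; apply: hz; rewrite zu.
    have := le_trans (Re_le_cabs u) u1; have := le_trans (Im_le_cabs u) u1.
    by rewrite !ler_norml => /andP[? ?] /andP[? ?]; split; apply/andP; split; lra.
  by apply: (differentiableB (k_diff _ _ (zn _ t1)) (k_diff _ _ (zn _ z1))).
have N0 : 0 < N by lra.
apply: le_trans (@rect_int_bound _ _ _ _ _ _ ((N - 1)^-1 * N^-1) _ _ _ _) _; try lra.
- move=> z zb; apply: (continuousB (cb _ N _ t1 _ zb) (cb _ N _ z1 _ zb)); lra.
- move=> z zb; have := @square_boundary_dist _ 0 z N N0.
  rewrite /= !add0r subr0 => /(_ zb)/andP[h _].
  have zt : N - 1 <= cabs (z - t) by apply: le_trans (cabs_dist _ _); lra.
  have z0 : z != 0 by rewrite -cabs_gt0; lra.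
  have zt0 : z - t != 0 by rewrite -cabs_gt0; lra.
  have -> : (z - t)^-1 - z^-1 = t * ((z - t)^-1 * z^-1) by field; rewrite ?z0 ?zt0.
  rewrite !cabsM !cabsV -[leRHS]mul1r; apply: ler_pM => //; rewrite ?cabs_ge0 ?mulr_ge0 ?invr_ge0 ?cabs_ge0//.
  apply: ler_pM; rewrite ?invr_ge0 ?cabs_ge0 //; rewrite lef_pV2// posrE; lra.
have -> : 4 * ((N - 1)^-1 / N * (N - - N + (N - - N))) = 16 / (N - 1).
  by field; apply/andP; split; apply/eqP; lra.
rewrite ler_pdivrMr; last lra.
have -> : e * (N - 1) = 16 + 2 * e by rewrite /N; field; apply/eqP; lra.
by lra.
Qed.

Lemma cauchy_const_ge : 4 <= cabs cauchy_const.
Proof.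
have := @kernel_lower_bound R 0 2 (ltr0Sn _ 1).
by rewrite /= !add0r -inv_subr0.
Qed.

Lemma cauchy_formula2 g (t : R[i]^o) :
  (forall z, rect (-2) 2 (-2) 2 z -> differentiable g z) -> cabs t <= 1 ->
  rect_int (fun z => g z * (z - t)^-1) (-2) 2 (-2) 2 = cauchy_const * g t.
Proof.
move=> dg t1.
have Ret : - 1 <= Re t <= 1 by rewrite -ler_norml; exact: le_trans (Re_le_cabs _) _.
have Imt : - 1 <= Im t <= 1 by rewrite -ler_norml; exact: le_trans (Im_le_cabs _) _.
rewrite cauchy_formula//; [|lra|lra].
by rewrite rect2_kernel// mulrC.
Qed.

Lemma cauchy_continuous2 g (t : R[i]^o) m :
  (forall z, rect (-2) 2 (-2) 2 z -> differentiable g z) -> cabs t <= 1 ->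
  continuous_on_boundary (fun z => g z * z ^- m * (z - t)^-1) (-2) 2 (-2) 2.
Proof.
move=> dg t1 z zb; apply: differentiable_continuous.
have [z2 zt] := square2_boundary zb t1.
apply: differentiable_cauchy_kernel; last first.
  by rewrite -subr_eq0 -cabs_gt0; lra.
apply: differentiable_pole; last by rewrite -cabs_gt0; lra.
by apply: dg; apply: rect_boundary_sub zb; lra.
Qed.

Lemma mul_pole0 g (t : R[i]^o) :
  (fun z : R[i]^o => g z * z ^- 0 * (z - t)^-1 : R[i]^o) =
  (fun z : R[i]^o => g z * (z - t)^-1 : R[i]^o).
Proof. by apply/funext => z; rewrite expr0 invr1 mulr1. Qed.

(** Insert [1/(z - t) = 1/z + t/z^2 + t^2/(z^2 (z - t))] into Cauchy's formula. The first two terms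
    yield [g 0] and [t * l]; the third is small because on the boundary [|z| >= 2] and
    [|z - t| >= 1]. *)
Lemma cauchy_taylor2 g (M : R) :
  (forall z, rect (-2) 2 (-2) 2 z -> differentiable g z) ->
  (forall z, rect (-2) 2 (-2) 2 z -> cabs (g z) <= M) ->
  exists l : R[i], cabs l <= 2 * M /\
    forall t, cabs t <= 1 -> cabs (g t - g 0 - t * l) <= 2 * M * cabs t ^+ 2.
Proof.
move=> dg gM; have c4 := cauchy_const_ge.
have c0 : cauchy_const != 0 by rewrite -cabs_gt0; lra.
have ctg (t : R[i]^o) m := @cauchy_continuous2 g t m dg.
have z1 : cabs (0 : R[i]) <= 1 by rewrite cabs0.
have M0 : 0 <= M.
  by apply: le_trans (gM 0 _); [exact: cabs_ge0|split => /=; lra].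
have gMb z : rect_boundary (-2) 2 (-2) 2 z -> cabs (g z) <= M.
  by move=> zb; apply: gM; apply: rect_boundary_sub zb; lra.
(* The integral of [g z / z^2], with one factor written [(z - 0)^-1] so that [cauchy_continuous2]
   covers it. *)
pose I2 := rect_int (fun z => g z * z ^- 1 * (z - 0)^-1) (-2) 2 (-2) 2.
exists (cauchy_const^-1 * I2); split.
  rewrite cabsM cabsV mulrC ler_pdivrMr; last lra.
  apply: (@le_trans _ _ (8 * M)); last by nra.
  apply: le_trans (@rect_int_bound _ _ _ _ _ _ (M / 4) _ _ _ _) _; try lra.
    exact: ctg.
  move=> z zb; have [z2 zt] := square2_boundary zb z1.
  rewrite subr0 !cabsM !cabsV expr1 -mulrA; apply: ler_pM;
    rewrite ?gMb ?cabs_ge0 ?mulr_ge0 ?invr_ge0 ?cabs_ge0//.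
  by rewrite -invfM lef_pV2// ?posrE; nra.
move=> t t1.
have -> : g t - g 0 - t * (cauchy_const^-1 * I2) =
   cauchy_const^-1 * (cauchy_const * g t - cauchy_const * g 0 - t * I2).
  by field.
rewrite -!cauchy_formula2// /I2.
have c_1 : continuous_on_boundary (fun z => g z * (z - t)^-1) (-2) 2 (-2) 2.
  by have := ctg t 0%N t1; rewrite mul_pole0.
have c_2 : continuous_on_boundary (fun z => g z * (z - 0)^-1) (-2) 2 (-2) 2.
  by have := ctg 0 0%N z1; rewrite mul_pole0.
have c_3 := ctg 0 1%N z1.
have c_4 : continuous_on_boundary (fun z => t * (g z * z ^- 1 * (z - 0)^-1)) (-2) 2 (-2) 2.
  exact: continuous_on_boundaryM.
have c_5 : continuous_on_boundary (fun z => g z * (z - t)^-1 - g z * (z - 0)^-1) (-2) 2 (-2) 2.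
  exact: continuous_on_boundaryB.
rewrite -(rect_intM t c_3) -(rect_intB c_1 c_2) -(rect_intB c_5 c_4).
rewrite cabsM cabsV mulrC ler_pdivrMr; last lra.
apply: (@le_trans _ _ (8 * (M * cabs t ^+ 2))); last first.
  by have := mulr_ge0 M0 (sqr_ge0 (cabs t)); nra.
apply: le_trans (@rect_int_bound _ _ _ _ _ _ (M * cabs t ^+ 2 / 4) _ _ _ _) _; try lra.
  exact: continuous_on_boundaryB.
move=> z zb; have [z2 zt] := square2_boundary zb t1.
have z0 : z != 0 by rewrite -cabs_gt0; lra.
have zt0 : z - t != 0 by rewrite -cabs_gt0; lra.
have -> : g z / (z - t) - g z / (z - 0) - t * (g z / z ^+ 1 / (z - 0)) =
   g z * t ^+ 2 * ((z * z) * (z - t))^-1.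
  by rewrite subr0 expr1; field; rewrite ?z0 ?zt0.
rewrite cabsM (cabsM (g z)) cabsX cabsV (cabsM (z * z)) (cabsM z); apply: ler_pM;
  rewrite ?mulr_ge0 ?invr_ge0 ?mulr_ge0 ?cabs_ge0 ?exprn_ge0 ?cabs_ge0//.
  by apply: ler_wpM2r; rewrite ?exprn_ge0 ?cabs_ge0 ?gMb.
rewrite lef_pV2// ?posrE ?mulr_gt0//; try lra.
have : 4 <= cabs z * cabs z by nra.
by nra.
Qed.

(* In Cauchy's formula at [1] write [1/(z-1)] as the sum of [z^-(k+1)] for [k < m]
   plus [z^-m/(z-1)]: the first [m] integrals can be moved to the small square,
   and the last one is of order [M / 2^m]. *)
Lemma two_constants (M s eta : R) : 0 < s -> s < 1 -> 0 < eta ->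
  exists2 e : R, 0 < e & forall g,
    (forall z, rect (-2) 2 (-2) 2 z -> differentiable g z) ->
    (forall z, rect (-2) 2 (-2) 2 z -> cabs (g z) <= M) ->
    (forall z, rect (-s) s (-s) s z -> cabs (g z) <= e) -> cabs (g 1) <= eta.
Proof.
move=> s0 s1 eta0.
have eta2 : 0 < eta / 2 by rewrite divr_gt0.
have [m hm] := exists_halving_lt (8 * M) eta2.
(* Since [cauchy_const] has modulus at least 4, a total of [4 * eta] is allowed. The last integral
   is below [32 * M / 2 ^+ m < 2 * eta] by the choice of [m]; the [m] integrals over the small
   square add up to at most [16 * m * e / s ^+ m <= 2 * eta]. *)
pose e := eta * s ^+ m / (8 * m.+1%:R).
have e0 : 0 < e by rewrite divr_gt0// ?mulr_gt0// exprn_gt0.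
exists e => // g dg gM ge.
have c4 := cauchy_const_ge.
have o1 : cabs (1 : R[i]) <= 1 by rewrite cabs1.
have gMb z : rect_boundary (-2) 2 (-2) 2 z -> cabs (g z) <= M.
  by move=> zb; apply: gM; apply: rect_boundary_sub zb; lra.
pose A k := rect_int (fun z => g z * z ^- k * (z - 1)^-1) (-2) 2 (-2) 2.
have A0 : A 0%N = cauchy_const * g 1.
  by rewrite -cauchy_formula2// /A mul_pole0.
have Am : cabs (A m) <= 32 * (M / 2 ^+ m).
  apply: le_trans (@rect_int_bound _ _ _ _ _ _ (M / 2 ^+ m) _ _ _ _) _; try lra.
    exact: cauchy_continuous2.
  move=> z zb; have [z2 zt] := square2_boundary zb o1.
  rewrite 2!cabsM -[leRHS]mulr1; apply: ler_pM; rewrite ?mulr_ge0 ?cabs_ge0//.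
    rewrite cabsV cabsX; apply: ler_pM; rewrite ?invr_ge0 ?exprn_ge0 ?cabs_ge0 ?gMb//.
    by rewrite lef_pV2 ?posrE ?exprn_gt0//; [apply: lerXn2r; rewrite ?nnegrE ?cabs_ge0|lra].
  by rewrite cabsV invf_le1//; lra.
have dP k z : rect (-2) 2 (-2) 2 z -> z != 0 -> differentiable (fun z : R[i]^o => (g z * z ^- k : R[i]^o)) z.
  by move=> zr z0; apply: differentiable_pole => //; exact: dg.
have AS k : cabs (A k - A k.+1) <= 16 * e * s ^- k.
  (* The difference of consecutive integrands has a factor [z - 1] which cancels the pole at 1. Only
     the pole at 0 remains, and the contour shrinks to the square where [g] is small. *)
  have E : A k - A k.+1 = rect_int (fun z => g z * z ^- k.+1) (-s) s (-s) s.
    have <- : rect_int (fun z => g z * z ^- k.+1) (-2) 2 (-2) 2 =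
        rect_int (fun z => g z * z ^- k.+1) (-s) s (-s) s.
      apply: rect_int_annulus; [lra|lra|lra|lra|lra|lra|].
      move=> z zr hz; apply: dP => //; apply/eqP => z0; apply: hz.
      by rewrite z0 /=; split; apply/andP; split; lra.
    rewrite -(rect_intB (@cauchy_continuous2 g 1 k dg o1) (@cauchy_continuous2 g 1 k.+1 dg o1)).
    have EE z : rect_boundary (-2) 2 (-2) 2 z ->
      g z * z ^- k * (z - 1)^-1 - g z * z ^- k.+1 * (z - 1)^-1 = g z * z ^- k.+1.
      move=> zb; have [z2 zt] := square2_boundary zb o1.
      have z0 : z != 0 by rewrite -cabs_gt0; lra.
      have z10 : z - 1 != 0 by rewrite -cabs_gt0; lra.
      by rewrite exprS; field; rewrite expf_neq0// z0.
    have l2 : (-2 : R) <= 2 by lra.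
    rewrite /rect_int; congr (_ + 'i%C * _); apply: eq_cint => x hx; rewrite !EE//;
      solve [by left; split => //=; left | by left; split => //=; right |
             by right; split => //=; left | by right; split => //=; right].
  rewrite E; apply: le_trans (@rect_int_bound _ _ _ _ _ _ (e / s ^+ k.+1) _ _ _ _) _; try lra.
  - move=> z zb; apply/differentiable_continuous/dP.
      have [] : rect (-s) s (-s) s z by apply: rect_boundary_sub zb; lra.
      by move=> /andP[? ?] /andP[? ?]; split; apply/andP; split; lra.
    by apply: rect_boundary_neq zb => /=; lra.
  - move=> z zb; have := @square_boundary_dist _ 0 z s s0.
    rewrite /= !add0r subr0 => /(_ zb)/andP[h _].
    rewrite cabsM cabsV cabsX; apply: ler_pM; rewrite ?invr_ge0 ?exprn_ge0 ?cabs_ge0//.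
      by apply: ge; apply: rect_boundary_sub zb; lra.
    by rewrite lef_pV2 ?posrE ?exprn_gt0//; [apply: lerXn2r; rewrite ?nnegrE ?cabs_ge0// ltW|lra].
  rewrite exprS (_ : 4 * _ = 16 * e * s ^- k)//.
  by field; rewrite expf_neq0 ?gt_eqF.
have AS' k : (k <= m)%N -> cabs (A 0%N - A k) <= k%:R * (16 * e * s ^- m).
  elim: k => [|k IH] km; first by rewrite subrr cabs0 mul0r.
  apply: le_trans (cabs_trans (A k) _ _) _.
  rewrite -natr1 mulrDl mul1r; apply: lerD; first exact/IH/ltnW.
  apply: le_trans (AS k) _; apply: ler_wpM2l; first by rewrite mulr_ge0// ltW.
  by rewrite lef_pV2 ?posrE ?exprn_gt0//; apply: ler_wiXn2l; rewrite ?ltW// ltnW.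
have A0b : cabs (A 0%N) <= 32 * (M / 2 ^+ m) + m%:R * (16 * e * s ^- m).
  have -> : A 0%N = A m + (A 0%N - A m) by rewrite addrC subrK.
  by apply: le_trans (cabsD _ _) _; apply: lerD => //; exact: AS'.
move: A0b; rewrite A0 cabsM.
have -> : m%:R * (16 * e * s ^- m) = m%:R / m.+1%:R * (2 * eta).
  rewrite /e; field; rewrite expf_neq0 ?gt_eqF//=.
have mm : m%:R / m.+1%:R <= 1 :> R by rewrite ler_pdivrMr ?ltr0Sn// mul1r ler_nat.
have M8 : 8 * M / 2 ^+ m = 8 * (M / 2 ^+ m) by rewrite mulrA.
rewrite M8 in hm.
have g0 := cabs_ge0 (g 1).
move: (_ / _) mm hm => u mm hm; move: (M / _) hm => v hm.
by nra.
Qed.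

End CauchySquare.

(** * The L^p estimate on polyboxes *)

Section SupNorm.
Context {R : realType} {n : nat}.
Local Notation Cn := (Cn R n).

Lemma cabs_le_rnorm (z : Cn) j : cabs (z ord0 j) <= rnorm z.
Proof.
rewrite -lecR -normr_rnorm -normr_cabs /Num.norm /= mx_normE.
by apply: (@le_trans _ _ (`|z ord0 j|%:nng)%:num) => //; rewrite num_le;
  apply/bigmax_geP; right; exists (ord0, j).
Qed.

Lemma rnorm_le (z : Cn) (e : R) : 0 <= e -> (forall j, cabs (z ord0 j) <= e) ->
  rnorm z <= e.
Proof.
move=> e0 h; have [->|z0] := eqVneq (rnorm z) 0 => //.
have nz : mx_norm z != 0.
  by move: z0; apply: contra => /eqP h0; rewrite /rnorm /Num.norm /= h0.
have [[i j] hij] := mx_norm_neq0 nz.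
have : `|z| = `|z ord0 j| by rewrite [LHS]hij /= (ord1 i).
by rewrite normr_rnorm normr_cabs => /complexI ->.
Qed.

Lemma rnorm_lt (z : Cn) (e : R) : 0 < e -> (forall j, cabs (z ord0 j) < e) ->
  rnorm z < e.
Proof.
move=> e0 h; have [->|z0] := eqVneq (rnorm z) 0 => //.
have nz : mx_norm z != 0.
  by move: z0; apply: contra => /eqP h0; rewrite /rnorm /Num.norm /= h0.
have [[i j] hij] := mx_norm_neq0 nz.
have : `|z| = `|z ord0 j| by rewrite [LHS]hij /= (ord1 i).
by rewrite normr_rnorm normr_cabs => /complexI ->.
Qed.

End SupNorm.

(** * Measurability, monotonicity and Fatou's lemma for iterated integrals *)

Section IteratedIntegral.
Context {R : realType}.
Local Notation mu := (@lebesgue_measure R).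
Implicit Types (G : (nat -> R) -> \bar R).

Definition upd (v : nat -> R) (k : nat) (x : R) : nat -> R :=
  fun i => if i == k then x else v i.

(* Measurability with respect to the product sigma-algebra of [nat -> R],
   tested against all coordinatewise measurable maps. *)
Definition coord_measurable d' (Y : measurableType d') (G : (nat -> R) -> Y) : Prop :=
  forall d (T : measurableType d) (phi : nat -> T -> R),
    (forall k, measurable_fun setT (phi k)) ->
    measurable_fun setT (fun t => G (fun k => phi k t)).

(** Tonelli's theorem on [T * R]: in the induction the outermost coordinate joins the parameter. The
    parameter space therefore changes, which is why the hypothesis is tested against all maps from
    all measurable spaces. *)
Lemma measurable_iint_param k d (T : measurableType d) (H : T -> (nat -> R) -> \bar R) :
  (forall t v, 0 <= H t v)%E ->
  (forall d' (S : measurableType d') (psi : S -> T) (phi : nat -> S -> R),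
    measurable_fun setT psi -> (forall k, measurable_fun setT (phi k)) ->
    measurable_fun setT ((fun s => H (psi s) (fun i => phi i s)) : S -> \bar R)) ->
  measurable_fun setT (fun t => iint k (H t)).
Proof.
elim: k d T H => [|k IH] d T H H0 mH /=.
  exact: (mH _ _ id (fun _ _ => 0)).
have h0 (G : (nat -> R) -> \bar R) m : (forall v, 0 <= G v)%E -> (0 <= iint m G)%E.
  by elim: m G => [|m IHm] G G0 /=; [exact: G0|apply: integral_ge0 => t _; exact: IHm].
pose H' (tx : T * R) v := H tx.1 (fun i => if i == k then tx.2 else v i).
have mH' : measurable_fun setT (fun tx : T * R => iint k (H' tx)).
  apply: IH => [tx v|d' S psi phi mpsi mphi]; first exact: H0.
  rewrite /H'; apply: (mH _ _ (fun s => (psi s).1) (fun i s => if i == k then (psi s).2 else phi i s)).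
    exact: measurableT_comp.
  by move=> i; case: (i == k) => //; exact: measurableT_comp.
have := measurable_fun_fubini_tonelli_F (m2 := mu) _ mH'.
by apply => tx; apply: h0 => v; exact: H0.
Qed.

Lemma iint_ge0 k G : (forall v, 0 <= G v)%E -> (0 <= iint k G)%E.
Proof.
by elim: k G => [|k IH] G G0 /=; [exact: G0|apply: integral_ge0 => t _; exact: IH].
Qed.

Lemma coord_measurable_upd d' (Y : measurableType d') (G : (nat -> R) -> Y) k x :
  coord_measurable G -> coord_measurable (fun v => G (upd v k x)).
Proof.
move=> mG d T phi mphi; apply: (mG _ _ (fun i t => if i == k then x else phi i t)).
by move=> i; case: (i == k).
Qed.

Lemma measurable_iint_upd k G m : (forall v, 0 <= G v)%E -> coord_measurable G ->
  measurable_fun setT (fun t : R => iint k (fun v => G (upd v m t))).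
Proof.
move=> G0 mG; apply: measurable_iint_param => [t v|d' S psi phi mpsi mphi]; first exact: G0.
apply: (mG _ _ (fun i s => if i == m then psi s else phi i s)).
by move=> i; case: (i == m).
Qed.

Lemma iintS k G : iint k.+1 G =
  (\int[mu]_(t in [set: R]) iint k (fun v => G (upd v k t)))%E.
Proof. by []. Qed.

Lemma le_iint k G1 G2 : (forall v, 0 <= G1 v)%E ->
  coord_measurable G1 -> coord_measurable G2 -> (forall v, G1 v <= G2 v)%E ->
  (iint k G1 <= iint k G2)%E.
Proof.
elim: k G1 G2 => [|k IH] G1 G2 G10 m1 m2 G12; first exact: G12.
have G20 v : (0 <= G2 v)%E by exact: le_trans (G12 v).
rewrite !iintS; apply: ge0_le_integral => //.
- by move=> t _; exact: iint_ge0.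
- exact: measurable_iint_upd.
- exact: measurable_iint_upd.
- by move=> t _; apply: IH => //; exact: coord_measurable_upd.
Qed.

Lemma iintD k G1 G2 : (forall v, 0 <= G1 v)%E -> (forall v, 0 <= G2 v)%E ->
  coord_measurable G1 -> coord_measurable G2 ->
  iint k (fun v => G1 v + G2 v)%E = (iint k G1 + iint k G2)%E.
Proof.
elim: k G1 G2 => [//|k IH] G1 G2 G10 G20 m1 m2.
rewrite !iintS -ge0_integralD//.
- by apply: eq_integral => t _; apply: IH => //; exact: coord_measurable_upd.
- by move=> t _; exact: iint_ge0.
- exact: measurable_iint_upd.
- by move=> t _; exact: iint_ge0.
- exact: measurable_iint_upd.
Qed.

Lemma iintZ k G (c : R) : 0 <= c -> (forall v, 0 <= G v)%E -> coord_measurable G ->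
  iint k (fun v => c%:E * G v)%E = (c%:E * iint k G)%E.
Proof.
move=> c0; elim: k G => [//|k IH] G G0 mG.
rewrite !iintS -ge0_integralZl_EFin//.
- by apply: eq_integral => t _; apply: IH => //; exact: coord_measurable_upd.
- by move=> t _; exact: iint_ge0.
- exact: measurable_iint_upd.
Qed.

(** Fatou's lemma is applied to one coordinate at a time. The lower limit is measurable as the
    opposite of the upper limit of the opposites. *)
Lemma fatou_iint k (G : nat -> (nat -> R) -> \bar R) : (forall j v, 0 <= G j v)%E ->
  (forall j, coord_measurable (G j)) ->
  (iint k (fun v => limn_einf (fun j => G j v)) <= limn_einf (fun j => iint k (G j)))%E.
Proof.
have lim0 (u : nat -> \bar R) : (forall j, 0 <= u j)%E -> (0 <= limn_einf u)%E.
  move=> u0; rewrite limn_einf_lim; apply: lime_ge; first exact: is_cvg_einfs.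
  by near=> j; apply: le_ereal_inf_tmp => _ [m /= nm <-].
have mlim' d (T : measurableType d) (H : nat -> T -> \bar R) :
    (forall j, measurable_fun setT (H j)) -> measurable_fun setT (fun t => limn_einf (H ^~ t)).
  move=> mH; rewrite (_ : (fun t => _) = -%E \o (fun t => limn_esup ((fun j t => - H j t) ^~ t)))%E//.
  apply: measurableT_comp => //.
  by apply: (@measurable_fun_limn_esup _ _ _ _ (fun j t => - H j t)%E) => j; exact: measurableT_comp.
have mlim (H : nat -> (nat -> R) -> \bar R) : (forall j, coord_measurable (H j)) ->
    coord_measurable (fun v => limn_einf (fun j => H j v)).
  move=> mH d T phi mphi; apply: mlim' => j; exact: mH.
elim: k G => [//|k IH] G G0 mG.
have mj j : measurable_fun setT (fun t : R => iint k (fun v => G j (upd v k t))).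
  exact: measurable_iint_upd.
have F := fatou mu measurableT mj (fun j t _ => iint_ge0 _ (fun v => G0 j (upd v k t))).
rewrite iintS; apply: le_trans F; apply: ge0_le_integral => //.
+ by move=> t _; apply: iint_ge0 => v; exact: lim0.
+ apply: (@measurable_iint_upd k (fun v => limn_einf (fun j => G j v)) k).
    by move=> v; exact: lim0.
  exact: mlim.
+ by apply: mlim' => j; exact: measurable_iint_upd.
+ by move=> t _; apply: IH => // j; exact: coord_measurable_upd.
Unshelve. all: by end_near. Qed.

End IteratedIntegral.

(** * Measurability of the integrands in coordinates *)

Section CoordinateMeasurability.
Context {R : realType} {n : nat}.
Local Notation Cn := (Cn R n).
Implicit Types (Om : set Cn) (f : Cn -> R[i]^o).

Lemma exists_inv_nat_lt (e : R) : 0 < e -> exists m : nat, m.+1%:R^-1 < e.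
Proof.
move=> e0; exists (Num.bound `|e^-1|); rewrite invf_plt ?posrE ?ltr0n//.
apply: le_lt_trans (ler_norm _) _; apply: lt_trans (archi_boundP (normr_ge0 _)) _.
by rewrite ltr_nat.
Qed.

Lemma exists_rat_near (x e : R) : 0 < e -> exists c : rat, `|x - ratr c| < e.
Proof.
move=> e0; have [|c] := @rat_in_itvoo _ (x - e) (x + e); first by lra.
by rewrite in_itv /= => /andP[h1 h2]; exists c; rewrite ltr_norml; lra.
Qed.

(** Boxes with rational centre and radius [1/(m + 1)] form a countable base described by real
    coordinates, so the preimage of an open set under a coordinatewise measurable map is a countable
    union of measurable sets. *)
Definition rat_box (i : {ffun 'I_n -> rat * rat} * nat) : set Cn :=
  [set z | forall j, `|Re (z ord0 j) - ratr (i.1 j).1| < i.2.+1%:R^-1 /\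
                     `|Im (z ord0 j) - ratr (i.1 j).2| < i.2.+1%:R^-1].

Lemma rat_box_base Om z : open Om -> Om z ->
  exists2 i, rat_box i z & rat_box i `<=` Om.
Proof.
move=> /open_rnorm oOm /oOm[d d0 hd].
have d4 : 0 < d / 4 by rewrite divr_gt0.
have [m hm] := exists_inv_nat_lt d4.
have e0 : 0 < m.+1%:R^-1 :> R by rewrite invr_gt0.
have /choice[c1 hc1] : forall j, exists c : rat, `|Re (z ord0 j) - ratr c| < m.+1%:R^-1.
  by move=> j; exact: exists_rat_near.
have /choice[c2 hc2] : forall j, exists c : rat, `|Im (z ord0 j) - ratr c| < m.+1%:R^-1.
  by move=> j; exact: exists_rat_near.
exists ([ffun j => (c1 j, c2 j)], m); first by move=> j /=; rewrite ffunE.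
move=> w hw; apply: hd; apply: rnorm_lt => // j; rewrite !mxE.
apply: le_lt_trans (cabs_le_ReIm _) _; rewrite ReD ImD ReN ImN.
have := hw j; rewrite ffunE /= => -[]; have := hc1 j; have := hc2 j.
rewrite !ltr_norml => /andP[a1 a2] /andP[a3 a4] /andP[a5 a6] /andP[a7 a8].
have -> : d = d / 2 + d / 2 by lra.
move: hm a1 a2 a3 a4 a5 a6 a7 a8; move: (m.+1%:R^-1) => q *.
by apply: ltrD; rewrite ltr_norml; lra.
Qed.

Lemma measurable_coords_open Om d (T : measurableType d) (phi : nat -> T -> R) :
  open Om -> (forall k, measurable_fun setT (phi k)) ->
  measurable [set t | Om (coords_to_Cn (fun k => phi k t))].
Proof.
move=> oOm mphi; pose F i : set T :=
  if `[< rat_box i `<=` Om >] then [set t | rat_box i (coords_to_Cn (fun k => phi k t))] else set0.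
have -> : [set t | Om (coords_to_Cn (fun k => phi k t))] = \bigcup_i F i.
  apply/seteqP; split => t /=.
    move=> /(rat_box_base oOm)[i iz iOm]; exists i => //.
    by rewrite /F; case: asboolP.
  by move=> [i _]; rewrite /F; case: asboolP => // h /h.
apply: countable_bigcupT_measurable; first exact: countableP.
move=> i; rewrite /F; case: asboolP => // _.
have mball k x e : measurable [set t | `|phi k t - x| < e].
  rewrite (_ : [set t | _] = setT `&` phi k @^-1` `]x - e, x + e[%classic).
    exact: (mphi k measurableT _ (measurable_itv _)).
  by rewrite setTI; apply/seteqP; split => t /=; rewrite in_itv /= ltr_distl.
rewrite (_ : [set t | _] = \bigcap_(j in [set: 'I_n])
   ([set t | `|phi (2 * j)%N t - ratr (i.1 j).1| < i.2.+1%:R^-1] `&`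
    [set t | `|phi (2 * j).+1 t - ratr (i.1 j).2| < i.2.+1%:R^-1])).
  by apply: fin_bigcap_measurable => // j _; apply: measurableI; exact: mball.
by apply/seteqP; split => t h j; have := h j; rewrite !mxE //= => /(_ I).
Qed.

Lemma open_cabs_gt Om f (x : R) : open Om -> holomorphic_on Om f ->
  open (Om `&` [set z | x < cabs (f z)]).
Proof.
move=> oOm hf; apply/open_rnorm => z [Oz xz].
have /open_rnorm /(_ _ Oz)[d d0 hd] := oOm.
have /differentiable_continuous /continuous_rnorm := hf _ Oz.
have e0 : 0 < cabs (f z) - x by rewrite subr_gt0.
move=> /(_ _ e0)[d' d'0 hd']; exists (Num.min d d'); first by rewrite lt_min d0.
move=> y; rewrite lt_min => /andP[/hd Oy /hd' h]; split => //=.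
by have := cabs_dist (f z) (f y); rewrite cabsB; lra.
Qed.

(** Outside [Om] nothing is known about [f], so the superlevel sets are computed after
    multiplication by the indicator: for a level [x >= 0] they come from an open subset of [Om]. As
    [p] is positive, the power of 0 is 0 and the indicator can be moved under the power. *)
Lemma coord_measurable_intp_integrand Om f (p : R) : open Om -> holomorphic_on Om f -> 0 < p ->
  coord_measurable (fun v => \1_Om (coords_to_Cn v) * powR (cabs (f (coords_to_Cn v))) p : R).
Proof.
move=> oOm hf p0 d T phi mphi.
pose u t : R := \1_Om (coords_to_Cn (fun k => phi k t)) * cabs (f (coords_to_Cn (fun k => phi k t))).
have mu : measurable_fun setT u.
  move=> _; apply: (measurability _ (RGenOInfty.measurableE R)) => // _ [_ [x ->] <-].
  rewrite setTI; have [x0|x0] := ltP x 0.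
    rewrite (_ : _ @^-1` _ = setT)//; apply/seteqP; split => t //= _.
    by rewrite in_itv /= andbT /u (lt_le_trans x0)// mulr_ge0// cabs_ge0.
  rewrite (_ : _ @^-1` _ = [set t | (Om `&` [set z | x < cabs (f z)]) (coords_to_Cn (fun k => phi k t))]).
    by apply: measurable_coords_open => //; exact: open_cabs_gt.
  apply/seteqP; split => t /=; rewrite in_itv /= andbT /u indicE.
    case: (boolP (_ \in Om)) => [|_]; last by rewrite mul0r ltNge x0.
    by rewrite inE mul1r.
  by move=> [Oz ?]; rewrite mem_set// mul1r.
rewrite (_ : (fun t => _) = (@powR R ^~ p) \o u); first exact: measurableT_comp (measurable_powR p) mu.
apply/funext => t /=; rewrite /u indicE; case: (_ \in Om); first by rewrite !mul1r.
by rewrite !mul0r powR0// gt_eqF.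
Qed.

End CoordinateMeasurability.

(** * The estimate of point values in one complex variable *)

Section PlanarEstimate.
Context {R : realType}.
Local Notation mu := (@lebesgue_measure R).

(* Young-type splitting, used with [t] proportional to [u] to pass from an
   L^1 to an L^p bound without Hoelder. *)
Lemma le_add_powR_div (u t p : R) : 0 <= u -> 0 < t -> 1 <= p ->
  u <= t + powR u p / powR t (p - 1).
Proof.
move=> u0 t0 p1; have tp : 0 < powR t (p - 1) by exact: powR_gt0.
have [ut|tu] := leP u t.
  by apply: le_trans ut _; rewrite lerDl divr_ge0 ?powR_ge0.
apply: (@le_trans _ _ (powR u p / powR t (p - 1))); last by rewrite lerDr ltW.
rewrite ler_pdivlMr// -(@mulr_powRB1 _ u p)//; last by lra.
apply: ler_wpM2l => //; apply: ge0_ler_powR; rewrite ?nnegrE ?subr_ge0// ltW//.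
Qed.

(** Used to choose a side of a rectangle on which the line integral of [|h|^p] is controlled by the
    area integral. *)
Lemma exists_mean_value_le (H : R -> \bar R) (c d I : R) : c < d ->
  (forall x, 0 <= H x)%E -> measurable_fun setT H ->
  (\int[mu]_x H x < I%:E)%E -> 0 < I ->
  exists2 x, c <= x <= d & (H x <= (I / (d - c))%:E)%E.
Proof.
move=> cd H0 mH HI I0; have dc : 0 < d - c by rewrite subr_gt0.
have [//|none] := pselect (exists2 x, c <= x <= d & (H x <= (I / (d - c))%:E)%E).
exfalso; move: HI; apply/negP; rewrite -leNgt.
apply: (@le_trans _ _ (\int[mu]_(x in `[c, d]) H x)%E); last first.
  by apply: ge0_subset_integral => //=.
apply: (@le_trans _ _ (\int[mu]_(x in `[c, d]) (I / (d - c))%:E)%E).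
  rewrite integral_cst//= lebesgue_measure_itv/= lte_fin cd -EFinB -EFinM.
  by rewrite divfK// gt_eqF.
apply: ge0_le_integral => //=.
- by move=> x _; rewrite lee_fin divr_ge0// ltW.
- exact: measurable_funTS.
- move=> x; rewrite in_itv /= => xcd; apply/ltW; rewrite ltNge; apply/negP => h.
  by apply: none; exists x.
Qed.

Definition square_indic (a : R * R) (r : R) (x : R * R) : R :=
  ((`|x.1 - a.1| <= r) && (`|x.2 - a.2| <= r))%:R.

(** Contribution of one side to Cauchy's integral: the distance [r / 2] to the pole bounds the
    kernel by [2 / r], and [le_add_powR_div] passes from the modulus of [h] to its [p]-th power.
    Here [g] is a function on the whole line that equals this power on the side. *)
Lemma side_bound (h : R -> R[i]) (w : R -> R[i]) (g : R -> R) (x0 x1 r t p B : R) :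
  0 < r -> 0 < t -> 1 <= p -> 0 <= B -> x0 <= x1 -> x1 - x0 <= 2 * r ->
  cintegrable x0 x1 (fun x => h x * (w x)^-1) ->
  (forall x, x0 <= x <= x1 -> r / 2 <= cabs (w x)) ->
  (forall x, x0 <= x <= x1 -> g x = powR (cabs (h x)) p) ->
  (forall x, 0 <= g x) -> measurable_fun setT g ->
  (\int[mu]_x (g x)%:E <= B%:E)%E ->
  cabs (cint x0 x1 (fun x => h x * (w x)^-1)) <=
    4 / r * (2 * r * t + B / powR t (p - 1)).
Proof.
move=> r0 t0 p1 B0 x01 xr ci hw gE g0 mg gB.
have tp : 0 < powR t (p - 1) by exact: powR_gt0.
pose k x := 2 / r * (t + g x / powR t (p - 1)).
have gi : mu.-integrable `[x0, x1] (EFin \o g).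
  apply: (@integrableS _ _ _ mu setT) => //.
  apply/integrableP; split; first exact/measurable_EFinP.
  have -> : (\int[mu]_x `|(EFin \o g) x| = \int[mu]_x (g x)%:E)%E.
    by apply: eq_integral => x _; rewrite gee0_abs ?lee_fin.
  by apply: le_lt_trans gB _; rewrite ltry.
have cst_int (c : R) a b : mu.-integrable `[a, b] (EFin \o (fun=> c)).
  by apply: real_seg_continuous_integrable => x _ e e0; exists 1 => // y _; rewrite subrr normr0.
have i1 : mu.-integrable `[x0, x1] (EFin \o (fun x => g x / powR t (p - 1))).
  rewrite (_ : _ \o _ = (fun x => (powR t (p - 1))^-1%:E * (g x)%:E)%E); last first.
    by apply/funext => x /=; rewrite mulrC EFinM.
  exact: integrableZl.
have i2 : mu.-integrable `[x0, x1] (EFin \o (fun x => t + g x / powR t (p - 1))).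
  exact: (integrableD _ (cst_int t x0 x1) i1).
have ik : mu.-integrable `[x0, x1] (EFin \o k).
  exact: (integrableZl _ (2 / r) i2).
have bk x : x0 <= x <= x1 -> cabs (h x * (w x)^-1) <= k x.
  move=> xx; rewrite cabsM cabsV /k mulrC gE//; apply: ler_pM.
  - by rewrite invr_ge0 cabs_ge0.
  - exact: cabs_ge0.
  - have wr := hw _ xx; have w0 : 0 < cabs (w x) by apply: lt_le_trans wr; rewrite divr_gt0.
    by rewrite -[2 / r]invf_div lef_pV2 // posrE divr_gt0.
  - by apply: le_add_powR_div => //; exact: cabs_ge0.
apply: le_trans (cabs_cint_le_int ci ik bk) _.
rewrite /k RintegralZl// RintegralD//.
have -> : \int[mu]_(x in `[x0, x1]) t = t * (x1 - x0).
  have := congr1 (@complex.Re R) (cint_cst t%:C x01).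
  by rewrite /= mul0r subr0 (mulrC (x1 - x0)).
rewrite RintegralZr//.
have gle : \int[mu]_(x in `[x0, x1]) g x <= B.
  rewrite -lee_fin /Rintegral fineK; last exact: integrable_fin_num.
  apply: le_trans gB; apply: ge0_subset_integral => //=; first exact/measurable_EFinP.
  by move=> x _; rewrite lee_fin.
rewrite mulrA (_ : 2 * (2 / r) = 4 / r); last by field; rewrite gt_eqF.
apply: ler_wpM2l; first by rewrite divr_ge0// ltW.
apply: lerD; first by rewrite mulrC; apply: ler_wpM2r => //; exact: ltW.
by apply: ler_wpM2r => //; rewrite invr_ge0 ltW.
Qed.

(** The mean value lemma provides sides in the four strips of width [r / 2] along the border of the
    square, on each of which [|h|^p] has integral at most [2 / r] times the area integral. Cauchy's
    formula on this rectangle bounds [u], the modulus at the centre, by a term linear in the free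
    parameter [t] plus a multiple of [t^(1 - p)]. *)
Lemma planar_estimate (p r : R) : 1 <= p -> 0 < r -> exists2 K : R, 0 < K &
  forall (h : R[i]^o -> R[i]^o) (a1 a2 : R),
  (forall z, rect (a1 - r) (a1 + r) (a2 - r) (a2 + r) z -> differentiable h z) ->
  measurable_fun setT (fun x : R * R =>
    square_indic (a1, a2) r x * powR (cabs (h (Complex x.1 x.2))) p : R) ->
  ((powR (cabs (h (Complex a1 a2))) p)%:E <= K%:E *
    \int[mu]_y \int[mu]_x
     (square_indic (a1, a2) r (x, y) * powR (cabs (h (Complex x y))) p)%:E)%E.
Proof.
move=> p1 r0; exists (powR 16 p / r ^+ 2); first by rewrite divr_gt0 ?powR_gt0 ?exprn_gt0.
move=> h a1 a2 dh mg; set g := fun x : R * R => _ in mg.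
set a : R[i]^o := Complex a1 a2.
have g0 x : 0 <= g x by rewrite mulr_ge0 ?powR_ge0 ?ler0n.
have mgE : measurable_fun setT (EFin \o g) by exact/measurable_EFinP.
have gE0 x : (0 <= (EFin \o g) x)%E by rewrite lee_fin.
rewrite -[X in (_ <= _ * X)%E]/(\int[mu]_y \int[mu]_x (EFin \o g) (x, y))%E.
set I := (\int[mu]_y _)%E.
have I0 : (0 <= I)%E by apply: integral_ge0 => y _; exact: integral_ge0.
have K0 : 0 < powR 16 p / r ^+ 2 by rewrite divr_gt0 ?powR_gt0 ?exprn_gt0.
have [Ioo|] := eqVneq I +oo%E; first by rewrite Ioo gt0_muley ?lte_fin// leey.
rewrite -ltey => Ifin.
have IE : I = (fine I)%:E by rewrite fineK// ge0_fin_numE.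
set J := fine I in IE.
have J0 : 0 <= J by exact: fine_ge0.
rewrite IE -EFinM lee_fin; apply/ler_addgt0Pr => e e0.
set u := cabs (h a).
have [u0|u0] := eqVneq u 0.
  have pn : p != 0 by rewrite gt_eqF//; lra.
  by rewrite u0 powR0//; apply: addr_ge0; [apply: mulr_ge0 => //|]; exact: ltW.
have up : 0 < u by rewrite lt_neqAle eq_sym u0 cabs_ge0.
(* The mean value lemma requires a strict upper bound of a positive size; [de] provides it and
   amounts to the margin [e] after multiplication by the constant. *)
set de := e / (powR 16 p / r ^+ 2).
have de0 : 0 < de by rewrite divr_gt0.
have -> : powR 16 p / r ^+ 2 * J + e = powR 16 p / r ^+ 2 * (J + de).
  by rewrite mulrDr /de mulrCA divff ?mulr1// gt_eqF.
have Jd : 0 < J + de by rewrite ltr_wpDl.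
have IJd : (I < (J + de)%:E)%E by rewrite IE lte_fin ltrDl.
pose H (y : R) := (\int[mu]_x (EFin \o g) (x, y))%E.
pose V (x : R) := (\int[mu]_y (EFin \o g) (x, y))%E.
have H0 y : (0 <= H y)%E by exact: integral_ge0.
have V0 y : (0 <= V y)%E by exact: integral_ge0.
have mH : measurable_fun setT H by exact: (measurable_fun_fubini_tonelli_G (m1 := mu) _ mgE gE0).
have mV : measurable_fun setT V by exact: (measurable_fun_fubini_tonelli_F (m2 := mu) _ mgE gE0).
have IV : (\int[mu]_x V x < (J + de)%:E)%E.
  by have := fubini_tonelli (m1 := mu) (m2 := mu) _ mgE gE0; rewrite /V => ->.
have r2 : 0 < r / 2 by rewrite divr_gt0.
have side c (S : R -> \bar R) : (forall x, 0 <= S x)%E -> measurable_fun setT S ->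
    (\int[mu]_x S x < (J + de)%:E)%E ->
    exists2 x, c <= x <= c + r / 2 & (S x <= (2 / r * (J + de))%:E)%E.
  move=> S0 mS SJ; have [|x xc hx] := @exists_mean_value_le S c (c + r / 2) (J + de) _ S0 mS SJ Jd.
    by lra.
  exists x => //; move: hx; rewrite (_ : c + r / 2 - c = r / 2); last by ring.
  by rewrite (_ : (J + de) / (r / 2) = 2 / r * (J + de))//; field; rewrite gt_eqF.
have [y0 y0r hy0] := side (a2 - r) H H0 mH IJd.
have [y1 y1r hy1] := side (a2 + r / 2) H H0 mH IJd.
have [x0 x0r hx0] := side (a1 - r) V V0 mV IV.
have [x1 x1r hx1] := side (a1 + r / 2) V V0 mV IV.
have [X0 X1] : x0 < a1 < x1 /\ x1 - x0 <= 2 * r by clear -x0r x1r r0; lra.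
have [Y0 Y1] : y0 < a2 < y1 /\ y1 - y0 <= 2 * r by clear -y0r y1r r0; lra.
have x01 : x0 <= x1 by clear -X0; lra.
have y01 : y0 <= y1 by clear -Y0; lra.
have sub z : rect x0 x1 y0 y1 z -> rect (a1 - r) (a1 + r) (a2 - r) (a2 + r) z.
  move=> [/andP[z1 z2] /andP[z3 z4]]; clear -z1 z2 z3 z4 x0r x1r y0r y1r.
  by split; apply/andP; split; lra.
have gon x y : x0 <= x <= x1 -> y0 <= y <= y1 -> g (x, y) = powR (cabs (h (Complex x y))) p.
  move=> xx yy; rewrite /g /square_indic /= (_ : _ && _) ?mul1r//.
  by clear -xx yy x0r x1r y0r y1r; rewrite !ler_norml; lra.
(* The linear term of [Q] is [8 * t], half of [u], and is absorbed. What remains is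
   [t^p <= (J + de) / r^2], and [u = 16 * t] gives the constant [16^p / r^2]. *)
pose t := u / 16.
have t0 : 0 < t by rewrite divr_gt0.
have tp : 0 < powR t (p - 1) by exact: powR_gt0.
pose B := 2 / r * (J + de).
have B0 : 0 <= B by rewrite mulr_ge0 ?divr_ge0 ?ltW.
pose Q := 4 / r * (2 * r * t + B / powR t (p - 1)).
have cK : continuous_on_boundary (fun z => h z * (z - a)^-1) x0 x1 y0 y1.
  move=> z zb; apply/differentiable_continuous/differentiable_cauchy_kernel.
    exact/dh/sub/(rect_boundary_sub x01 y01).
  exact: rect_boundary_neq zb.
have yl : y0 <= y0 <= y1 by rewrite lexx.
have yu : y0 <= y1 <= y1 by rewrite lexx andbT.
have xl : x0 <= x0 <= x1 by rewrite lexx.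
have xu : x0 <= x1 <= x1 by rewrite lexx andbT.
have b0 : cabs (cint x0 x1 (fun x => h (Complex x y0) * (Complex x y0 - a)^-1)) <= Q.
  apply: (@side_bound (fun x => h (Complex x y0)) (fun x => Complex x y0 - a)
      (fun x => g (x, y0)) x0 x1 r t p B);
    [exact: r0|exact: t0|exact: p1|exact: B0|exact: x01|exact: X1| | | |by move=> ?; exact: g0| |exact: hy0].
  - exact: (cintegrableH cK (or_introl erefl)).
  - move=> x _; apply: le_trans (Im_le_cabs _); rewrite /= ler_normr; apply/orP; right.
    by clear -y0r; lra.
  - by move=> x xx; exact: gon.
  - exact: measurableT_comp mg (pair2_measurable _).
have b1 : cabs (cint x0 x1 (fun x => h (Complex x y1) * (Complex x y1 - a)^-1)) <= Q.
  apply: (@side_bound (fun x => h (Complex x y1)) (fun x => Complex x y1 - a)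
      (fun x => g (x, y1)) x0 x1 r t p B);
    [exact: r0|exact: t0|exact: p1|exact: B0|exact: x01|exact: X1| | | |by move=> ?; exact: g0| |exact: hy1].
  - exact: (cintegrableH cK (or_intror erefl)).
  - move=> x _; apply: le_trans (Im_le_cabs _); rewrite /= ler_normr; apply/orP; left.
    by clear -y1r; lra.
  - by move=> x xx; exact: gon.
  - exact: measurableT_comp mg (pair2_measurable _).
have b2 : cabs (cint y0 y1 (fun y => h (Complex x0 y) * (Complex x0 y - a)^-1)) <= Q.
  apply: (@side_bound (fun y => h (Complex x0 y)) (fun y => Complex x0 y - a)
      (fun y => g (x0, y)) y0 y1 r t p B);
    [exact: r0|exact: t0|exact: p1|exact: B0|exact: y01|exact: Y1| | | |by move=> ?; exact: g0| |exact: hx0].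
  - exact: (cintegrableV cK (or_introl erefl)).
  - move=> x _; apply: le_trans (Re_le_cabs _); rewrite /= ler_normr; apply/orP; right.
    by clear -x0r; lra.
  - by move=> x xx; exact: gon.
  - exact: measurableT_comp mg (pair1_measurable _).
have b3 : cabs (cint y0 y1 (fun y => h (Complex x1 y) * (Complex x1 y - a)^-1)) <= Q.
  apply: (@side_bound (fun y => h (Complex x1 y)) (fun y => Complex x1 y - a)
      (fun y => g (x1, y)) y0 y1 r t p B);
    [exact: r0|exact: t0|exact: p1|exact: B0|exact: y01|exact: Y1| | | |by move=> ?; exact: g0| |exact: hx1].
  - exact: (cintegrableV cK (or_intror erefl)).
  - move=> x _; apply: le_trans (Re_le_cabs _); rewrite /= ler_normr; apply/orP; left.
    by clear -x1r; lra.
  - by move=> x xx; exact: gon.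
  - exact: measurableT_comp mg (pair1_measurable _).
have key : 4 * u <= 4 * Q.
  have cf : rect_int (fun z => h z * (z - a)^-1) x0 x1 y0 y1 =
      h a * rect_int (fun z => (z - a)^-1) x0 x1 y0 y1.
    by apply: cauchy_formula => // z /sub; exact: dh.
  have k4 : 4 <= cabs (rect_int (fun z => (z - a)^-1) x0 x1 y0 y1).
    exact: kernel_rect_lower_bound.
  have : cabs (rect_int (fun z => h z * (z - a)^-1) x0 x1 y0 y1) <= 4 * Q.
    rewrite rect_intE//; apply: le_trans (cabsD _ _) _; rewrite cabsM cabs_i mul1r.
    apply: le_trans (lerD (cabs_sub _ _) (cabs_sub _ _)) _.
    apply: le_trans (lerD (lerD b0 b1) (lerD b3 b2)) _.
    by rewrite le_eqVlt; apply/orP; left; apply/eqP; ring.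
  by rewrite cf cabsM -/u; clear -k4 up; nra.
have upE : powR u p = powR 16 p * (t * powR t (p - 1)).
  rewrite (mulr_powRB1 (ltW t0) (lt_le_trans ltr01 p1)).
  by rewrite -powRM ?ltW// /t mulrCA divff// mulr1.
rewrite upE -mulrA; apply: ler_wpM2l; first exact: powR_ge0.
have rt : 4 / r * (2 * r * t) = 8 * t by field; rewrite gt_eqF.
have rB : 4 / r * (B / powR t (p - 1)) = 8 * ((r ^+ 2)^-1 * (J + de) / powR t (p - 1)).
  by rewrite /B; field; rewrite !gt_eqF.
have tu : u = 16 * t by rewrite /t mulrCA divff// mulr1.
rewrite -ler_pdivlMr//; move: key; rewrite /Q mulrDr rt rB tu.
by move: (_ / powR t _) => w; clear; lra.
Qed.

End PlanarEstimate.

(** * The estimate of point values in several variables *)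

Section PolydiscEstimate.
Context {R : realType} {n : nat}.
Local Notation Cn := (Cn R n).
Local Notation mu := (@lebesgue_measure R).

Definition polybox (a : Cn) (r : R) : set Cn :=
  [set z | forall j, `|Re (z ord0 j) - Re (a ord0 j)| <= r /\
                     `|Im (z ord0 j) - Im (a ord0 j)| <= r].

(** The induction over complex coordinates integrates the first [m] of them, that is [2 * m] real
    ones, and freezes the others at [w]. *)
Definition mix (m : nat) (v w : nat -> R) : nat -> R :=
  fun i => if (i < 2 * m)%N then v i else w i.

Lemma coords_to_Cn_surj (a : Cn) : exists v : nat -> R, coords_to_Cn v = a.
Proof.
exists (fun i => if insub i./2 is Some j then
   (if odd i then Im (a ord0 j) else Re (a ord0 j)) else 0).
apply/rowP => j; rewrite !mxE mul2n doubleK /= uphalf_double odd_double /=.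
by rewrite valK; case: (a ord0 j).
Qed.

Lemma mixS m v w x y :
  mix m.+1 (upd (upd v (2 * m) x) (2 * m).+1 y) w =
  mix m v (upd (upd w (2 * m) x) (2 * m).+1 y).
Proof.
apply/funext => i; rewrite /mix /upd mulnS add2n.
case: (ltngtP i (2 * m)) => [h|h|->].
- by rewrite (ltn_trans h)// ?ltnS ?leqnSn// !ltn_eqF// ltnS ltnW.
- rewrite ltnS leq_eqVlt ltnS (leqNgt i) h orbF.
  by case: eqP.
- by rewrite ltnS leqnSn !ltn_eqF.
Qed.

(** The pair of real coordinates [2 * m] and [2 * m + 1] moves the point along a complex line, so a
    holomorphic function of several variables restricts to a holomorphic function of [z]. *)
Lemma coords_mix_slice m (lt_mn : (m < n)%N) (v w : nat -> R) : exists c : Cn,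
  forall z : R[i], coords_to_Cn (mix m v (upd (upd w (2 * m) (Re z)) (2 * m).+1 (Im z))) =
    c + z *: delta_mx ord0 (Ordinal lt_mn).
Proof.
exists (\row_j if j == Ordinal lt_mn then 0 else coords_to_Cn (mix m v w) ord0 j).
move=> z; apply/rowP => j; rewrite !mxE eqxx /=.
have [->|jm] := eqVneq j (Ordinal lt_mn).
  rewrite /mix /upd /= ltnn ltnNge leqnSn /= eqxx ltn_eqF// eqxx add0r mulr1.
  by case: z.
rewrite mulr0 addr0 /mix /upd.
have jm' : (j : nat) != m by apply: contra jm => /eqP h; apply/eqP/val_inj.
have e1 : ((2 * j)%N == (2 * m)%N) = false by rewrite eqn_pmul2l//; exact/negbTE.
have e2 : ((2 * j).+1 == (2 * m).+1) = false by rewrite eqSS.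
have e3 : ((2 * j)%N == (2 * m).+1) = false.
  by apply/negbTE/negP => /eqP/(congr1 odd); rewrite /= !oddM.
have e4 : ((2 * j).+1 == (2 * m)%N) = false.
  by apply/negbTE/negP => /eqP/(congr1 odd); rewrite /= !oddM.
by rewrite e1 e2 e3 e4.
Qed.

Lemma measurable_square_indic (a : R * R) (r : R) :
  measurable_fun setT (square_indic a r).
Proof.
have mI c : measurable [set x : R | `|x - c| <= r].
  rewrite (_ : [set x | _] = `[c - r, c + r]%classic)//.
  by apply/seteqP; split => x /=; rewrite in_itv /= ler_distl.
rewrite (_ : square_indic a r =
    \1_([set x : R | `|x - a.1| <= r] `*` [set x : R | `|x - a.2| <= r])).
  by apply: measurable_indic; exact: measurableX.
apply/funext => x; rewrite /square_indic indicE; congr (nat_of_bool _)%:R.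
by apply/idP/idP => [/andP h|]; [rewrite inE; split; apply h|rewrite inE => -[/= -> ->]].
Qed.

Lemma polydisc_estimate (p r : R) : 1 <= p -> 0 < r -> exists2 K : R, 0 < K &
  forall (Om : set Cn) (f : Cn -> R[i]^o) (a : Cn), open Om -> holomorphic_on Om f ->
  polybox a r `<=` Om -> ((powR (cabs (f a)) p)%:E <= K%:E * intp Om p f)%E.
Proof.
move=> p1 r0; have [K K0 hK] := planar_estimate p1 r0.
exists (K ^+ n); first exact: exprn_gt0.
move=> Om f a oOm hf aOm; have [al ala] := coords_to_Cn_surj a.
have p0 : 0 < p by apply: lt_le_trans p1.
pose G v : R := \1_Om (coords_to_Cn v) * powR (cabs (f (coords_to_Cn v))) p.
have mG : coord_measurable G by exact: coord_measurable_intp_integrand.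
have G0 v : 0 <= G v by rewrite /G mulr_ge0 ?powR_ge0// indicE.
have GE0 v : (0 <= (G v)%:E)%E by rewrite lee_fin.
have mGE : coord_measurable (fun v => (G v)%:E).
  by move=> d T phi mphi; apply/measurable_EFinP; exact: mG.
have Om1 v : Om (coords_to_Cn v) -> G v = powR (cabs (f (coords_to_Cn v))) p.
  by move=> h; rewrite /G indicE mem_set// mul1r.
have near_al v : (forall i, (i < 2 * n)%N -> `|v i - al i| <= r) -> Om (coords_to_Cn v).
  move=> h; apply: aOm => j; rewrite -ala !mxE /=; split; apply: h.
    by rewrite ltn_pmul2l.
  by rewrite -[X in (X <= _)%N]/((2 * j).+2) -(addn2 (2 * j)) -mulnSr leq_pmul2l.
have claim m : (m <= n)%N -> forall w, (forall i, (2 * m <= i < 2 * n)%N -> `|w i - al i| <= r) ->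
    ((G (mix m al w))%:E <= (K ^+ m)%:E * iint (2 * m) (fun v => (G (mix m v w))%:E))%E.
  elim: m => [|m IH] mn w hw.
    rewrite muln0 expr0 mul1e /=.
    by rewrite (_ : mix 0 al w = mix 0 (fun=> 0) w).
  set w' := fun x y => upd (upd w (2 * m) x) (2 * m).+1 y.
  have hw' x y : `|x - al (2 * m)%N| <= r -> `|y - al (2 * m).+1| <= r ->
      forall i, (2 * m <= i < 2 * n)%N -> `|w' x y i - al i| <= r.
    move=> hx hy i /andP[i1 i2]; rewrite /w' /upd.
    case: eqP => [->//|/eqP n1]; case: eqP => [->//|/eqP n2].
    apply: hw; rewrite i2 andbT mulnS add2n ltn_neqAle eq_sym n1 /=.
    by rewrite ltn_neqAle eq_sym n2.
  have inOm x y : `|x - al (2 * m)%N| <= r -> `|y - al (2 * m).+1| <= r ->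
      Om (coords_to_Cn (mix m al (w' x y))).
    move=> hx hy; apply: near_al => i ilt; rewrite /mix; case: ltnP => h.
      by rewrite subrr normr0 ltW.
    by apply: hw' => //; rewrite h.
  have [c hc] := coords_mix_slice mn al w.
  pose h : R[i]^o -> R[i]^o := fun z => f (c + z *: delta_mx ord0 (Ordinal mn)).
  have hE x y : h (Complex x y) = f (coords_to_Cn (mix m al (w' x y))).
    by rewrite /h -hc.
  have dh z : rect (al (2 * m)%N - r) (al (2 * m)%N + r) (al (2 * m).+1 - r) (al (2 * m).+1 + r) z ->
      differentiable h z.
    case: z => x y [/= hx hy].
    have Oz : Om (c + (Complex x y : R[i]) *: delta_mx ord0 (Ordinal mn)).
      by rewrite -hc; apply: inOm; rewrite ler_distl.
    apply: (@differentiable_comp _ _ _ _ (fun z : R[i]^o => c + z *: delta_mx ord0 (Ordinal mn)) f);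
      last exact: hf.
    by apply: (@differentiableD _ _ _ (cst c)).
  pose Phi (xy : R * R) := iint (2 * m) (fun v => (G (mix m v (w' xy.1 xy.2)))%:E).
  have Phi0 xy : (0 <= Phi xy)%E.
    by rewrite /Phi; apply: iint_ge0 => v; exact: GE0.
  have mPhi : measurable_fun setT Phi.
    apply: measurable_iint_param => [t v|d' S psi phi mpsi mphi]; first exact: GE0.
    pose vphi i s := if (i < 2 * m)%N then phi i s else
      if i == (2 * m).+1 then (psi s).2 else if i == (2 * m)%N then (psi s).1 else w i.
    apply: (mGE _ _ vphi) => i; rewrite /vphi.
    case: (i < 2 * m)%N => //; case: (i == (2 * m).+1); first exact: measurableT_comp.
    by case: (i == (2 * m)%N) => //; exact: measurableT_comp.
  pose g (x : R * R) : R :=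
    square_indic (al (2 * m)%N, al (2 * m).+1) r x * powR (cabs (h (Complex x.1 x.2))) p.
  have gG x : g x = square_indic (al (2 * m)%N, al (2 * m).+1) r x * G (mix m al (w' x.1 x.2)).
    rewrite /g /square_indic /=; case: (boolP (_ && _)) => [/andP[h1 h2]|]; last by rewrite !mul0r.
    by rewrite Om1 ?hE//; exact: inOm.
  have mg : measurable_fun setT g.
    rewrite (_ : g = (fun x => square_indic (al (2 * m)%N, al (2 * m).+1) r x *
        G (mix m al (w' x.1 x.2)))); last exact/funext.
    apply: measurable_funM; first exact: measurable_square_indic.
    pose vphi i (s : R * R) := if (i < 2 * m)%N then al i else
      if i == (2 * m).+1 then s.2 else if i == (2 * m)%N then s.1 else w i.
    apply: (mG _ _ vphi) => i; rewrite /vphi.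
    case: (i < 2 * m)%N => //; case: (i == (2 * m).+1); first exact: measurable_snd.
    by case: (i == (2 * m)%N) => //; exact: measurable_fst.
  have g0 x : 0 <= g x by rewrite gG mulr_ge0 ?ler0n.
  have gPhi x : ((g x)%:E <= (K ^+ m)%:E * Phi x)%E.
    rewrite gG /square_indic /=; case: (boolP (_ && _)) => [/andP[h1 h2]|_]; last first.
      by rewrite mul0r mule_ge0// lee_fin exprn_ge0// ltW.
    by rewrite mul1r; apply: IH; [exact: ltnW|exact: hw'].
  have Km0 : 0 <= K ^+ m by rewrite exprn_ge0// ltW.
  have mgE : measurable_fun setT (EFin \o g) by exact/measurable_EFinP.
  have mKPhi : measurable_fun setT (fun x => (K ^+ m)%:E * Phi x)%E by exact: measurable_funeM.
  have KPhi0 x : (0 <= (K ^+ m)%:E * Phi x)%E by rewrite mule_ge0.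
  have step1 : (\int[mu]_y \int[mu]_x (g (x, y))%:E <=
      (K ^+ m)%:E * \int[mu]_y \int[mu]_x Phi (x, y))%E.
    apply: (@le_trans _ _ (\int[mu]_y \int[mu]_x ((K ^+ m)%:E * Phi (x, y)))%E).
      apply: ge0_le_integral; first exact: measurableT.
      - by move=> y _; apply: integral_ge0 => x _; rewrite lee_fin.
      - by apply: (measurable_fun_fubini_tonelli_G (m1 := mu) _ mgE) => x; rewrite lee_fin.
      - exact: (measurable_fun_fubini_tonelli_G (m1 := mu) _ mKPhi).
      - move=> y _; apply: ge0_le_integral; first exact: measurableT.
        + by move=> x _; rewrite lee_fin.
        + exact: (measurableT_comp mgE (pair2_measurable _)).
        + exact: (measurableT_comp mKPhi (pair2_measurable _)).
        + by move=> x _; exact: gPhi.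
    rewrite -ge0_integralZl_EFin//; last first.
      exact: (measurable_fun_fubini_tonelli_G (m1 := mu) _ mPhi).
      by move=> y _; exact: integral_ge0.
    rewrite le_eqVlt; apply/orP; left; apply/eqP; apply: eq_integral => y _.
    apply: ge0_integralZl_EFin; [exact: measurableT|by move=> x _; exact: Phi0| |].
      exact: (measurableT_comp mPhi (pair2_measurable _)).
    by rewrite exprn_ge0// ltW.
  have iE : iint (2 * m.+1) (fun v => (G (mix m.+1 v w))%:E) = (\int[mu]_y \int[mu]_x Phi (x, y))%E.
    rewrite mulnS add2n iintS; apply: eq_integral => y _; rewrite iintS.
    by apply: eq_integral => x _; rewrite /Phi; congr iint; apply/funext => v; rewrite mixS.
  have aE : mix m.+1 al w = mix m al (w' (al (2 * m)%N) (al (2 * m).+1)).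
    rewrite /w' -mixS; congr mix; apply/funext => i; rewrite /upd.
    by case: eqP => [->//|_]; case: eqP => [->//|_].
  have z0 (x : R) : `|x - x| <= r by rewrite subrr normr0 ltW.
  rewrite iE aE Om1; last by apply: inOm; exact: z0.
  rewrite -hE exprS EFinM -muleA; apply: le_trans (hK h _ _ dh mg) _.
  by apply: lee_wpmul2l => //; rewrite lee_fin ltW.
have := claim n (leqnn n) al; rewrite (_ : mix n al al = al); last first.
  by apply/funext => i; rewrite /mix; case: ifP.
rewrite Om1; last by rewrite ala; apply: aOm => j; rewrite !subrr normr0; split; exact: ltW.
rewrite ala => /(_ _)/le_trans; apply.
  by move=> i; rewrite ltnNge; case: leqP.
rewrite le_eqVlt; apply/orP; left; apply/eqP; congr (_ * _)%E.
rewrite /intp; congr iint; apply/funext => v; rewrite -/(G v); congr EFin.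
suff E : @coords_to_Cn R n (mix n v al) = coords_to_Cn v by rewrite /G E.
apply/rowP => j; rewrite !mxE /mix.
have j1 : (2 * j < 2 * n)%N by rewrite ltn_pmul2l.
have j2 : ((2 * j).+1 < 2 * n)%N.
  by rewrite -[X in (X <= _)%N]/((2 * j).+2) -(addn2 (2 * j)) -mulnSr leq_pmul2l.
by rewrite j1 j2.
Qed.

End PolydiscEstimate.

(** * Holomorphic functions of several variables *)

Section ComplexLimits.
Context {R : realType}.

Definition ccvg (u : nat -> R[i]) (l : R[i]) := forall e : R, 0 < e ->
  exists N, forall k, (N <= k)%N -> cabs (u k - l) <= e.

Definition ccauchy (u : nat -> R[i]) := forall e : R, 0 < e ->
  exists N, forall j k, (N <= j)%N -> (N <= k)%N -> cabs (u j - u k) <= e.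

Lemma real_cauchy_cvg (u : nat -> R) : (forall e : R, 0 < e ->
    exists N, forall j k, (N <= j)%N -> (N <= k)%N -> `|u j - u k| <= e) ->
  exists l, forall e : R, 0 < e -> exists N, forall k, (N <= k)%N -> `|u k - l| <= e.
Proof.
move=> H; have : cvg (u @ \oo).
  apply/cauchy_cvgP/cauchy_exP => e e0; have e2 : 0 < e / 2 by rewrite divr_gt0.
  have [N hN] := H _ e2; exists (u N); exists N => // k /= Nk.
  rewrite /ball /=; apply: le_lt_trans (hN _ _ (leqnn N) Nk) _.
  by rewrite ltr_pdivrMr// ltr_pMr// ltr1n.
move=> /cvgrPdist_le cu; exists (lim (u @ \oo)) => e e0.
by have [N _ hN] := cu _ e0; exists N => k /hN; rewrite distrC.
Qed.

Lemma ccauchy_cvg (u : nat -> R[i]) : ccauchy u -> exists l, ccvg u l.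
Proof.
move=> cu.
have [|a ha] := @real_cauchy_cvg (fun k => Re (u k)).
  move=> e /cu[N hN]; exists N => j k jN kN; apply: le_trans (hN _ _ jN kN).
  by rewrite -ReN -ReD Re_le_cabs.
have [|b hb] := @real_cauchy_cvg (fun k => Im (u k)).
  move=> e /cu[N hN]; exists N => j k jN kN; apply: le_trans (hN _ _ jN kN).
  by rewrite -ImN -ImD Im_le_cabs.
exists (Complex a b) => e e0; have e2 : 0 < e / 2 by rewrite divr_gt0.
have [N1 h1] := ha _ e2; have [N2 h2] := hb _ e2.
exists (maxn N1 N2) => k; rewrite geq_max => /andP[/h1 k1 /h2 k2].
apply: le_trans (cabs_le_ReIm _) _; rewrite ReD ImD ReN ImN /=.
by rewrite [leRHS]splitr lerD.
Qed.

End ComplexLimits.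

(** * Taylor estimates and Weierstrass' theorem *)

Section HolomorphicSeveral.
Context {R : realType} {n : nat}.
Local Notation Cn := (Cn R n).
Implicit Types (E U : set Cn) (F G f : Cn -> R[i]^o) (a z v : Cn).

(** The norm of row vectors is the largest modulus of a coordinate, so these balls are polydiscs. *)
Definition rball a (r : R) : set Cn := [set z | rnorm (z - a) < r].

Lemma rball_sub a z (r s : R) : rnorm (z - a) + s <= r -> rball z s `<=` rball a r.
Proof.
move=> h w /= wz; rewrite /rball /=; apply: le_lt_trans (rnorm_trans z _ _) _.
by move: wz h; rewrite /rball /=; lra.
Qed.

Lemma open_rball a r : open (rball a r).
Proof.
apply/open_rnorm => z /= za; exists (r - rnorm (z - a)); first by rewrite subr_gt0.
by move=> y yz; apply: (@rball_sub a z r (r - rnorm (z - a))) => //; lra.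
Qed.

Lemma open_rball_sub U z : open U -> U z -> exists2 d : R, 0 < d & rball z d `<=` U.
Proof. by move=> /open_rnorm oU /oU. Qed.

Lemma rball_center z (d : R) : 0 < d -> rball z d z.
Proof. by move=> d0; rewrite /rball /= subrr rnorm0. Qed.

Lemma polybox_sub_rball z (r : R) : 0 < r -> polybox z (r / 4) `<=` rball z r.
Proof.
move=> r0 w hw; apply: rnorm_lt => // j; rewrite !mxE.
apply: le_lt_trans (cabs_le_ReIm _) _; rewrite ReD ImD ReN ImN.
by have [] := hw j; lra.
Qed.

Lemma holomorphic_onS U E f : U `<=` E -> holomorphic_on E f -> holomorphic_on U f.
Proof. by move=> UE hf z /UE; exact: hf. Qed.

Lemma holomorphic_onB U f F : holomorphic_on U f -> holomorphic_on U F ->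
  holomorphic_on U (fun z => f z - F z).
Proof. by move=> hf hF z Uz; exact: (differentiableB (hf _ Uz) (hF _ Uz)). Qed.

Lemma holomorphic_onD U f F : holomorphic_on U f -> holomorphic_on U F ->
  holomorphic_on U (fun z => f z + F z).
Proof. by move=> hf hF z Uz; exact: (differentiableD (hf _ Uz) (hF _ Uz)). Qed.

Lemma holomorphic_onM U (c : R[i]) f : holomorphic_on U f ->
  holomorphic_on U (fun z => c * f z).
Proof. by move=> hf z Uz; exact: (differentiableZ c (hf _ Uz)). Qed.

Lemma holomorphic_locally_bounded U F z : open U -> holomorphic_on U F -> U z ->
  exists2 d : R, 0 < d & rball z d `<=` U /\
    exists M : R, forall w, rball z d w -> cabs (F w) <= M.
Proof.
move=> oU hF Uz; have [d1 d10 hd1] := open_rball_sub oU Uz.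
have /differentiable_continuous/continuous_rnorm/(_ _ (@ltr01 R))[d2 d20 hd2] := hF _ Uz.
exists (Num.min d1 d2); first by rewrite lt_min d10.
split; first by move=> w; rewrite /rball /= lt_min => /andP[/hd1].
exists (cabs (F z) + 1) => w; rewrite /rball /= lt_min => /andP[_ /hd2].
by have := cabs_dist (F w) (F z); lra.
Qed.

Lemma rect_cabs (s : R) (t : R[i]^o) : rect (- s) s (- s) s t -> cabs t <= 2 * s.
Proof.
move=> [/= h1 h2]; apply: le_trans (cabs_le_ReIm _) _.
by rewrite mulr_natl mulr2n; apply: lerD; rewrite ler_norml.
Qed.

Lemma differentiable_line f a v (t : R[i]^o) : differentiable f (a + (t : R[i]) *: v) ->
  differentiable (fun s : R[i]^o => f (a + (s : R[i]) *: v)) t.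
Proof.
by move=> df; apply: (@differentiable_comp _ _ _ _ (fun z : R[i]^o => a + z *: v) f).
Qed.

(** Two first order expansions along the same complex line agree up to [o(t)], hence have the same
    coefficient. This identifies the number delivered by [cauchy_taylor2] with a value of the
    differential. *)
Lemma diff_lineE f a v (C l : R) (D : R[i]) : differentiable f a -> 0 < C -> 0 < l ->
  (forall t : R[i], cabs t <= l -> cabs (f (a + t *: v) - f a - t * D) <= C * cabs t ^+ 2) ->
  D = 'd f a v.
Proof.
move=> df C0 l0 H; apply/eqP; rewrite -subr_eq0; apply/eqP/cabs_le_all_eq0 => e e0.
have V0 : 0 < rnorm v + 1 by rewrite ltr_wpDl ?rnorm_ge0.
have e1 : 0 < e / 2 / (rnorm v + 1) by rewrite !divr_gt0.
have [d d0 hd] := differentiable_rnorm df e1.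
pose t : R := Num.min l (Num.min (d / 2 / (rnorm v + 1)) (e / 2 / C)).
have t0 : 0 < t by rewrite !lt_min l0 !divr_gt0.
have tl : t <= l by rewrite ge_min lexx.
have td : t * (rnorm v + 1) < d.
  apply: (@le_lt_trans _ _ (d / 2)); last by rewrite ltr_pdivrMr// ltr_pMr// ltr1n.
  by rewrite -ler_pdivlMr// !ge_min lexx orbT.
have te : C * t <= e / 2 by rewrite mulrC -ler_pdivlMr// !ge_min lexx !orbT.
have ct : cabs t%:C = t by rewrite cabs_real gtr0_norm.
have h1 := H t%:C; rewrite ct in h1; have {}h1 := h1 tl.
have := hd (t%:C *: v); rewrite rnormZ ct => h2.
have tv : t * rnorm v < d by apply: le_lt_trans td; apply: ler_wpM2l; [exact: ltW|rewrite lerDl].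
have {}h2 := h2 tv.
have E : t%:C * (D - 'd f a v) =
  (f (a + t%:C *: v) - f a - 'd f a (t%:C *: v)) - (f (a + t%:C *: v) - f a - t%:C * D).
  by rewrite linearZ /= -[_ *: 'd f a v]/(t%:C * 'd f a v); ring.
have : t * cabs (D - 'd f a v) <= t * e.
  rewrite -{1}ct -cabsM E; apply: le_trans (cabs_sub _ _) _.
  have V1 : rnorm v / (rnorm v + 1) <= 1 by rewrite ler_pdivrMr// mul1r lerDl.
  have h3 : e / 2 / (rnorm v + 1) * (t * rnorm v) <= t * (e / 2).
    rewrite (_ : _ * _ = t * (e / 2) * (rnorm v / (rnorm v + 1))); last by ring.
    by rewrite ler_piMr// mulr_ge0 ?divr_ge0// ltW.
  have h4 : C * t ^+ 2 <= t * (e / 2).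
    by rewrite expr2 mulrA mulrC ler_wpM2l// ltW.
  rewrite (_ : t * e = t * (e / 2) + t * (e / 2)); last by field.
  by apply: lerD; [exact: le_trans h2 h3|exact: le_trans h1 h4].
by rewrite ler_pM2l.
Qed.

(** [cauchy_taylor2] is applied on the line through [a] in the direction of [h], rescaled to norm
    [rho / 8]. In the square of half-side 2 the parameter has modulus at most 4, so the line stays
    within [rho / 2] of [a], and [a + h] is reached at the parameter [s <= 1]. *)
Lemma holomorphic_taylor f a (rho M : R) : 0 < rho -> holomorphic_on (rball a rho) f ->
  (forall z, rball a rho z -> cabs (f z) <= M) ->
  forall h, rnorm h <= rho / 8 ->
   cabs ('d f a h) <= 16 * M / rho * rnorm h /\
   cabs (f (a + h) - f a - 'd f a h) <= 128 * M / rho ^+ 2 * rnorm h ^+ 2.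
Proof.
move=> r0 hf fM h hr.
have ra : rball a rho a by rewrite /rball /= subrr rnorm0.
have M0 : 0 <= M by apply: le_trans (fM _ ra); exact: cabs_ge0.
have [h0|h0] := eqVneq h 0.
  rewrite h0 linear0 addr0 subrr subr0 cabs0 rnorm0 !mulr0 expr0n /= mulr0.
  by [].
have nh : 0 < rnorm h by rewrite lt_neqAle eq_sym rnorm_eq0 h0 rnorm_ge0.
pose s := 8 * rnorm h / rho.
have s0 : 0 < s by rewrite divr_gt0// mulr_gt0.
have s1 : s <= 1 by rewrite ler_pdivrMr// mul1r; lra.
have cs : cabs s%:C = s by rewrite cabs_real gtr0_norm.
have sn0 : s%:C != 0 by rewrite -cabs_gt0 cs.
pose v := (s%:C)^-1 *: h.
have hv : h = s%:C *: v by rewrite /v scalerA divff// scale1r.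
have nv : rnorm v = rho / 8.
  rewrite /v rnormZ cabsV cs /s; field; rewrite !gt_eqF//.
have inb (t : R[i]^o) : rect (-2) 2 (-2) 2 t -> rball a rho (a + (t : R[i]) *: v).
  move=> /rect_cabs ht; rewrite /rball /= addrAC subrr add0r rnormZ nv.
  by nra.
have [||D [D1 D2]] := @cauchy_taylor2 R (fun t : R[i]^o => f (a + (t : R[i]) *: v)) M.
- by move=> t /inb ht; apply: differentiable_line; exact: hf.
- by move=> t /inb ht; exact: fM.
have da : differentiable f a by exact: hf.
have DE : D = 'd f a v.
  apply: (@diff_lineE f a v (2 * M + 1) 1) => //; first by lra.
  move=> t t1; have := D2 t t1; rewrite scale0r addr0 => /le_trans; apply.
  by rewrite ler_wpM2r ?exprn_ge0 ?cabs_ge0//; lra.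
have dh : 'd f a h = s%:C * D by rewrite {1}hv linearZ DE.
split.
  rewrite dh cabsM cs (_ : _ * rnorm h = s * (2 * M)); last first.
    by rewrite /s; ring.
  by rewrite ler_wpM2l// ltW.
have := D2 s%:C; rewrite cs scale0r addr0 => /(_ s1).
rewrite -hv -dh => /le_trans; apply.
rewrite /s le_eqVlt; apply/orP; left; apply/eqP.
by field; rewrite gt_eqF.
Qed.

Lemma rnorm_delta j : rnorm (delta_mx ord0 j : Cn) <= 1.
Proof.
apply: rnorm_le => // k; rewrite mxE eqxx /=; case: eqP => _ /=.
  by rewrite cabs1.
by rewrite cabs0.
Qed.

Lemma linear_coord (L : {linear Cn -> R[i]^o}) h :
  L h = \sum_j (h ord0 j) * L (delta_mx ord0 j).
Proof.
rewrite {1}[h]row_sum_delta linear_sum; apply: eq_bigr => j _.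
by rewrite linearZ.
Qed.

Lemma diffB_ext F G a h : differentiable F a -> differentiable G a ->
  'd (fun z => F z - G z) a h = 'd F a h - 'd G a h.
Proof. by move=> dF dG; have /(congr1 (fun L : Cn -> R[i]^o => L h)) := diffB dF dG. Qed.

Lemma diff_scaledB F G a (c : R[i]) h : differentiable F a -> differentiable G a ->
  'd (fun z => F z - G z) a (c *: h) = c * ('d F a h - 'd G a h) :> R[i].
Proof.
move=> dF dG.
have E1 := diffB_ext (c *: h) dF dG.
have E2 : 'd F a (c *: h) = c * 'd F a h by exact: linearZ.
have E3 : 'd G a (c *: h) = c * 'd G a h by exact: linearZ.
have E4 : c * 'd F a h - c * 'd G a h = c * ('d F a h - 'd G a h) :> R[i].
  exact/esym/mulrBr.
exact: (etrans E1 (etrans (congr2 (fun x y : R[i]^o => x - y) E2 E3) E4)).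
Qed.

Definition locally_uniform_cvg U (F_ : nat -> Cn -> R[i]^o) F := forall a, U a ->
  exists2 r : R, 0 < r & rball a r `<=` U /\ forall e : R, 0 < e ->
    exists N, forall k, (N <= k)%N ->
    forall z, rball a r z -> cabs (F_ k z - F z) <= e.

(** The first order bound for [F_ k - F_ l] shows that the differentials at [a] form Cauchy
    sequences on the basis vectors; their limits define the candidate [L]. The quadratic remainder
    bound is uniform in [k] and passes to the limit. *)
Lemma weierstrass U (F_ : nat -> Cn -> R[i]^o) F :
  (forall k, holomorphic_on U (F_ k)) -> locally_uniform_cvg U F_ F ->
  holomorphic_on U F.
Proof.
move=> hF cF a Ua; have [r' r'0 [rU' cv']] := cF a Ua.
have [N0 hN0] := cv' _ (@ltr01 R).
have da : differentiable (F_ N0) a by exact: hF.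
have /continuous_rnorm/(_ _ (@ltr01 R))[d d0 hd] := differentiable_continuous da.
pose r := Num.min r' d.
have r0 : 0 < r by rewrite lt_min r'0.
have rr' : rball a r `<=` rball a r'.
  by move=> z; rewrite /rball /= lt_min => /andP[].
have rU : rball a r `<=` U by move=> z /rr' /rU'.
have cv (e : R) : 0 < e -> exists N, forall k, (N <= k)%N ->
    forall z, rball a r z -> cabs (F_ k z - F z) <= e.
  by move=> /cv'[N hN]; exists N => k /hN H z /rr' /H.
(* One unit for the variation of [F_ N0] near [a], one for the distance of [F] to [F_ N0], one for
   that of [F_ k] to [F]. *)
pose M := cabs (F_ N0 a) + 3.
have bN0 z : rball a r z -> cabs (F z) <= M - 1.
  move=> zr; have := hN0 N0 (leqnn _) z (rr' _ zr).
  have : cabs (F_ N0 z - F_ N0 a) < 1 by apply: hd; move: zr; rewrite /rball /= lt_min => /andP[].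
  have := cabs_dist (F_ N0 z) (F_ N0 a); have := cabs_dist (F z) (F_ N0 z).
  by rewrite (cabsB (F z)) /M; lra.
have bF k : (N0 <= k)%N -> forall z, rball a r z -> cabs (F_ k z) <= M.
  move=> kN z zr; have := hN0 k kN z (rr' _ zr).
  by have := bN0 _ zr; have := cabs_dist (F_ k z) (F z); lra.
have hol k : holomorphic_on (rball a r) (F_ k) by exact: holomorphic_onS (hF k).
pose c : R := r / 8.
have c0 : 0 < c by rewrite divr_gt0.
have cn0 : c%:C != 0 by rewrite -cabs_gt0 cabs_real gtr0_norm.
have cc : cabs c%:C = c by rewrite cabs_real gtr0_norm.
have Lc j : ccauchy (fun k => 'd (F_ k) a (delta_mx ord0 j)).
  move=> e e0; have e1 : 0 < e * r / 32 by rewrite divr_gt0// mulr_gt0.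
  have [N hN] := cv _ e1; exists N => k l kN lN.
  have dk : differentiable (F_ k) a by apply: hol; rewrite /rball /= subrr rnorm0.
  have dl : differentiable (F_ l) a by apply: hol; rewrite /rball /= subrr rnorm0.
  have nd : rnorm (c%:C *: (delta_mx ord0 j : Cn)) <= r / 8.
    by rewrite rnormZ cc ler_piMr// ?rnorm_delta// ltW.
  have [|h1 _] := @holomorphic_taylor (fun z => F_ k z - F_ l z) a r (e * r / 16) r0
    (holomorphic_onB (hol k) (hol l)) _ _ nd.
    move=> z zr; have := hN k kN z zr; have := hN l lN z zr.
    by have := cabs_trans (F z) (F_ k z) (F_ l z); rewrite (cabsB (F z)); lra.
  have dE : 'd (fun z => F_ k z - F_ l z) a (c%:C *: delta_mx ord0 j) =
     c%:C * ('d (F_ k) a (delta_mx ord0 j) - 'd (F_ l) a (delta_mx ord0 j)).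
    exact: diff_scaledB.
  have cE := etrans (congr1 (@cabs R) dE) (cabsM _ _); rewrite cc in cE.
  have {}h1 := eq_ind _ (fun u : R => u <= 16 * (e * r / 16) / r *
    rnorm (c%:C *: (delta_mx ord0 j : Cn))) h1 _ cE.
  have h2 : 16 * (e * r / 16) / r * rnorm (c%:C *: (delta_mx ord0 j : Cn)) <= e * c.
    rewrite (_ : 16 * (e * r / 16) / r = e); last by field; rewrite gt_eqF.
    by rewrite ler_wpM2l// ltW.
  by have := le_trans h1 h2; rewrite mulrC ler_pM2r.
have /choice[lam hlam] : forall j, exists l, ccvg (fun k => 'd (F_ k) a (delta_mx ord0 j)) l.
  by move=> j; exact: ccauchy_cvg.
pose Lf (h : Cn) : R[i]^o := \sum_j (h ord0 j) * lam j.
have Llin : linear Lf.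
  move=> t x y; rewrite /Lf scaler_sumr -big_split /=; apply: eq_bigr => j _.
  by rewrite !mxE mulrDl -mulrA.
pose LfM := @GRing.isLinear.Build _ _ _ _ Lf Llin.
pose L : {linear Cn -> R[i]^o} := HB.pack Lf LfM.
have cL : continuous L.
  move=> x; apply/continuous_rnorm => e e0.
  pose S := \sum_j cabs (lam j).
  have S0 : 0 <= S by apply: sumr_ge0 => j _; exact: cabs_ge0.
  exists (e / (S + 1)) => [|y]; first by rewrite divr_gt0// ltr_wpDl.
  rewrite ltr_pdivlMr ?ltr_wpDl// => hy.
  rewrite -linearB /= /Lf; apply: le_lt_trans (cabs_sum _ _ _) _.
  apply: (@le_lt_trans _ _ (rnorm (y - x) * S)); last first.
    by apply: le_lt_trans hy; rewrite mulrDr mulr1 lerDl rnorm_ge0.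
  rewrite mulr_sumr; apply: ler_sum => j _; rewrite cabsM ler_wpM2r ?cabs_ge0//.
  exact: cabs_le_rnorm.
have cvL h (e : R) : 0 < e -> exists N, forall k, (N <= k)%N -> cabs ('d (F_ k) a h - Lf h) <= e.
  move=> e0; pose e1 := e / (n%:R * rnorm h + 1).
  have n1 : 0 < n%:R * rnorm h + 1 by rewrite ltr_wpDl// mulr_ge0// rnorm_ge0.
  have e10 : 0 < e1 by rewrite divr_gt0.
  have /choice[N hN] : forall j, exists N, forall k, (N <= k)%N ->
      cabs ('d (F_ k) a (delta_mx ord0 j) - lam j) <= e1.
    by move=> j; exact: hlam.
  exists (\max_j N j)%N => k kN.
  rewrite linear_coord /Lf -sumrB; apply: le_trans (cabs_sum _ _ _) _.
  apply: (@le_trans _ _ (\sum_(j < n) rnorm h * e1)).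
    apply: ler_sum => j _; rewrite -mulrBr cabsM; apply: ler_pM; rewrite ?cabs_ge0//.
      exact: cabs_le_rnorm.
    by apply: hN; apply: leq_trans kN; exact: (@leq_bigmax _ N j).
  rewrite sumr_const card_ord -mulr_natl mulrA /e1 mulrA ler_pdivrMr// mulrC.
  by rewrite ler_wpM2l ?ltW// ltrDl.
have main h : rnorm h <= r / 8 ->
    cabs (F (a + h) - F a - Lf h) <= 128 * M / r ^+ 2 * rnorm h ^+ 2.
  move=> hr; apply/ler_addgt0Pr => e e0.
  have e3 : 0 < e / 3 by rewrite divr_gt0.
  have [N1 h1] := cv _ e3; have [N2 h2] := cvL h _ e3.
  pose k := maxn N0 (maxn N1 N2).
  have k0 : (N0 <= k)%N by rewrite leq_maxl.
  have k1 : (N1 <= k)%N by rewrite /k maxnA (maxnC N0) -maxnA leq_maxl.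
  have k2 : (N2 <= k)%N by rewrite /k maxnA leq_maxr.
  have [_ T] := @holomorphic_taylor (F_ k) a r M r0 (hol k) (bF k k0) h hr.
  have A1 := h1 k k1 (a + h); have A2 := h1 k k1 a; have A3 := h2 k k2.
  have ra : rball a r a by rewrite /rball /= subrr rnorm0.
  have rah : rball a r (a + h) by rewrite /rball /= addrAC subrr add0r; lra.
  have {}A1 := A1 rah; have {}A2 := A2 ra.
  have -> : F (a + h) - F a - Lf h = (F_ k (a + h) - F_ k a - 'd (F_ k) a h) -
    (F_ k (a + h) - F (a + h)) + (F_ k a - F a) + ('d (F_ k) a h - Lf h).
    by ring.
  have e33 (x : R) : x + e / 3 + e / 3 + e / 3 = x + e by field.
  apply: le_trans (cabsD _ _) _; rewrite -e33; apply: lerD; last exact: A3.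
  apply: le_trans (cabsD _ _) _; apply: lerD; last exact: A2.
  by apply: le_trans (cabs_sub _ _) _; apply: lerD.
apply: (differentiable_rnormP cL) => e e0.
pose C := 128 * M / r ^+ 2 + 1.
have M0 : 0 <= M by rewrite /M addr_ge0 ?cabs_ge0.
have C0 : 0 < C by rewrite ltr_wpDl// divr_ge0 ?mulr_ge0 ?exprn_ge0// ltW.
exists (Num.min c (e / C)); first by rewrite lt_min c0 divr_gt0.
move=> h; rewrite lt_min => /andP[hc he].
apply: le_trans (main _ (ltW hc)) _.
rewrite expr2 mulrA; apply: ler_wpM2r; first exact: rnorm_ge0.
move: he; rewrite ltr_pdivlMr// => he; apply: le_trans (ltW he).
by rewrite mulrC; apply: ler_wpM2l; rewrite ?rnorm_ge0// /C lerDl.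
Qed.

End HolomorphicSeveral.

(** * Vitali's theorem and the identity theorem *)

Section Vitali.
Context {R : realType} {n : nat}.
Local Notation Cn := (Cn R n).
Implicit Types (E U : set Cn) (F G f : Cn -> R[i]^o) (a z v : Cn).

(** The points of [E] with property [P] form a nonempty, relatively open and closed subset. The
    principle serves both for Vitali's theorem and for finding boundary points of components. *)
Lemma connected_propagation E (P : Cn -> Prop) z0 : connected E -> E z0 -> P z0 ->
  (forall z, E z -> P z -> exists2 d : R, 0 < d & forall y, rball z d y -> P y) ->
  (forall z, E z -> (forall d : R, 0 < d -> exists y, [/\ E y, P y & rball z d y]) -> P z) ->
  forall z, E z -> P z.
Proof.
move=> cE Ez0 Pz0 hop hcl.
pose B := [set z | E z /\ P z].
have BE : B = E.
  apply: cE; first by exists z0.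
    exists [set z | exists2 d : R, 0 < d & forall y, rball z d y -> P y].
      apply/open_rnorm => z [d d0 hd]; exists (d / 2) => [|y yz]; first by rewrite divr_gt0.
      exists (d / 2) => [|w wy]; first by rewrite divr_gt0.
      by apply: hd; apply: (@rball_sub _ _ z y d (d / 2)) => //; lra.
    apply/seteqP; split => z /= [Ez h]; first by split => //; exact: hop.
    split => //; case: h => d d0; apply.
    by rewrite /rball /= subrr rnorm0.
  exists (closure B); first exact: closed_closure.
  apply/seteqP; split => z /= [Ez h]; first by split => //; apply: subset_closure.
  split => //; apply: hcl => // d d0.
  have [|y [[Ey Py] yz]] := h (rball z d).
    by apply/nbhs_rnorm; exists d.
  by exists y.
by move=> z; rewrite -{1}BE => -[].
Qed.

Definition uniformly_cauchy_on U (F_ : nat -> Cn -> R[i]^o) := forall e : R, 0 < e ->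
  exists N, forall j k, (N <= j)%N -> (N <= k)%N -> forall z, U z ->
    cabs (F_ j z - F_ k z) <= e.

(** [two_constants] for [F_ j - F_ k] on the complex line from [a] through [z], where [z] has
    parameter 1. The radius [rho / 8] reached does not depend on [s], which is the whole point. *)
Lemma uniformly_cauchy_spread (F_ : nat -> Cn -> R[i]^o) a (rho s M : R) :
  0 < rho -> 0 < s -> (forall k, holomorphic_on (rball a rho) (F_ k)) ->
  (forall k z, rball a rho z -> cabs (F_ k z) <= M) ->
  uniformly_cauchy_on (rball a s) F_ -> uniformly_cauchy_on (rball a (rho / 8)) F_.
Proof.
move=> r0 s0 hF bF uc e e0.
(* Parameters in the square of half-side [sg] have modulus at most [2 * sg] and the direction has
   norm below [rho / 8], so [sg <= s / rho] keeps the points inside the ball of radius [s]; the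
   bound [1 / 2] gives [sg < 1]. *)
pose sg := Num.min (1 / 2) (s / rho).
have sg0 : 0 < sg by rewrite lt_min !divr_gt0.
have sg1 : sg < 1.
  by apply: (@le_lt_trans _ _ (1 / 2)); [rewrite ge_min lexx|lra].
have sgs : sg * rho <= s by rewrite -ler_pdivlMr// ge_min lexx orbT.
have [d d0 hd] := two_constants (2 * M) sg0 sg1 e0.
have [N hN] := uc _ d0; exists N => j k jN kN z zr.
pose v := z - a.
have vr : rnorm v < rho / 8 by [].
have v0 := rnorm_ge0 v.
have inr (t : R[i]^o) : rect (-2) 2 (-2) 2 t -> rball a rho (a + (t : R[i]) *: v).
  move=> /rect_cabs ht; rewrite /rball /= addrAC subrr add0r rnormZ.
  have := cabs_ge0 t; nra.
have ins (t : R[i]^o) : rect (- sg) sg (- sg) sg t -> rball a s (a + (t : R[i]) *: v).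
  move=> /rect_cabs ht; rewrite /rball /= addrAC subrr add0r rnormZ.
  have := cabs_ge0 t; nra.
have := hd (fun t : R[i]^o => F_ j (a + (t : R[i]) *: v) - F_ k (a + (t : R[i]) *: v)).
have av : a + v = z by rewrite /v addrC subrK.
rewrite scale1r av; apply.
- move=> t /inr ht.
  by apply: (@differentiable_line _ _ (fun z => F_ j z - F_ k z)); apply: holomorphic_onB ht; exact: hF.
- move=> t /inr ht; apply: le_trans (cabs_sub _ _) _.
  by have := bF j _ ht; have := bF k _ ht; lra.
- by move=> t /ins ht; exact: hN.
Qed.

(** The set of points near which the sequence is uniformly Cauchy is open. It is closed in [E]
    because the spreading radius is governed by the ball on which the sequence is bounded, however
    small the ball of convergence at a nearby point. *)
Lemma vitali E (F_ : nat -> Cn -> R[i]^o) a0 : connected E -> E a0 ->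
  (forall k, holomorphic_on E (F_ k)) ->
  (forall z, E z -> exists2 r : R, 0 < r & rball z r `<=` E /\
     exists M, forall k w, rball z r w -> cabs (F_ k w) <= M) ->
  (exists2 r : R, 0 < r & uniformly_cauchy_on (rball a0 r) F_) ->
  forall z, E z -> exists2 r : R, 0 < r & uniformly_cauchy_on (rball z r) F_.
Proof.
move=> cE Ea hF bF uc.
apply: (connected_propagation cE Ea uc).
  move=> z Ez [r r0 hr]; exists (r / 2) => [|y yz]; first by rewrite divr_gt0.
  exists (r / 2) => [|e /hr[N hN]]; first by rewrite divr_gt0.
  exists N => j k jN kN w wy; apply: hN => //.
  by apply: (@rball_sub _ _ z y r (r / 2)) => //; move: yz; rewrite /rball /=; lra.
move=> z Ez hz; have [r r0 [rE [M hM]]] := bF z Ez.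
(* The ball of radius [r / 2] at [y] lies in that of radius [r] at [z]; convergence spreads to
   radius [r / 16] at [y], which covers radius [r / 32] at [z]. *)
have r16 : 0 < r / 32 by rewrite divr_gt0.
have [y [Ey [s s0 hs] yz]] := hz _ r16.
have ysub : rball y (r / 2) `<=` rball z r.
  by apply: rball_sub; move: yz; rewrite /rball /=; lra.
have r2 : 0 < r / 2 by rewrite divr_gt0.
have := @uniformly_cauchy_spread F_ y (r / 2) s M r2 s0 _ _ hs.
have hE' k : holomorphic_on (rball y (r / 2)) (F_ k).
  by apply: holomorphic_onS (hF k) => w /ysub /rE.
move=> /(_ hE' _) H.
exists (r / 32) => // e e0; have [|N hN] := H _ _ e0; first by move=> k w /ysub; exact: hM.
exists N => j k jN kN w wz; apply: hN => //.
apply: (@rball_sub _ _ y z _ (r / 32)) => //.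
by move: yz; rewrite /rball /= rnormB; lra.
Qed.

Lemma vitali_limit E (F_ : nat -> Cn -> R[i]^o) a0 : connected E -> E a0 ->
  (forall k, holomorphic_on E (F_ k)) ->
  (forall z, E z -> exists2 r : R, 0 < r & rball z r `<=` E /\
     exists M, forall k w, rball z r w -> cabs (F_ k w) <= M) ->
  (exists2 r : R, 0 < r & uniformly_cauchy_on (rball a0 r) F_) ->
  exists F : Cn -> R[i]^o, holomorphic_on E F /\ forall z, E z -> ccvg (F_ ^~ z) (F z).
Proof.
move=> cE Ea hF bF uc; have V := vitali cE Ea hF bF uc.
have /choice[F hFlim] : forall z, exists l : R[i]^o, E z -> ccvg (F_ ^~ z) l.
  move=> z; have [Ez|nEz] := pselect (E z); last by exists 0.
  have [r r0 hr] := V z Ez.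
  have [|l hl] := @ccauchy_cvg _ (F_ ^~ z); last by exists l.
  move=> e /hr[N hN]; exists N => j k jN kN; apply: hN => //.
  by rewrite /rball /= subrr rnorm0.
exists F; split => //; apply: (weierstrass hF) => a Ea'.
have [r r0 hr] := V a Ea'; have [r' r'0 [rE _]] := bF a Ea'.
exists (Num.min r r'); first by rewrite lt_min r0.
have sub : rball a (Num.min r r') `<=` E.
  by move=> z; rewrite /rball /= lt_min => /andP[_ h]; exact: rE.
split => // e e0; have e2 : 0 < e / 2 by rewrite divr_gt0.
have [N hN] := hr _ e2; exists N => k kN z zr.
have [N' hN'] := hFlim z (sub _ zr) _ e2.
apply: le_trans (cabs_trans (F_ (maxn N N') z) _ _) _; rewrite [leRHS]splitr.
apply: lerD; last by apply: hN'; rewrite leq_maxr.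
apply: hN => //; first by rewrite leq_maxl.
by move: zr; rewrite /rball /= lt_min => /andP[].
Qed.

(* Apply Vitali's theorem to the sequence [(-1)^k (F - G)], which converges
   only where [F = G]. *)
Lemma identity_theorem E F G a0 (r : R) : open E -> connected E -> E a0 -> 0 < r ->
  holomorphic_on E F -> holomorphic_on E G ->
  (forall z, rball a0 r z -> F z = G z) -> forall z, E z -> F z = G z.
Proof.
move=> oE cE Ea r0 hF hG FG.
pose F_ k := fun z => (-1) ^+ k * (F z - G z) : R[i]^o.
have cF k z : cabs (F_ k z) = cabs (F z - G z).
  by rewrite /F_ cabsM cabsX cabsN cabs1 expr1n mul1r.
have V := @vitali E F_ a0 cE Ea.
move=> z Ez; have [|||s s0 hs] := V _ _ _ z Ez.
- by move=> k; apply: holomorphic_onM; exact: holomorphic_onB.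
- move=> w Ew; have [d d0 [dE [M hM]]] := holomorphic_locally_bounded oE (holomorphic_onB hF hG) Ew.
  by exists d => //; split => //; exists M => k y /hM; rewrite cF.
- exists r => // e e0; exists 0%N => j k _ _ y /FG h.
  by rewrite /F_ h subrr !mulr0 subrr cabs0 ltW.
- apply/eqP; rewrite -subr_eq0; apply/eqP/cabs_le_all_eq0 => e e0.
  have [N hN] := hs _ e0; have := hN N N.+1 (leqnn _) (leqnSn _) z.
  rewrite /rball /= subrr rnorm0 => /(_ s0).
  have -> : F_ N.+1 z = - F_ N z by rewrite /F_ exprS mulN1r mulNr.
  rewrite opprK -mulr2n -mulr_natl cabsM cF.
  have -> : (2%:R : R[i]) = (2%:R : R)%:C by rewrite rmorph_nat.
  by rewrite cabs_real ger0_norm//; have := cabs_ge0 (F z - G z); lra.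
Qed.

End Vitali.

(** * Components of intersections with balls *)

Section Norms.
Context {R : realType} {n : nat}.
Local Notation Cn := (Cn R n).
Implicit Types (w z v : Cn).

Lemma rnorm_le_enorm v : rnorm v <= enorm v.
Proof.
apply: rnorm_le => [|j]; first exact: sqrtr_ge0.
rewrite -[leLHS]ger0_norm ?cabs_ge0// -sqrtr_sqr ler_wsqrtr//.
rewrite (bigD1 j)//= lerDl; apply: sumr_ge0 => k _; exact: sqr_ge0.
Qed.

Lemma enormZ (t : R[i]) v : enorm (t *: v) = cabs t * enorm v.
Proof.
rewrite /enorm (eq_bigr (fun j => cabs t ^+ 2 * cabs (v ord0 j) ^+ 2)); last first.
  by move=> j _; rewrite mxE cabsM exprMn.
by rewrite -mulr_sumr sqrtrM ?sqr_ge0// sqrtr_sqr ger0_norm ?cabs_ge0.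
Qed.

Lemma eball_sub_rball w (d : R) : eball w d `<=` rball w d.
Proof. by move=> z /=; apply: le_lt_trans; exact: rnorm_le_enorm. Qed.

Lemma open_eball w (d : R) : open (eball w d).
Proof.
apply/open_rnorm => z zw.
have d0 : 0 < d by apply: le_lt_trans zw; exact: sqrtr_ge0.
pose S y : R := \sum_(j < n) cabs ((y - w) ord0 j) ^+ 2.
have S0 y : 0 <= S y by apply: sumr_ge0 => j _; exact: sqr_ge0.
have SE y : eball w d y = (S y < d ^+ 2) :> Prop.
  apply/propext; rewrite /eball /= /enorm -/(S y) -[X in _ < X](ger0_norm (ltW d0)) -sqrtr_sqr.
  by rewrite ltr_sqrt// exprn_gt0.
have Sz : S z < d ^+ 2 by rewrite -SE.
pose A := rnorm (z - w).
have A0 : 0 <= A by exact: rnorm_ge0.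
(* For [D <= 1] each squared modulus of a coordinate grows by at most
   [2 * A * D + D ^+ 2 <= (2 * A + 1) * D]; the summand 1 makes [C] positive. *)
pose C := n%:R * (2 * A + 1) + 1.
have C0 : 0 < C by rewrite ltr_wpDl// mulr_ge0// addr_ge0// mulr_ge0.
exists (Num.min 1 ((d ^+ 2 - S z) / C)); first by rewrite lt_min ltr01 divr_gt0// subr_gt0.
move=> y; rewrite lt_min => /andP[y1]; rewrite ltr_pdivlMr// => y2; rewrite SE.
set D := rnorm (y - z) in y1 y2; have D0 : 0 <= D by exact: rnorm_ge0.
suff : S y <= S z + n%:R * (2 * A + 1) * D.
  by move: y2; rewrite /C mulrDr mulr1 mulrC; lra.
rewrite -mulrA mulr_natl -[in leRHS](card_ord n) -sumr_const -big_split /=.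
apply: ler_sum => j _; set b := cabs ((z - w) ord0 j).
have b0 : 0 <= b by exact: cabs_ge0.
have bA : b <= A by exact: cabs_le_rnorm.
have : cabs ((y - w) ord0 j) <= b + D.
  have -> : (y - w) ord0 j = (z - w) ord0 j + (y - z) ord0 j.
    by rewrite !mxE; ring.
  apply: le_trans (cabsD _ _) _; rewrite lerD2l; exact: cabs_le_rnorm.
set u := cabs _; have u0 : 0 <= u by exact: cabs_ge0.
by nra.
Qed.

Lemma star_connected (A : set Cn) w : A w ->
  (forall z (t : R), A z -> 0 <= t <= 1 -> A (w + t%:C *: (z - w))) -> connected A.
Proof.
move=> Aw st.
pose seg z := [set w + t%:C *: (z - w) | t in `[(0 : R), 1]].
have -> : A = \bigcup_(z in A) seg z.
  apply/seteqP; split => z /=.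
    move=> Az; exists z => //; exists 1; first by rewrite /= in_itv /= ler01 lexx.
    by rewrite scale1r addrC subrK.
  by move=> [y Ay [t]]; rewrite /= in_itv /= => h <-; exact: st.
apply: bigcup_connected.
  exists w => z Az; exists 0; first by rewrite /= in_itv /= ler01 lexx.
  by rewrite scale0r addr0.
move=> z Az; apply: connected_continuous_connected; first exact: segment_connected.
apply: continuous_subspaceT => t; apply: cvg_rnorm => e e0.
have V0 : 0 < rnorm (z - w) + 1 by rewrite ltr_wpDl ?rnorm_ge0.
apply/nbhs_ballP; exists (e / (rnorm (z - w) + 1)) => /=; first by rewrite divr_gt0.
move=> s; rewrite /ball /= ltr_pdivlMr// => h.
rewrite opprD addrACA subrr add0r -scalerBl rnormZ -rmorphB cabs_real distrC.
apply: le_lt_trans h; apply: ler_wpM2l => //; by rewrite lerDl.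
Qed.

Lemma connected_rball w (d : R) : connected (rball w d).
Proof.
(* Rational balls are indexed by arbitrary rational radii, hence the empty case. *)
have [d0|d0] := ltP 0 d; last first.
  rewrite (_ : rball w d = set0); first exact: connected0.
  apply/seteqP; split => z //; rewrite /rball /= => h.
  by have := rnorm_ge0 (z - w); lra.
apply: (@star_connected _ w); first by rewrite /rball /= subrr rnorm0.
move=> z t; rewrite /rball /= => h /andP[t0 t1].
rewrite addrAC subrr add0r rnormZ cabs_real ger0_norm//.
by apply: le_lt_trans h; rewrite ler_piMl ?rnorm_ge0.
Qed.

Lemma enorm0 : enorm (0 : Cn) = 0.
Proof. by rewrite -(scale0r (0 : Cn)) enormZ cabs0 mul0r. Qed.

Lemma connected_eball w (d : R) : 0 < d -> connected (eball w d).
Proof.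
move=> d0; apply: (@star_connected _ w); first by rewrite /eball /= subrr enorm0.
move=> z t; rewrite /eball /= => h /andP[t0 t1].
rewrite addrAC subrr add0r enormZ cabs_real ger0_norm//.
by apply: le_lt_trans h; rewrite ler_piMl ?sqrtr_ge0.
Qed.

Definition rat_point (i : {ffun 'I_n -> rat * rat}) : Cn :=
  \row_j Complex (ratr (i j).1) (ratr (i j).2).

Lemma rat_point_dense z (e : R) : 0 < e -> exists i, rball z e (rat_point i).
Proof.
move=> e0; have e2 : 0 < e / 2 by rewrite divr_gt0.
have /choice[c1 hc1] : forall j, exists c : rat, `|Re (z ord0 j) - ratr c| < e / 2.
  by move=> j; exact: exists_rat_near.
have /choice[c2 hc2] : forall j, exists c : rat, `|Im (z ord0 j) - ratr c| < e / 2.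
  by move=> j; exact: exists_rat_near.
exists [ffun j => (c1 j, c2 j)]; apply: rnorm_lt => // j; rewrite !mxE ffunE /=.
apply: le_lt_trans (cabs_le_ReIm _) _; rewrite ReD ImD ReN ImN /= [ltRHS]splitr.
by rewrite distrC (distrC _ (Im _)) ltrD.
Qed.

End Norms.

(** * Boundary points of components, and extensions across them *)

Section Components.
Context {R : realType} {n : nat}.
Local Notation Cn := (Cn R n).
Implicit Types (Om B U : set Cn) (x z : Cn) (f : Cn -> R[i]^o).

Lemma connected_sub_component U B x z : connected_component U x z -> B z ->
  B `<=` U -> connected B -> B `<=` connected_component U x.
Proof.
move=> xz Bz BU cB; have := connected_component_max Bz BU cB.
by rewrite (same_connected_component xz).
Qed.

Lemma open_connected_component U x : open U -> open (connected_component U x).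
Proof.
move=> oU; apply/open_rnorm => z xz.
have [d d0 hd] := open_rball_sub oU (connected_component_sub xz).
exists d => //; apply: (connected_sub_component xz (rball_center _ d0) hd).
exact: connected_rball.
Qed.

(** Without such a point the component would be relatively closed in [B]: a limit point in [B] would
    lie in [Om], and a small ball around it inside both sets would meet the component and so belong
    to it. Being open, the component would be all of [B]. *)
Lemma component_boundary Om B x : open Om -> open B -> connected B ->
  (B `&` Om) x -> ~ (B `<=` Om) ->
  exists zeta, [/\ B zeta, ~ Om zeta & closure (connected_component (B `&` Om) x) zeta].
Proof.
move=> oOm oB cB Bx nB; set E := connected_component _ _.
have oU : open (B `&` Om) by exact: openI.
have oE : open E by exact: open_connected_component.
have Ex : E x by exact: connected_component_refl.
apply: contrapT => none; apply: nB => z Bz.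
suff : E z by move=> /connected_component_sub[].
apply: (connected_propagation cB _ Ex _ _ Bz); first by case: Bx.
  by move=> y By Ey; exact: open_rball_sub.
move=> y By hy; have cEy : closure E y.
  move=> A /nbhs_rnorm[d d0 hd]; have [w [Bw Ew wy]] := hy _ d0.
  by exists w; split => //; exact: hd.
have Oy : Om y by apply: contrapT => nO; apply: none; exists y.
have [d d0 hd] := open_rball_sub oU (conj By Oy).
have [w [Bw Ew wy]] := hy _ d0.
exact: (connected_sub_component Ew wy hd (@connected_rball _ _ y d)) (rball_center _ d0).
Qed.

Lemma bdry_of_component Om B x zeta : open Om -> ~ Om zeta ->
  closure (connected_component (B `&` Om) x) zeta -> bdry Om zeta.
Proof.
move=> oOm nO cz; split; last by move=> /interior_subset.
apply: closure_subset cz => z /connected_component_sub[]; by [].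
Qed.

(** What a failure of singularity provides: by the identity theorem the agreement on [V] spreads
    over a whole component, and this component reaches a point outside [Om] at which [F] is still
    holomorphic. *)
Lemma extension_boundary Om U V v f F : open Om -> open U -> open V -> connected U ->
  V v -> V `<=` U `&` Om -> U `&` Om <> U -> holomorphic_on Om f -> holomorphic_on U F ->
  (forall z, V z -> F z = f z) ->
  exists zeta, [/\ U zeta, ~ Om zeta, closure (connected_component (U `&` Om) v) zeta &
    forall z, connected_component (U `&` Om) v z -> F z = f z].
Proof.
move=> oOm oU oV cU Vv VU UO hf hF FV; have UOv := VU _ Vv.
have [|zeta [Uz nO cz]] := component_boundary oOm oU cU UOv.
  by move=> UsO; apply: UO; apply/setIidPl.
exists zeta; split => //; have [d d0 hd] := open_rball_sub oV Vv.
apply: (@identity_theorem _ _ _ F f v d) => //.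
- exact: open_connected_component (openI oU oOm).
- exact: component_connected.
- exact: connected_component_refl.
- by apply: holomorphic_onS hF => z /connected_component_sub[].
- by apply: holomorphic_onS hf => z /connected_component_sub[].
- by move=> z /hd; exact: FV.
Qed.

Lemma nbhs_rball z (d : R) : 0 < d -> nbhs z (rball z d).
Proof. by move=> d0; apply/nbhs_rnorm; exists d. Qed.

Lemma nbhs_eball z (d : R) : 0 < d -> nbhs z (eball z d).
Proof.
move=> d0; apply: open_nbhs_nbhs; split; first exact: open_eball.
by rewrite /eball /= subrr enorm0.
Qed.

Lemma closure_rat_point (A : set Cn) z (e : R) : open A -> closure A z -> 0 < e ->
  exists i, rball z e (rat_point i) /\
    exists2 s : R, 0 < s & rball (rat_point i) s `<=` A.
Proof.
move=> oA cz e0; have [y [Ay ye]] := cz _ (nbhs_rball z e0).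
have oAe : open (A `&` rball z e) by apply: openI => //; exact: open_rball.
have [t t0 ht] := open_rball_sub oAe (conj Ay ye).
have [i /ht[Ai ie]] := @rat_point_dense R n y _ t0; exists i; split => //.
by have [s s0 hs] := open_rball_sub oA Ai; exists s.
Qed.

Lemma totally_unbounded_singular Om f : open Om -> holomorphic_on Om f ->
  totally_unbounded Om f -> singular_everywhere Om f.
Proof.
move=> oOm hf tu U V oU oV cU [v Vv] VU UO [F [hF FV]].
have [zeta [Uz nO cz FE]] := extension_boundary oOm oU oV cU Vv VU UO hf hF FV.
have [d d0 [dU [M hM]]] := holomorphic_locally_bounded oU hF Uz.
have [x [Ex xd]] := cz _ (nbhs_eball zeta d0).
have [_ Ox] := connected_component_sub Ex.
have [z [xz Mz]] := tu zeta (bdry_of_component oOm nO cz) d d0 x (conj xd Ox) M.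
have zd : rball zeta d z.
  by have [/eball_sub_rball] := connected_component_sub xz.
(* The component in the small ball is connected, lies in both [U] and [Om], and meets the component
   on which [F = f] at [x]. *)
have Ez : connected_component (U `&` Om) v z.
  apply: (connected_sub_component Ex _ _ _ xz).
  - exact: connected_component_refl.
  - by move=> y /connected_component_sub[/eball_sub_rball/dU ? ?].
  - exact: component_connected.
by have := hM z zd; rewrite (FE _ Ez) leNgt Mz.
Qed.

End Components.

(** * The metric and point evaluations *)

Section IntpTheory.
Context {R : realType} {n : nat}.
Local Notation Cn := (Cn R n).
Variable Om : set Cn.
Hypothesis oOm : open Om.
Implicit Types (f g : Cn -> R[i]^o) (p : R).

Lemma intp_integrand_ge0 p f (v : nat -> R) :
  (0 <= (\1_Om (@coords_to_Cn R n v) * powR (cabs (f (coords_to_Cn v))) p)%:E)%E.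
Proof. by rewrite lee_fin mulr_ge0 ?powR_ge0// indicE. Qed.

Lemma coord_measurable_EFin (G : (nat -> R) -> R) : coord_measurable G ->
  coord_measurable (fun v => (G v)%:E).
Proof. by move=> mG d T phi mphi; apply/measurable_EFinP; exact: mG. Qed.

Lemma intp_ge0 p f : (0 <= intp Om p f)%E.
Proof. by apply: iint_ge0 => v; exact: intp_integrand_ge0. Qed.

Lemma eq_intp p f g : (forall z, Om z -> cabs (f z) = cabs (g z)) ->
  intp Om p f = intp Om p g.
Proof.
move=> fg; rewrite /intp; congr iint; apply/funext => v; rewrite !indicE.
by case: (boolP (_ \in Om)) => [/set_mem/fg ->|_]; [|rewrite !mul0r].
Qed.

Lemma intpZ p (c : R[i]) f : 0 < p -> holomorphic_on Om f ->
  intp Om p (fun z => c * f z) = ((powR (cabs c) p)%:E * intp Om p f)%E.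
Proof.
move=> p0 hf; rewrite /intp -iintZ ?powR_ge0//; last 2 first.
- by move=> v; exact: intp_integrand_ge0.
- by apply: coord_measurable_EFin; exact: coord_measurable_intp_integrand.
congr iint; apply/funext => v; rewrite -EFinM cabsM powRM ?cabs_ge0//; congr EFin.
by rewrite mulrCA.
Qed.

(** The sum is at most twice the larger of the two terms. *)
Lemma powRD_le (a b p : R) : 0 <= a -> 0 <= b -> 0 < p ->
  powR (a + b) p <= powR 2 p * (powR a p + powR b p).
Proof.
move=> a0 b0 p0.
have H (x y : R) : 0 <= x -> x <= y -> powR (x + y) p <= powR 2 p * powR y p.
  move=> x0 xy; have y0 := le_trans x0 xy; rewrite -powRM//.
  by apply: ge0_ler_powR; [exact: ltW|rewrite nnegrE addr_ge0|rewrite nnegrE mulr_ge0|lra].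
have [ab|/ltW ba] := leP a b.
  apply: le_trans (H _ _ a0 ab) _; apply: ler_wpM2l; first exact: powR_ge0.
  by rewrite lerDr powR_ge0.
rewrite addrC; apply: le_trans (H _ _ b0 ba) _; apply: ler_wpM2l; first exact: powR_ge0.
by rewrite lerDl powR_ge0.
Qed.

Lemma intpD_le p f g : 0 < p -> holomorphic_on Om f -> holomorphic_on Om g ->
  (intp Om p (fun z => f z + g z)%R <= (powR 2 p)%:E * (intp Om p f + intp Om p g))%E.
Proof.
move=> p0 hf hg.
have mf := coord_measurable_EFin (coord_measurable_intp_integrand oOm hf p0).
have mg := coord_measurable_EFin (coord_measurable_intp_integrand oOm hg p0).
have mfg := coord_measurable_EFin (coord_measurable_intp_integrand oOm (holomorphic_onD hf hg) p0).
have f0 v := intp_integrand_ge0 p f v; have g0 v := intp_integrand_ge0 p g v.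
have fg0 v := adde_ge0 (f0 v) (g0 v).
have mD : coord_measurable (fun v => (\1_Om (@coords_to_Cn R n v) * powR (cabs (f (coords_to_Cn v))) p)%:E +
   (\1_Om (@coords_to_Cn R n v) * powR (cabs (g (coords_to_Cn v))) p)%:E)%E.
  by move=> d T phi mphi; exact: (emeasurable_funD (mf _ _ _ mphi) (mg _ _ _ mphi)).
have E1 := iintD (2 * n) f0 g0 mf mg.
have E2 := iintZ (2 * n) (powR_ge0 2 p) fg0 mD.
rewrite [X in (_ <= _ * X)%E](esym E1) -E2; apply: (le_iint _ _ mfg).
- by move=> v; exact: (intp_integrand_ge0 p (fun z => f z + g z) v).
- by move=> d T phi mphi; exact: (measurable_funeM _ (mD _ _ _ mphi)).
move=> v; rewrite -EFinD -EFinM lee_fin !indicE.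
case: (_ \in Om); rewrite ?mul0r ?addr0 ?mulr0// !mul1r.
apply: le_trans (powRD_le _ _ p0); [|exact: cabs_ge0|exact: cabs_ge0].
apply: ge0_ler_powR; [exact: ltW|by rewrite nnegrE cabs_ge0| |exact: cabsD].
by rewrite nnegrE addr_ge0 ?cabs_ge0.
Qed.

Lemma measurable_abs_le (M : R) :
  measurable_fun setT (fun x : R => (`|x| <= M)%R%:R : R).
Proof.
rewrite (_ : (fun _ => _) = \1_(`[- M, M]%classic)).
  by apply: measurable_indic; exact: measurable_itv.
apply/funext => y; rewrite indicE; congr (nat_of_bool _)%:R.
by rewrite ler_norml; apply/idP/idP; rewrite inE /= in_itv.
Qed.

Lemma iint_box_finite k (M : R) : 0 <= M ->
  (iint k (fun v : nat -> R => (\prod_(i < k) (`|v i| <= M)%R%:R : R)%:E) <= ((2 * M) ^+ k)%:E)%E.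
Proof.
move=> M0.
pose B k (v : nat -> R) : R := \prod_(i < k) (`|v i| <= M)%R%:R.
have B0 j v : (0 <= (B j v)%:E)%E by rewrite lee_fin prodr_ge0// => i _; exact: ler0n.
have mB j : coord_measurable (fun v => (B j v)%:E).
  apply: coord_measurable_EFin => d T phi mphi; rewrite /B.
  apply: measurable_prod => i _; exact: (measurableT_comp (measurable_abs_le M) (mphi i)).
change (iint k (fun v => (B k v)%:E) <= ((2 * M) ^+ k)%:E)%E.
elim: k => [|k IH]; first by rewrite /= /B big_ord0 expr0.
rewrite iintS.
have E t v : B k.+1 (upd v k t) = (`|t| <= M)%R%:R * B k v.
  rewrite /B big_ord_recr /= {2}/upd eqxx mulrC; congr (_ * _).
  by apply: eq_bigr => i _; rewrite /upd ltn_eqF.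
apply: (@le_trans _ _ (\int[lebesgue_measure]_(t in `[(- M)%R, M]) ((2 * M) ^+ k)%:E)%E); last first.
  rewrite integral_cst//= lebesgue_measure_itv/= lte_fin; case: ltP => h.
    by rewrite -EFinB -EFinM lee_fin exprSr opprK; rewrite le_eqVlt; apply/orP; left; apply/eqP; ring.
  by rewrite mule0 lee_fin exprn_ge0// mulr_ge0.
rewrite [leRHS]integral_mkcond; apply: ge0_le_integral => //.
- by move=> t _; exact: iint_ge0.
- exact: (@measurable_iint_upd _ k (fun v => (B k.+1 v)%:E) k).
- apply/(measurable_restrictT _ _).1 => //.
move=> t _; rewrite patchE; under eq_fun do rewrite E EFinM.
rewrite iintZ ?ler0n//; case: (boolP (t \in _)) => tM.
  apply: le_trans IH; rewrite -[leRHS]mul1e; apply: lee_wpmul2r; first exact: iint_ge0.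
  by rewrite lee_fin lern1 leq_b1.
have -> : (`|t| <= M) = false.
  by apply/negbTE; apply: contra tM; rewrite inE /= in_itv /= ler_norml.
by rewrite mul0e.
Qed.

Lemma intp_cst1_finite p : bounded_Cn Om -> (intp Om p (fun=> 1%R) < +oo)%E.
Proof.
move=> [M hM]; pose M' := Num.max M 0.
have M0 : 0 <= M' by rewrite le_max lexx orbT.
apply: (@le_lt_trans _ _ ((2 * M') ^+ (2 * n))%:E); last exact: ltry.
apply: le_trans (iint_box_finite (2 * n) M0).
have h1 : holomorphic_on Om (fun=> 1 : R[i]^o) by move=> z _; exact: differentiable_cst.
(* Here [p] may be any real number, whereas measurability of the integrand is established for
   positive exponents. *)
have E1 : intp Om p (fun=> 1) = intp Om 1 (fun=> 1).
  by rewrite /intp; congr iint; apply/funext => v; rewrite cabs1 !powR1.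
rewrite E1; apply: le_iint.
- by move=> v; exact: (intp_integrand_ge0 1 (fun=> 1) v).
- exact: (coord_measurable_EFin (coord_measurable_intp_integrand oOm h1 ltr01)).
- apply: coord_measurable_EFin => d T phi mphi.
  by apply: measurable_prod => i _; exact: (measurableT_comp (measurable_abs_le M') (mphi i)).
move=> v; rewrite lee_fin cabs1 powR1 mulr1 indicE; case: (boolP (_ \in Om)) => [|_]; last first.
  by rewrite prodr_ge0// => i _; exact: ler0n.
rewrite inE => /hM vM; rewrite big1// => i _.
suff -> : `|v i| <= M' by [].
have H (j : 'I_n) : cabs (@coords_to_Cn R n v ord0 j) <= M'.
  apply: le_trans (cabs_le_rnorm _ _) _; apply: le_trans (rnorm_le_enorm _) _.
  by rewrite le_max vM.
have i2 : (i./2 < n)%N by rewrite ltn_half_double -mul2n.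
have := H (Ordinal i2); rewrite mxE /= => h.
case: (boolP (odd i)) => oi.
  have <- : (2 * i./2).+1 = i by rewrite mul2n -[RHS](odd_double_half i) oi.
  exact: le_trans (Im_le_cabs _) h.
have <- : (2 * i./2)%N = i by rewrite mul2n -[RHS](odd_double_half i) (negbTE oi).
exact: le_trans (Re_le_cabs _) h.
Qed.

(** Pointwise [|f|^p <= 1 + |f|^p'], and a bounded set has finite volume. *)
Lemma intp_exponent_finite p p' f : bounded_Cn Om -> holomorphic_on Om f -> 0 < p -> p <= p' ->
  (intp Om p' f < +oo -> intp Om p f < +oo)%E.
Proof.
move=> bOm hf p0 pp' fin.
have p'0 : 0 < p' by apply: lt_le_trans pp'.
have h1 : holomorphic_on Om (fun=> 1 : R[i]^o) by move=> z _; exact: differentiable_cst.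
have mf := coord_measurable_EFin (coord_measurable_intp_integrand oOm hf p0).
have mf' := coord_measurable_EFin (coord_measurable_intp_integrand oOm hf p'0).
have m1 := coord_measurable_EFin (coord_measurable_intp_integrand oOm h1 p'0).
apply: (@le_lt_trans _ _ (intp Om p' (fun=> 1%R) + intp Om p' f)%E); last first.
  by apply: lte_add_pinfty; [exact: intp_cst1_finite|exact: fin].
rewrite [leRHS](esym (iintD (2 * n) (fun v => intp_integrand_ge0 p' (fun=> 1) v)
  (fun v => intp_integrand_ge0 p' f v) m1 mf')).
apply: (le_iint _ _ mf); first by move=> v; exact: intp_integrand_ge0.
  by move=> d T phi mphi; exact: (emeasurable_funD (m1 _ _ _ mphi) (mf' _ _ _ mphi)).
move=> v; rewrite -EFinD lee_fin cabs1 powR1 mulr1 !indicE.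
case: (_ \in Om); rewrite ?mul0r ?addr0// !mul1r.
set u := cabs _; have u0 : 0 <= u by exact: cabs_ge0.
have [u1|u1] := leP u 1.
  apply: (@le_trans _ _ 1); last by rewrite lerDl powR_ge0.
  have -> : (1 : R) = powR 1 p by rewrite powR1.
  by apply: ge0_ler_powR; rewrite ?nnegrE ?ler01 ?(ltW p0).
apply: (@le_trans _ _ (powR u p')); last by rewrite lerDr.
by apply: ler_powR => //; exact: ltW.
Qed.

(** Where [F z] is not 0, the modulus of [s k z] eventually exceeds half that of [F z]. So Fatou's
    lemma is compared with the integrand of [F / 2], and the factor [2^p] undoes the halving. *)
Lemma fatou_intp p (s : nat -> Cn -> R[i]^o) F (C : \bar R) : 0 < p ->
  (forall k, holomorphic_on Om (s k)) -> holomorphic_on Om F ->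
  (forall z, Om z -> ccvg (s ^~ z) (F z)) ->
  (forall k, intp Om p (s k) <= C)%E -> (intp Om p F <= (powR 2 p)%:E * C)%E.
Proof.
move=> p0 hs hF sF sC.
have -> : intp Om p F = ((powR 2 p)%:E * intp Om p (fun z => (2^-1 : R)%:C * F z)%R)%E.
  rewrite intpZ// muleA -EFinM cabs_real ger0_norm ?invr_ge0// -powRM ?invr_ge0//.
  by rewrite mulfV// powR1 mul1e.
apply: lee_wpmul2l; first by rewrite lee_fin powR_ge0.
have hF2 : holomorphic_on Om (fun z => (2^-1 : R)%:C * F z) by exact: holomorphic_onM.
have ms k := coord_measurable_EFin (coord_measurable_intp_integrand oOm (hs k) p0).
have mF := coord_measurable_EFin (coord_measurable_intp_integrand oOm hF2 p0).
have cinf (u : nat -> \bar R) : cvgn (einfs u) by exact: is_cvg_einfs.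
apply: (@le_trans _ _ (limn_einf (fun k => intp Om p (s k)))); last first.
  rewrite limn_einf_lim; apply: lime_le => //; near=> k.
  by apply: le_trans (sC k); apply: ereal_inf_lbound; exists k => /=.
apply: le_trans (fatou_iint (2 * n) (fun j v => intp_integrand_ge0 p (s j) v) ms).
apply: (le_iint _ _ mF).
- by move=> v; exact: (intp_integrand_ge0 p (fun z => (2^-1 : R)%:C * F z) v).
- move=> d T phi mphi.
  rewrite (_ : (fun t => _) = -%E \o (fun t =>
    limn_esup ((fun j t => - (\1_Om (@coords_to_Cn R n (phi ^~ t)) *
             powR (cabs (s j (coords_to_Cn (phi ^~ t)))) p)%:E) ^~ t)))%E//.
  apply: measurableT_comp => //.
  apply: measurable_fun_limn_esup => j; apply: measurableT_comp => //; exact: ms.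
move=> v; rewrite limn_einf_lim.
set z := coords_to_Cn v.
have [Oz|nOz] := boolP (z \in Om); last first.
  rewrite indicE (negbTE nOz) mul0r; apply: lime_ge => //; near=> k.
  by apply: le_ereal_inf_tmp => _ [m /= _ <-]; rewrite mul0r.
rewrite indicE Oz mul1r; move: Oz; rewrite inE => Oz.
have [F0|F0] := eqVneq (cabs (F z)) 0.
  rewrite cabsM F0 mulr0 powR0 ?gt_eqF//; apply: lime_ge => //; near=> k.
  by apply: le_ereal_inf_tmp => _ [m /= _ <-]; rewrite lee_fin mul1r powR_ge0.
have Fp : 0 < cabs (F z) / 2 by rewrite divr_gt0// lt_neqAle eq_sym F0 cabs_ge0.
have [N hN] := sF z Oz _ Fp.
apply: lime_ge => //; exists N => // k /= Nk.
apply: le_ereal_inf_tmp => _ [m /= km <-]; rewrite lee_fin mul1r.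
apply: ge0_ler_powR; [exact: ltW|by rewrite nnegrE cabs_ge0|by rewrite nnegrE cabs_ge0|].
rewrite cabsM cabs_real ger0_norm ?invr_ge0//.
have := hN m (leq_trans Nk km); have := cabs_dist (F z) (s m z); rewrite cabsB; lra.
Unshelve. all: by end_near. Qed.

End IntpTheory.

(** * The function space, its metric and small perturbations *)

Section OLSpace.
Context {R : realType} {n : nat}.
Local Notation Cn := (Cn R n).
Variables (Om : set Cn) (q : \bar R) (ps : nat -> R).
Hypothesis oOm : open Om.
Hypothesis bOm : bounded_Cn Om.
Hypothesis hps : exponent_seq q ps.
Implicit Types (f g h F : Cn -> R[i]^o) (p : R).

Lemma ps_gt1 j : 1 < ps j. Proof. by case: hps. Qed.

Lemma ps_gt0 j : 0 < ps j. Proof. exact: lt_trans (ps_gt1 j). Qed.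

Lemma ps_lt j : ((ps j)%:E < q)%E. Proof. by case: hps => _ [_ []]. Qed.

Lemma ps_homo j k : (j <= k)%N -> ps j <= ps k.
Proof.
move: j k; apply: (homo_leq (@lexx _ _) (@le_trans _ _)) => j.
by apply: ltW; case: hps => _ [].
Qed.

(** The convergence of the exponents is taken in the extended reals, so finite [q] and [q = +oo] are
    covered by the same argument. *)
Lemma exponent_le_ps p : (p%:E < q)%E -> exists j, p <= ps j.
Proof.
move=> pq; case: hps => _ [_ [_ cq]].
have H : nbhs q [set y | p%:E < y]%E by exact: (open_ereal_gt' pq).
have [N _ hN] := cq _ H; exists N.
by have := hN N (leqnn _); rewrite /= lte_fin => /ltW.
Qed.

Lemma OLqP f : OLq Om q f <->
  holomorphic_on Om f /\ forall j, (intp Om (ps j) f < +oo)%E.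
Proof.
split=> [[hf ff]|[hf ff]]; split => //.
  by move=> j; apply: ff; [exact/ltW/ps_gt1|exact: ps_lt].
move=> p p1 /exponent_le_ps[j pj].
by apply: (intp_exponent_finite oOm bOm hf _ pj) => //; exact: lt_le_trans p1.
Qed.

Lemma OLqD f g : OLq Om q f -> OLq Om q g -> OLq Om q (fun z => f z + g z).
Proof.
move=> /OLqP[hf ff] /OLqP[hg fg]; apply/OLqP; split; first exact: holomorphic_onD.
move=> j; apply: le_lt_trans (intpD_le oOm (ps_gt0 j) hf hg) _.
by apply: lte_mul_pinfty; rewrite ?lee_fin ?powR_ge0//; apply: lte_add_pinfty.
Qed.

Lemma OLqM (c : R[i]) f : OLq Om q f -> OLq Om q (fun z => c * f z).
Proof.
move=> /OLqP[hf ff]; apply/OLqP; split; first exact: holomorphic_onM.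
move=> j; rewrite (intpZ oOm c (ps_gt0 j) hf).
by apply: lte_mul_pinfty; rewrite ?lee_fin ?powR_ge0.
Qed.

Lemma OLqB f g : OLq Om q f -> OLq Om q g -> OLq Om q (fun z => f z - g z).
Proof.
move=> hf hg; have := OLqD hf (OLqM (-1) hg).
by rewrite (_ : (fun z => f z + -1 * g z) = (fun z => f z - g z))//; apply/funext => z; rewrite mulN1r.
Qed.

Lemma intp_pointwise p (r : R) : 1 <= p -> 0 < r -> exists2 C : R, 0 < C &
  forall f (eta : R), holomorphic_on Om f -> 0 <= eta ->
  (intp Om p f <= (powR eta p)%:E)%E ->
  forall z, polybox z r `<=` Om -> cabs (f z) <= C * eta.
Proof.
move=> p1 r0; have [K K0 hK] := @polydisc_estimate R n p r p1 r0.
have p0 : 0 < p by apply: lt_le_trans p1.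
exists (powR K p^-1); first exact: powR_gt0.
move=> f eta hf e0 fe z zOm; rewrite leNgt; apply/negP => lt.
have C0 : 0 <= powR K p^-1 * eta by rewrite mulr_ge0 ?powR_ge0.
have : powR (powR K p^-1 * eta) p < powR (cabs (f z)) p.
  by apply: gt0_ltr_powR; rewrite ?nnegrE ?cabs_ge0.
rewrite powRM ?powR_ge0// -powRrM mulVf ?gt_eqF// powRr1 ?ltW// ltNge => /negP; apply.
rewrite -lee_fin EFinM; apply: le_trans (hK Om f z oOm hf zOm) _.
by apply: lee_wpmul2l => //; rewrite lee_fin ltW.
Qed.

Definition OLterm f g j : R := 2%:R ^- j.+1 * (Lpnorm Om (ps j) (fun z => f z - g z) /
                (1 + Lpnorm Om (ps j) (fun z => f z - g z))).

Lemma Lpnorm_ge0 p f : 0 <= Lpnorm Om p f.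
Proof. exact: powR_ge0. Qed.

Lemma OLterm_ge0 f g j : 0 <= OLterm f g j.
Proof.
have L0 := Lpnorm_ge0 (ps j) (fun z => f z - g z).
by rewrite mulr_ge0 ?invr_ge0 ?exprn_ge0// divr_ge0// addr_ge0.
Qed.

Lemma OLterm_le f g j (eta : R) : Lpnorm Om (ps j) (fun z => f z - g z) <= eta ->
  OLterm f g j <= 2%:R ^- j.+1 * eta.
Proof.
have L0 := Lpnorm_ge0 (ps j) (fun z => f z - g z).
move=> h; apply: ler_wpM2l; first by rewrite invr_ge0 exprn_ge0.
apply: le_trans h; rewrite ler_pdivrMr ?ltr_pwDl//.
by rewrite mulrDr mulr1 lerDl mulr_ge0.
Qed.

Lemma OLterm_le1 f g j : OLterm f g j <= 2%:R ^- j.+1.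
Proof.
have L0 := Lpnorm_ge0 (ps j) (fun z => f z - g z).
rewrite -[leRHS]mulr1; apply: ler_wpM2l; first by rewrite invr_ge0 exprn_ge0.
by rewrite ler_pdivrMr ?ltr_pwDl// mul1r lerDr.
Qed.

Lemma halfS (k : nat) : 2%:R ^- k = 2%:R ^- k.+1 + 2%:R ^- k.+1 :> R.
Proof. by rewrite exprS; field; rewrite expf_neq0. Qed.

(** The terms of index at most [J] are below [eta * 2^-(j+1)], the others below [2^-(j+1)]. Both
    geometric sums are in closed form; the second bracket vanishes as long as [N <= J + 1]. *)
Lemma OLterm_partial f g J (eta : R) : 0 <= eta ->
  (forall j, (j <= J)%N -> Lpnorm Om (ps j) (fun z => f z - g z) <= eta) ->
  forall N, \sum_(0 <= j < N) OLterm f g j <=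
    eta * (1 - 2%:R ^- N) + (2%:R ^- J.+1 - 2%:R ^- (maxn N J.+1)).
Proof.
move=> e0 hJ; elim=> [|N IH].
  by rewrite big_nil expr0 invr1 subrr mulr0 add0r max0n subrr.
rewrite big_nat_recr//=.
have hN : 0 <= 2%:R ^- N.+1 :> R by rewrite invr_ge0 exprn_ge0.
have [NJ|JN] := leqP N J.
  move: IH; rewrite (maxn_idPr (leqW NJ)) (maxn_idPr (NJ : (N.+1 <= J.+1)%N)) subrr !addr0 => IH.
  have := OLterm_le (hJ _ NJ); rewrite (halfS N) in IH.
  by move: (2%:R ^- N.+1) hN IH => x; nra.
move: IH; rewrite (maxn_idPl JN) (maxn_idPl (leqW JN)) (halfS N) => IH.
have := OLterm_le1 f g N.
by move: (2%:R ^- N.+1) hN IH => x; nra.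
Qed.

Lemma OLdist_le_partial f g (c : R) :
  (forall N, \sum_(0 <= j < N) OLterm f g j <= c) -> OLdist ps Om f g <= c.
Proof.
move=> hc; have S0 : (0 <= \sum_(j <oo) (OLterm f g j)%:E)%E.
  by apply: nneseries_ge0 => j _ _; rewrite lee_fin OLterm_ge0.
have Sc : (\sum_(j <oo) (OLterm f g j)%:E <= c%:E)%E.
  apply: lime_le; first by apply: is_cvg_nneseries => j _ _; rewrite lee_fin OLterm_ge0.
  by near=> N; rewrite sumEFin lee_fin.
rewrite /OLdist -/(OLterm f g); rewrite -lee_fin fineK//.
by rewrite ge0_fin_numE//; apply: le_lt_trans Sc _; rewrite ltry.
Unshelve. all: by end_near. Qed.

Lemma OLdist_ge_term0 f g : OLterm f g 0 <= OLdist ps Om f g.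
Proof.
have S0 : (0 <= \sum_(j <oo) (OLterm f g j)%:E)%E.
  by apply: nneseries_ge0 => j _ _; rewrite lee_fin OLterm_ge0.
(* [OLdist] is the [fine] part of a series, so a comparison with one of its terms first requires the
   series to be finite. *)
have S1 : (\sum_(j <oo) (OLterm f g j)%:E <= 1%:E)%E.
  apply: lime_le; first by apply: is_cvg_nneseries => j _ _; rewrite lee_fin OLterm_ge0.
  near=> N; rewrite sumEFin lee_fin.
  have : \sum_(0 <= j < N) OLterm f g j <= 1 - 2%:R ^- N.
    elim: (N) => [|k IH]; first by rewrite big_nil expr0 invr1 subrr.
    rewrite big_nat_recr//=; have := OLterm_le1 f g k; rewrite (halfS k) in IH.
    by move: (2%:R ^- k.+1) IH => x; lra.
  by move/le_trans; apply; rewrite gerBl invr_ge0 exprn_ge0.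
rewrite /OLdist -lee_fin fineK; last first.
  by rewrite ge0_fin_numE//; apply: le_lt_trans S1 _; rewrite ltry.
have := @nneseries_lim_ge R (fun j => (OLterm f g j)%:E) xpredT 0 1%N.
rewrite big_nat1; apply => j _ _; by rewrite lee_fin OLterm_ge0.
Unshelve. all: by end_near. Qed.

(** Inverts the first term of the metric: [L / (2 * (1 + L)) < e] with [e <= 1/4] gives
    [L <= 4 * e]. A single exponent already controls point values. *)
Lemma intp_le_of_dist f g (e : R) : OLq Om q f -> OLq Om q g -> e <= 4^-1 ->
  OLdist ps Om f g < e -> (intp Om (ps 0%N) (fun z => f z - g z)%R <= (powR (4 * e) (ps 0%N))%:E)%E.
Proof.
move=> hf hg e4 de; have /OLqP[_ /(_ 0%N) fin] := OLqB hf hg.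
set L := Lpnorm Om (ps 0%N) (fun z => f z - g z).
have L0 : 0 <= L by exact: Lpnorm_ge0.
have : OLterm f g 0 < e by apply: le_lt_trans (OLdist_ge_term0 f g) de.
rewrite /OLterm -/L expr1 => h.
have Le : L <= 4 * e.
  have L1 : 0 < 1 + L by rewrite ltr_pwDl.
  move: h; rewrite mulrA ltr_pdivrMr// => h; nra.
have i0 := intp_ge0 Om (ps 0%N) (fun z => f z - g z).
rewrite -[leLHS]fineK; last by rewrite ge0_fin_numE.
rewrite lee_fin.
have -> : fine (intp Om (ps 0%N) (fun z => f z - g z)) = powR L (ps 0%N).
  rewrite /L /Lpnorm -powRrM mulVf ?gt_eqF ?ps_gt0// powRr1//.
  exact: fine_ge0.
have e0 : 0 <= 4 * e by exact: le_trans Le.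
by apply: ge0_ler_powR => //; exact/ltW/ps_gt0.
Qed.

Lemma eval_close (r : R) : 0 < r -> exists2 C : R, 0 < C &
  forall f g (e : R), OLq Om q f -> OLq Om q g -> 0 <= e -> e <= 4^-1 -> OLdist ps Om f g < e ->
  forall z, polybox z r `<=` Om -> cabs (f z - g z) <= C * e.
Proof.
move=> r0; have [C C0 hC] := intp_pointwise (ltW (ps_gt1 0%N)) r0.
exists (C * 4) => [|f g e hf hg e0 e4 de z zOm]; first by rewrite mulr_gt0.
have [hol _] := OLqB hf hg; rewrite -mulrA.
apply: (hC (fun z => f z - g z) (4 * e) hol (mulr_ge0 (ler0n _ 4) e0) _ z zOm).
exact: intp_le_of_dist.
Qed.

(** Finitely many exponents decide the size of the distance, and one threshold for the integrals,
    before taking roots, serves them all. *)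
Lemma dist_small (e : R) : 0 < e -> exists J, exists2 eta : R, 0 < eta & forall f g,
  (forall j, (j <= J)%N -> (intp Om (ps j) (fun z => f z - g z)%R <= eta%:E)%E) ->
  OLdist ps Om f g < e.
Proof.
move=> e0; have e4 : 0 < e / 4 by rewrite divr_gt0.
have [J hJ] := @exists_halving_lt R 1 (e / 4) e4.
pose m := Num.min 1 (e / 4).
have m0 : 0 < m by rewrite lt_min ltr01.
(* As [m <= 1], its power with the largest exponent [ps J] is the smallest one, so that all norms up
   to index [J] are at most [m]. *)
exists J, (powR m (ps J)); first exact: powR_gt0.
move=> f g h.
have L j : (j <= J)%N -> Lpnorm Om (ps j) (fun z => f z - g z) <= e / 4.
  move=> jJ; have i0 := intp_ge0 Om (ps j) (fun z => f z - g z).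
  apply: (@le_trans _ _ m); last by rewrite ge_min lexx orbT.
  have -> : m = powR (powR m (ps j)) (ps j)^-1.
    by rewrite -powRrM mulfV ?gt_eqF ?ps_gt0// powRr1// ltW.
  apply: ge0_ler_powR; [by rewrite invr_ge0; exact/ltW/ps_gt0|
    by rewrite nnegrE fine_ge0|by rewrite nnegrE powR_ge0|].
  rewrite -lee_fin fineK; last first.
    by rewrite ge0_fin_numE//; apply: le_lt_trans (h _ jJ) _; rewrite ltry.
  apply: le_trans (h _ jJ) _; rewrite lee_fin; apply: ger_powR; last exact: ps_homo.
  by rewrite m0 ge_min lexx.
apply: (@le_lt_trans _ _ (e / 2)); last by rewrite ltr_pdivrMr// ltr_pMr// ltr1n.
apply: OLdist_le_partial => N; apply: le_trans (OLterm_partial (ltW e4) L N) _.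
have x0 (k : nat) : 0 <= 2%:R ^- k :> R by rewrite invr_ge0 exprn_ge0.
have := x0 N; have := x0 (maxn N J.+1); have := halfS J; have := x0 J.+1.
move: hJ; rewrite mul1r.
move: (2%:R ^- J) (2%:R ^- J.+1) (2%:R ^- N) (2%:R ^- maxn _ _) => a b c d; nra.
Qed.

(** Each addition costs a factor [2^p]. Splitting off the first summand at every step makes the
    summand of index [b] pay [b + 1] such factors. *)
Lemma intp_sum_le p (h : nat -> Cn -> R[i]^o) C : 0 < p ->
  (forall b, holomorphic_on Om (h b)) ->
  holomorphic_on Om (fun z => \sum_(b < C) h b z) /\
  (intp Om p (fun z => \sum_(b < C) h b z)%R <=
    \sum_(b < C) ((powR 2 p) ^+ b.+1)%:E * intp Om p (h b))%E.
Proof.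
move=> p0; elim: C h => [|C IH] h hh.
  have -> : (fun z : Cn => \sum_(b < 0) h b z : R[i]^o) = (fun z => 0 * h 0%N z).
    by apply/funext => z; rewrite big_ord0 mul0r.
  split; first exact: holomorphic_onM.
  by rewrite (intpZ oOm) // cabs0 powR0 ?gt_eqF// mul0e big_ord0.
have -> : (fun z : Cn => \sum_(b < C.+1) h b z : R[i]^o) =
    (fun z => h 0%N z + \sum_(b < C) h b.+1 z).
  by apply/funext => z; rewrite big_ord_recl.
have [h1 h2] := IH (fun b => h b.+1) (fun b => hh b.+1).
split; first exact: holomorphic_onD.
apply: le_trans (intpD_le oOm p0 (hh 0%N) h1) _.
rewrite big_ord_recl /= expr1 ge0_muleDr; [|exact: intp_ge0|exact: intp_ge0].
apply: leeD => //.
apply: (@le_trans _ _ ((powR 2 p)%:E * (\sum_(b < C) ((powR 2 p) ^+ b.+1)%:E * intp Om p (h b.+1)))%E).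
  by apply: lee_wpmul2l; rewrite ?lee_fin ?powR_ge0.
rewrite ge0_sume_distrr; last first.
  by move=> b _; rewrite mule_ge0 ?intp_ge0// lee_fin exprn_ge0 ?powR_ge0.
by apply: lee_sum => b _; rewrite muleA -EFinM -exprS.
Qed.

(** If [G] already exceeds [Bd] somewhere on [E], take [h = 0]. Otherwise take [h = phi / A] with
    [A] large enough for all smallness conditions: at a point of [E] where [phi] exceeds
    [2 * A * Bd] in modulus, [h] exceeds [2 * Bd] while [G] is at most [Bd], so no cancellation can
    spoil the sum. *)
Lemma small_perturbation (E : set Cn) (phi G : Cn -> R[i]^o) (s : seq Cn) (m : nat)
    (kap : nat -> R) (de Bd : R) :
  OLq Om q phi -> (forall j, 0 < kap j) -> 0 < de -> 0 <= Bd ->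
  (forall M, exists z, E z /\ M < cabs (phi z)) ->
  exists h z, [/\ OLq Om q h, E z, Bd < cabs (G z + h z),
    forall j, (j <= m)%N -> (intp Om (ps j) h <= (kap j)%:E)%E &
    forall w, w \in s -> cabs (h w) <= de].
Proof.
move=> hphi kap0 de0 Bd0 unb; have /OLqP[hol fin] := hphi.
(* The sum of all ratios between the quantities to be made small and their allowed sizes dominates
   each of them. For the integrals one uses [t^p <= t] when [0 < t <= 1] and [p >= 1]. *)
pose A : R := 1 + \sum_(j < m.+1) fine (intp Om (ps j) phi) / kap j + \sum_(w <- s) cabs (phi w) / de.
have fj0 j : 0 <= fine (intp Om (ps j) phi) by rewrite fine_ge0// intp_ge0.
have S10 : 0 <= \sum_(j < m.+1) fine (intp Om (ps j) phi) / kap j.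
  by apply: sumr_ge0 => j _; rewrite divr_ge0// ltW.
have S20 : 0 <= \sum_(w <- s) cabs (phi w) / de.
  by apply: sumr_ge0 => w _; rewrite divr_ge0 ?cabs_ge0// ltW.
have A1 : 1 <= A by rewrite /A -addrA lerDl addr_ge0.
have A0 : 0 < A by apply: lt_le_trans A1.
have eps0 : 0 < A^-1 by rewrite invr_gt0.
have eps1 : A^-1 <= 1 by rewrite invf_le1.
have small (t : R) : 0 <= t <= A^-1 ->
   (forall j, (j <= m)%N -> (intp Om (ps j) (fun z => t%:C * phi z)%R <= (kap j)%:E)%E) /\
   (forall w, w \in s -> cabs (t%:C * phi w) <= de).
  move=> /andP[t0 te]; split=> [j jm|w ws].
    rewrite (intpZ oOm _ (ps_gt0 j) hol) cabs_real ger0_norm//.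
    rewrite -[intp Om (ps j) phi]fineK; last by rewrite ge0_fin_numE ?intp_ge0.
    rewrite -EFinM lee_fin.
    apply: (@le_trans _ _ (A^-1 * fine (intp Om (ps j) phi))).
      apply: ler_wpM2r => //; apply: (le_trans _ te).
      have [->|tn0] := eqVneq t 0; first by rewrite powR0// gt_eqF ?ps_gt0.
      apply: ge1r_powR; last exact/ltW/ps_gt1.
      by rewrite lt_neqAle eq_sym tn0 t0 (le_trans te).
    rewrite mulrC ler_pdivrMr// mulrC -ler_pdivrMr//.
    apply: (@le_trans _ _ (\sum_(j < m.+1) fine (intp Om (ps j) phi) / kap j)).
      rewrite (bigD1 (Ordinal (jm : (j < m.+1)%N)))//= lerDl.
      by apply: sumr_ge0 => i _; rewrite divr_ge0// ltW.
    by rewrite /A; lra.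
  rewrite cabsM cabs_real ger0_norm//.
  apply: (@le_trans _ _ (A^-1 * cabs (phi w))); first by rewrite ler_wpM2r ?cabs_ge0.
  rewrite mulrC ler_pdivrMr// mulrC -ler_pdivrMr//.
  apply: (@le_trans _ _ (\sum_(w <- s) cabs (phi w) / de)).
    rewrite (big_rem w)//= lerDl; apply: sumr_ge0 => v _.
    by rewrite divr_ge0 ?cabs_ge0// ltW.
  by rewrite /A; lra.
have use (t : R) z : 0 <= t <= A^-1 -> E z -> Bd < cabs (G z + t%:C * phi z) ->
  exists h z, [/\ OLq Om q h, E z, Bd < cabs (G z + h z),
    forall j, (j <= m)%N -> (intp Om (ps j) h <= (kap j)%:E)%E &
    forall w, w \in s -> cabs (h w) <= de].
  move=> ht Ez hB; have [h1 h2] := small t ht.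
  by exists (fun z => t%:C * phi z), z; split; [exact: OLqM|exact: Ez|exact: hB|exact: h1|exact: h2].
have [[z [Ez hz]]|none] := pselect (exists z, E z /\ Bd < cabs (G z)).
  apply: (use 0 z) => //; first by rewrite lexx invr_ge0 ltW.
  by rewrite mul0r addr0.
have [z [Ez hz]] := unb (A * (2 * Bd)).
apply: (use A^-1 z) => //; first by rewrite lexx ltW.
have GB : cabs (G z) <= Bd.
  by rewrite leNgt; apply/negP => h; apply: none; exists z.
have := cabs_dist (A^-1%:C * phi z) (- G z).
rewrite cabsN opprK (addrC _ (G z)) => /(lt_le_trans _); apply.
rewrite cabsM cabs_real ger0_norm ?invr_ge0 ?(ltW A0)//.
have : 2 * Bd < A^-1 * cabs (phi z) by rewrite [ltRHS]mulrC ltr_pdivlMr// [ltLHS]mulrC.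
by lra.
Qed.

End OLSpace.

(** * Density *)

Section Density.
Context {R : realType} {n : nat}.
Local Notation Cn := (Cn R n).
Variables (Om : set Cn) (q : \bar R) (ps : nat -> R).
Hypothesis oOm : open Om.
Hypothesis bOm : bounded_Cn Om.
Hypothesis hps : exponent_seq q ps.

Lemma geometric_tail (u : nat -> R[i]) (C : R) N :
  (forall b, (N <= b)%N -> cabs (u b) <= C * 2%:R ^- b.+1) ->
  forall k, (N <= k)%N ->
    cabs (\sum_(b < k) u b - \sum_(b < N) u b) <= C * (2%:R ^- N - 2%:R ^- k).
Proof.
move=> hu; elim=> [|k IH].
  by rewrite leqn0 => /eqP ->; rewrite !subrr cabs0 mulr0.
rewrite leq_eqVlt => /predU1P[->|]; first by rewrite !subrr cabs0 mulr0.
rewrite ltnS => Nk; rewrite big_ord_recr /= addrAC.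
apply: le_trans (cabsD _ _) _; have := IH Nk; have := hu _ Nk; rewrite (halfS k).
by move: (2%:R ^- N) (2%:R ^- k.+1) => x y; lra.
Qed.

Lemma powR_half (p : R) k : powR (2%:R ^- k) p = (powR 2 p) ^- k.
Proof.
have p2 : powR 2 p != 0 by rewrite gt_eqF ?powR_gt0.
elim: k => [|k IH]; first by rewrite !expr0 invr1 powR1.
rewrite !exprS !invfM powRM ?invr_ge0 ?exprn_ge0// IH; congr (_ * _).
apply: (mulfI p2); rewrite mulfV// -powRM ?invr_ge0//.
by rewrite mulfV// powR1.
Qed.

Lemma sum_truncated_le (x : nat -> R) (j C : nat) : (forall b, 0 <= x b) ->
  \sum_(b < C) (if (b < j)%N then x b else 0) <= \sum_(b < j) x b.
Proof.
move=> x0; pose T b := if (b < j)%N then x b else 0.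
have T0 b : 0 <= T b by rewrite /T; case: ifP.
have mono k : \sum_(b < C) T b <= \sum_(b < k + C) T b.
  elim: k => [|k IH]; first by rewrite add0n.
  by rewrite addSn big_ord_recr /= (le_trans IH)// lerDl.
have const k : \sum_(b < k + j) T b = \sum_(b < j) T b.
  elim: k => [|k IH]; first by rewrite add0n.
  by rewrite addSn big_ord_recr /= IH /T ltnNge leq_addl addr0.
apply: le_trans (mono j) _; rewrite addnC const.
by apply: ler_sum => b _; rewrite /T ltn_ord.
Qed.

Lemma sum_halves (C : nat) : \sum_(b < C) 2%:R ^- b.+1 = 1 - 2%:R ^- C :> R.
Proof.
elim: C => [|C IH]; first by rewrite big_ord0 expr0 invr1 subrr.
by rewrite big_ord_recr /= IH (halfS C); ring.
Qed.

(** The limit is obtained from the estimates themselves: the bound for the first exponent makes the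
    series of corrections converge locally uniformly, Weierstrass' theorem makes its sum
    holomorphic, and Fatou's lemma bounds its integrals. The values reached at the points [zz c]
    survive because later corrections there are at most [2^-(b+1)]. *)
Lemma exists_close_large_on (E : nat -> set Cn) (B : nat -> R) (phi : nat -> Cn -> R[i]^o) :
  (forall c, OLq Om q (phi c)) -> (forall c, E c `<=` Om) -> (forall c, 0 <= B c) ->
  (forall c M, exists z, E c z /\ M < cabs (phi c z)) ->
  forall (f0 : Cn -> R[i]^o) (e : R), OLq Om q f0 -> 0 < e ->
  exists g, [/\ OLq Om q g, OLdist ps Om f0 g < e & forall c, exists z, E c z /\ B c < cabs (g z)].
Proof.
move=> hphi EOm B0 unb f0 e hf0 e0.
have [J [eta0 eta00 hJ]] := dist_small Om hps e0.
have pg0 j : 0 < ps j by exact: ps_gt0 hps j.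
have P0 j : 0 < powR 2 (ps j) :> R by exact: powR_gt0.
have P1 j : 1 <= powR 2 (ps j) :> R.
  by rewrite -[leLHS](@powRr0 _ 2); apply: ler_powR; [lra|exact: ltW].
(* The division compensates the factor [2^p] of [fatou_intp] for all exponents up to index [J]; the
   bound [eta <= 1] is used in the local estimate. *)
pose eta := Num.min 1 eta0 / powR 2 (ps J).
have m0 : 0 < Num.min 1 eta0 by rewrite lt_min ltr01.
have etap : 0 < eta by rewrite divr_gt0.
have eta1 : eta <= 1.
  by rewrite ler_pdivrMr// mul1r (le_trans _ (P1 J))// ge_min lexx.
have etaJ j : (j <= J)%N -> powR 2 (ps j) * eta <= eta0.
  move=> jJ; apply: (@le_trans _ _ (powR 2 (ps J) * eta)).
    apply: ler_wpM2r; first exact: ltW.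
    by apply: ler_powR; [lra|exact: ps_homo hps _ _ jJ].
  by rewrite /eta mulrCA divff ?gt_eqF// mulr1 ge_min lexx orbT.
(* The powers of [2 ^ p_j] compensate the factor [2 ^ p] lost at each use of
   [|a + b|^p <= 2^p (|a|^p + |b|^p)] when the corrections are summed. *)
pose kap c j := eta / (2 * powR 2 (ps j)) ^+ c.+1.
have kap0 c j : 0 < kap c j by rewrite divr_gt0// exprn_gt0// mulr_gt0.
have de0 c : 0 < 2%:R ^- c.+1 :> R by rewrite invr_gt0 exprn_gt0.
have B1 c : 0 <= B c + 1 by rewrite addr_ge0.
pose stT := ((Cn -> R[i]^o) * seq Cn)%type.
(* A state holds the current function and the points chosen so far. At stage [c] the exponents of
   index up to [J + c] are controlled: those up to [J] from the start, for the distance, and every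
   other one from some stage on, for membership in the space. The level [B + 1] leaves a margin for
   later corrections. *)
have /choice[nx hnx] : forall x : nat * stT, exists hz : (Cn -> R[i]^o) * Cn,
    [/\ OLq Om q hz.1, E x.1 hz.2, B x.1 + 1 < cabs (x.2.1 hz.2 + hz.1 hz.2),
      forall j, (j <= J + x.1)%N -> (intp Om (ps j) hz.1 <= (kap x.1 j)%:E)%E &
      forall w, w \in x.2.2 -> cabs (hz.1 w) <= 2%:R ^- x.1.+1].
  move=> [c [G s]] /=.
  have [h [z H]] := small_perturbation oOm bOm hps G s (J + c) (hphi c) (kap0 c) (de0 c) (B1 c) (unb c).
  by exists (h, z).
pose st := fix st c : stT := if c is c'.+1 then
   let hz := nx (c', st c') in ((fun z => (st c').1 z + hz.1 z), hz.2 :: (st c').2) else (f0, [::]).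
pose h c := (nx (c, st c)).1.
pose zz c := (nx (c, st c)).2.
have H1 c : OLq Om q (h c) by have [] := hnx (c, st c).
have H2 c : E c (zz c) by have [] := hnx (c, st c).
have H3 c : B c + 1 < cabs ((st c).1 (zz c) + h c (zz c)) by have [] := hnx (c, st c).
have H4 c j : (j <= J + c)%N -> (intp Om (ps j) (h c) <= (kap c j)%:E)%E.
  by have [_ _ _ + _] := hnx (c, st c); apply.
have H5 c w : w \in (st c).2 -> cabs (h c w) <= 2%:R ^- c.+1.
  by have [_ _ _ _] := hnx (c, st c); apply.
have stE c z : (st c).1 z = f0 z + \sum_(b < c) h b z.
  elim: c => [|c IH]; first by rewrite big_ord0 addr0.
  by rewrite big_ord_recr /= addrA -IH.
have memz b c : (b < c)%N -> zz b \in (st c).2.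
  elim: c => [//|c IH]; rewrite ltnS leq_eqVlt => /predU1P[->|/IH bc] /=.
    by rewrite in_cons eqxx.
  by rewrite in_cons bc orbT.
have hh b : holomorphic_on Om (h b) by case: (H1 b).
pose S C : Cn -> R[i]^o := fun z => \sum_(b < C) h b z.
have hS C : holomorphic_on Om (S C) by case: (intp_sum_le oOm C (pg0 0%N) hh).
have loc (r : R) : 0 < r -> exists2 C : R, 0 < C & forall b z, polybox z r `<=` Om ->
    cabs (h b z) <= C * 2%:R ^- b.+1.
  move=> r0; have [C C0 hC] := intp_pointwise oOm (ltW (ps_gt1 hps 0%N)) r0.
  exists C => // b z zOm; apply: (hC _ _ (hh b) (ltW (de0 b)) _ z zOm).
  apply: le_trans (H4 b 0%N (leq0n _)) _; rewrite lee_fin powR_half /kap.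
  have q0 : 0 < powR 2 (ps 0%N) ^+ b.+1 :> R by exact: exprn_gt0.
  rewrite exprMn invfM mulrA -[leRHS]mul1r; apply: ler_wpM2r.
    by rewrite invr_ge0 ltW.
  have le1 : 2%:R ^- b.+1 <= 1 :> R by rewrite invf_le1 ?exprn_gt0// exprn_ege1//; lra.
  exact: mulr_ile1 (ltW etap) (ltW (de0 b)) eta1 le1.
have locz a : Om a -> exists2 d : R, 0 < d & rball a d `<=` Om /\ exists2 C : R, 0 < C &
    forall b z, rball a (d / 2) z -> cabs (h b z) <= C * 2%:R ^- b.+1.
  move=> Oa; have [d d0 hd] := open_rball_sub oOm Oa.
  have d2 : 0 < d / 2 by rewrite divr_gt0.
  have [C C0 hC] := loc _ (divr_gt0 d2 (ltr0n _ 4)); exists d => //; split => //; exists C => // b z zr.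
  apply: hC; apply: subset_trans (polybox_sub_rball d2) (subset_trans _ hd).
  by apply: rball_sub; move: zr; rewrite /rball /=; lra.
have tail (z : Cn) (C : R) : 0 < C -> (forall b, cabs (h b z) <= C * 2%:R ^- b.+1) ->
   forall N k, (N <= k)%N -> cabs (S k z - S N z) <= C * 2%:R ^- N.
  move=> C0 hC N k Nk; have := geometric_tail (fun b _ => hC b) Nk; move/le_trans; apply.
  by apply: ler_wpM2l; [exact: ltW|rewrite gerBl invr_ge0 exprn_ge0].
have halv (C d : R) : 0 < C -> 0 < d -> exists N, forall k, (N <= k)%N -> C * 2%:R ^- k <= d.
  move=> C0 d0; have [N hN] := exists_halving_lt C d0; exists N => k Nk.
  apply: le_trans (ltW hN); apply: ler_wpM2l; first exact: ltW.
  by rewrite lef_pV2 ?posrE ?exprn_gt0// ler_weXn2l//; lra.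
have /choice[F hF] : forall z, exists l : R[i]^o, Om z -> ccvg (S ^~ z) l.
  move=> z; have [Oz|nOz] := pselect (Om z); last by exists 0.
  have [d d0 [_ [C C0 hC]]] := locz z Oz.
  have [|l hl] := @ccauchy_cvg _ (S ^~ z); last by exists l.
  move=> d' d'0; have d'2 : 0 < d' / 2 by rewrite divr_gt0.
  have [N hN] := halv _ _ C0 d'2; exists N => j k Nj Nk.
  have zr : rball z (d / 2) z by apply: rball_center; rewrite divr_gt0.
  have T := tail z C C0 (fun b => hC b z zr) N.
  have := T j Nj; have := T k Nk; have := hN N (leqnn _).
  by have := cabs_trans (S N z) (S j z) (S k z); rewrite (cabsB (S N z)); lra.
have hFol : holomorphic_on Om F.
  apply: (weierstrass hS) => a Oa; have [d d0 [dOm [C C0 hC]]] := locz a Oa.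
  exists (d / 2); first by rewrite divr_gt0.
  split; first by move=> z; rewrite /rball /= => h'; apply: dOm; rewrite /rball /=; lra.
  move=> d' d'0; have d'2 : 0 < d' / 2 by rewrite divr_gt0.
  have [N hN] := halv _ _ C0 d'2; exists N => k Nk z zr.
  have Oz : Om z by apply: dOm; move: zr; rewrite /rball /=; lra.
  have [N' hN'] := hF z Oz _ d'2.
  have T := tail z C C0 (fun b => hC b z zr) k (maxn k N') (leq_maxl _ _).
  have := hN' (maxn k N') (leq_maxr _ _); have := hN k Nk.
  by have := cabs_trans (S (maxn k N') z) (S k z) (F z); rewrite (cabsB (S k z) (S _ z)); lra.
have wb j b : (j <= J + b)%N ->
    (((powR 2 (ps j)) ^+ b.+1)%:E * intp Om (ps j) (h b) <= (eta * 2%:R ^- b.+1)%:E)%E.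
  move=> jb; apply: (@le_trans _ _ (((powR 2 (ps j)) ^+ b.+1)%:E * (kap b j)%:E)%E).
    by apply: lee_wpmul2l; [rewrite lee_fin exprn_ge0// ltW|exact: H4].
  rewrite -EFinM lee_fin /kap exprMn invfM le_eqVlt; apply/orP; left; apply/eqP.
  by field; rewrite !expf_neq0// gt_eqF.
have SJ j C : (j <= J)%N -> (intp Om (ps j) (S C) <= eta%:E)%E.
  move=> jJ; have [_ hle] := intp_sum_le oOm C (pg0 j) hh; apply: le_trans hle _.
  apply: (@le_trans _ _ (\sum_(b < C) (eta * 2%:R ^- b.+1)%:E)%E).
    by apply: lee_sum => b _; apply: wb; exact: leq_trans (leq_addr _ _).
  rewrite sumEFin lee_fin -mulr_sumr sum_halves -[leRHS]mulr1.
  by apply: ler_wpM2l; [exact: ltW|rewrite gerBl invr_ge0 exprn_ge0].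
(* Only the corrections with [b < j] may escape the control of the exponent of index [j]; they are
   finitely many and have finite integrals. *)
have Sfin j : exists D : R, forall C, (intp Om (ps j) (S C) <= D%:E)%E.
  pose x b : R := (powR 2 (ps j)) ^+ b.+1 * fine (intp Om (ps j) (h b)).
  have x0 b : 0 <= x b by rewrite mulr_ge0 ?exprn_ge0 ?fine_ge0 ?intp_ge0 ?powR_ge0.
  exists (\sum_(b < j) x b + eta) => C.
  have [_ hle] := intp_sum_le oOm C (pg0 j) hh; apply: le_trans hle _.
  apply: (@le_trans _ _ (\sum_(b < C) ((if (b < j)%N then x b else 0) + eta * 2%:R ^- b.+1)%:E)%E).
    apply: lee_sum => b _; case: ltnP => bj.
      have fb : (intp Om (ps j) (h b) < +oo)%E by have /(OLqP oOm bOm hps)[] := H1 b.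
      rewrite -[intp Om (ps j) (h b)]fineK; last by rewrite ge0_fin_numE ?intp_ge0.
      by rewrite -EFinM lee_fin lerDl mulr_ge0 ?ltW.
    by rewrite add0r; apply: wb; exact: leq_trans (leq_addl _ _).
  rewrite sumEFin lee_fin big_split /=; apply: lerD; first exact: sum_truncated_le.
  rewrite -mulr_sumr sum_halves -[leRHS]mulr1.
  by apply: ler_wpM2l; [exact: ltW|rewrite gerBl invr_ge0 exprn_ge0].
have OF : OLq Om q F.
  apply/(OLqP oOm bOm hps); split => // j; have [D hD] := Sfin j.
  apply: le_lt_trans (fatou_intp oOm (pg0 j) hS hFol hF hD) _.
  by rewrite -EFinM ltry.
exists (fun z => f0 z + F z); split; first exact (OLqD oOm bOm hps hf0 OF).
  apply: hJ => j jJ; rewrite (@eq_intp _ _ Om (ps j) _ F); last first.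
    by move=> z _; rewrite opprD addrA subrr add0r cabsN.
  apply: le_trans (fatou_intp oOm (pg0 j) hS hFol hF (fun C => SJ j C jJ)) _.
  by rewrite -EFinM lee_fin; exact: etaJ.
move=> c; exists (zz c); split => //.
have Oz : Om (zz c) by apply: EOm (H2 c).
(* The corrections after stage [c] change the value at [zz c] by at most [1/2], passing to the limit
   by at most [1/4]; together this is less than the margin 1. *)
have h4 : 0 < 4^-1 :> R by rewrite invr_gt0.
have [N hN] := hF _ Oz _ h4.
pose k := maxn c.+1 N.
have ck : (c.+1 <= k)%N by exact: leq_maxl.
have T : cabs (S k (zz c) - S c.+1 (zz c)) <= 1 * (2%:R ^- c.+1 - 2%:R ^- k).
  apply: (@geometric_tail (fun b => h b (zz c))) => // b cb.
  by rewrite mul1r; apply: H5; exact: memz.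
have := hN k (leq_maxr _ _); have := H3 c.
rewrite stE -(addrA (f0 _)).
have -> : \sum_(b < c) h b (zz c) + h c (zz c) = S c.+1 (zz c).
  by rewrite /S big_ord_recr.
have : 2%:R ^- c.+1 <= 2^-1 :> R.
  by rewrite lef_pV2 ?posrE ?exprn_gt0// exprS ler_peMr// exprn_ege1//; lra.
have : 0 <= 2%:R ^- k :> R by rewrite invr_ge0 exprn_ge0.
have E1 : f0 (zz c) + F (zz c) = (f0 (zz c) + S c.+1 (zz c)) -
  ((S k (zz c) - F (zz c)) - (S k (zz c) - S c.+1 (zz c))) by ring.
have := cabs_dist (f0 (zz c) + S c.+1 (zz c)) ((S k (zz c) - F (zz c)) - (S k (zz c) - S c.+1 (zz c))).
have := cabs_sub (S k (zz c) - F (zz c)) (S k (zz c) - S c.+1 (zz c)).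
rewrite -E1; move: T; rewrite mul1r.
move: (cabs _) (cabs (S k _ - _)) (cabs (S k _ - S c.+1 _)) => *.
lra.
Qed.

End Density.

(** * Countable families of open conditions *)

Section Topology.
Context {R : realType} {n : nat}.
Local Notation Cn := (Cn R n).
Implicit Types (f g : Cn -> R[i]^o) (z : Cn).
Variables (Om : set Cn) (q : \bar R) (ps : nat -> R).
Hypothesis oOm : open Om.
Hypothesis bOm : bounded_Cn Om.
Hypothesis hps : exponent_seq q ps.

(* [i] consists of the centre and the radius of a ball and a base point. *)
Definition ball_component (i : {ffun 'I_n -> rat * rat} * rat * {ffun 'I_n -> rat * rat}) : set Cn :=
  connected_component (rball (rat_point i.1.1) (ratr i.1.2) `&` Om) (rat_point i.2).

Definition ball_crossing (i : {ffun 'I_n -> rat * rat} * rat * {ffun 'I_n -> rat * rat}) : Prop :=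
  (rball (rat_point i.1.1) (ratr i.1.2) `&` Om) (rat_point i.2) /\
  ~ (rball (rat_point i.1.1 : Cn) (ratr i.1.2) `<=` Om).

Lemma ball_component_boundary i : ball_crossing i ->
  exists zeta, bdry Om zeta /\ closure (ball_component i) zeta /\
    exists2 d : R, 0 < d & rball zeta d `<=` rball (rat_point i.1.1) (ratr i.1.2).
Proof.
move=> [xB nB].
have [zeta [Bz nO cl]] := component_boundary oOm (@open_rball _ _ _ _) (@connected_rball _ _ _ _) xB nB.
exists zeta; split; first exact: bdry_of_component oOm nO cl.
by split => //; exact: open_rball_sub (@open_rball _ _ _ _) Bz.
Qed.

(** In both directions the given component has a point outside [Om] in its closure and inside its
    ball. A small enough ball of the other kind near that point has a component contained in the
    given one. This also passes between Euclidean balls and the balls of the maximum norm. *)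
Lemma totally_unboundedP f : totally_unbounded Om f <->
  forall i, ball_crossing i -> forall M : R, exists z, ball_component i z /\ M < cabs (f z).
Proof.
split=> [tu i ci M|H w bw d d0 x [wx Ox] M].
  have [zeta [bz [cl [d d0 hd]]]] := ball_component_boundary ci.
  have [y [Ey ey]] := cl _ (nbhs_eball zeta d0).
  have Oy : Om y by have [] := connected_component_sub Ey.
  have [z [Ez Mz]] := tu zeta bz d d0 y (conj ey Oy) M.
  exists z; split => //; apply: (connected_sub_component Ey _ _ _ Ez).
  - exact: connected_component_refl.
  - by move=> u /connected_component_sub[/eball_sub_rball/hd].
  - exact: component_connected.
have nsub : ~ (eball w d `<=` Om).
  by case: bw => _ nO sub; apply: nO; apply: filterS sub _; exact: nbhs_eball.
have [zeta [ez nOz cl]] :=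
  component_boundary oOm (@open_eball _ _ _ _) (connected_eball d0) (conj wx Ox) nsub.
have [s s0 hs] := open_rball_sub (@open_eball _ _ w d) ez.
(* With the centre within [s / 4] of [zeta] and a radius between [3 * s / 8] and [5 * s / 8], the
   rational ball contains [zeta] and stays within distance [s] of it. *)
have s4 : 0 < s / 4 by rewrite divr_gt0.
have s8 : 0 < s / 8 by rewrite divr_gt0.
have [c hc] := rat_point_dense zeta s4.
have [r hr] := exists_rat_near (s / 2) s8.
move: hc hr; rewrite /rball /= ltr_distlC => hc /andP[r1 r2].
have cs : rball (rat_point c) (ratr r) `<=` rball zeta s by apply: rball_sub; lra.
have zc : rball (rat_point c) (ratr r) zeta by rewrite /rball /= rnormB; lra.
have nc : nbhs zeta (rball (rat_point c) (ratr r)) by apply: open_nbhs_nbhs; split => //; exact: open_rball.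
have oE : open (connected_component (eball w d `&` Om) x).
  exact: open_connected_component (openI (@open_eball _ _ _ _) oOm).
have [y [Ey yc]] := cl _ nc.
have oEc : open (connected_component (eball w d `&` Om) x `&` rball (rat_point c) (ratr r)).
  exact: openI oE (@open_rball _ _ _ _).
have [t t0 ht] := open_rball_sub oEc (conj Ey yc).
have [x' /ht[Ex' cx']] := rat_point_dense y t0.
have [] := H (c, r, x') _ M.
  split => /=; first by split => //; have [] := connected_component_sub Ex'.
  by move=> /(_ _ zc).
move=> z [Ez Mz]; exists z; split => //.
apply: (connected_sub_component Ex' _ _ _ Ez).
- apply: connected_component_refl; split => //=.
  by have [] := connected_component_sub Ex'.
- by move=> u /connected_component_sub[/cs/hs].
- exact: component_connected.
Qed.

Lemma OL_eval_continuous f z (e : R) : OLq Om q f -> Om z -> 0 < e ->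
  exists2 d : R, 0 < d & forall g, OLq Om q g -> OLdist ps Om f g < d -> cabs (f z - g z) <= e.
Proof.
move=> hf Oz e0; have [r r0 hr] := open_rball_sub oOm Oz.
have r4 : 0 < r / 4 by rewrite divr_gt0.
have [C C0 hC] := eval_close oOm bOm hps r4.
have d0 : 0 < Num.min 4^-1 (e / C) by rewrite lt_min invr_gt0 ltr0n divr_gt0.
have d4 : Num.min 4^-1 (e / C) <= 4^-1 by rewrite ge_min lexx.
exists (Num.min 4^-1 (e / C)) => // g hg fg.
apply: le_trans (hC f g _ hf hg (ltW d0) d4 fg z (subset_trans (polybox_sub_rball r0) hr)) _.
by rewrite -ler_pdivlMl// mulrC ge_min lexx orbT.
Qed.

Lemma OL_open_unbounded (E : set Cn) (M : R) : E `<=` Om ->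
  OL_open ps Om q [set f | exists z, E z /\ M < cabs (f z)].
Proof.
move=> EOm f hf [z [Ez Mz]].
have e0 : 0 < (cabs (f z) - M) / 2 by rewrite divr_gt0// subr_gt0.
have [d d0 hd] := OL_eval_continuous hf (EOm _ Ez) e0.
exists d => // g hg /(hd _ hg) h; exists z; split => //.
by have := cabs_dist (f z) (f z - g z); rewrite subKr; lra.
Qed.

Lemma totally_unbounded_Gdelta : OL_Gdelta ps Om q [set g | OLq Om q g /\ totally_unbounded Om g].
Proof.
(* Integer thresholds suffice for unboundedness; codes that decode to nothing impose no
   condition. *)
pose U k : set (Cn -> R[i]^o) := if unpickle k is Some (i, M)
  then [set f | ball_crossing i -> exists z, ball_component i z /\ M%:R < cabs (f z)] else setT.
exists U; split.
  move=> k f hf; rewrite /U; case: (unpickle k) => [[i M]|]; last by exists 1.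
  have [ci|ni] := pselect (ball_crossing i); last by exists 1 => // g _ _ /ni.
  move=> /(_ ci) /(OL_open_unbounded _ hf)[|d d0 hd].
    by move=> z /connected_component_sub[].
  by exists d => // g hg fg _; exact: hd.
move=> g hg; split=> [[_ /totally_unboundedP tu] k|Ug].
  by rewrite /U; case: (unpickle k) => [[i M]|//] ci; exact: tu.
split => //; apply/totally_unboundedP => i ci M.
have := Ug (pickle (i, (Num.Def.trunc M).+1)); rewrite /U pickleK => /(_ ci)[z [Ez Mz]].
by exists z; split => //; apply: lt_trans Mz; exact: truncnS_gt.
Qed.

Lemma OLdist_refl_lt f (e : R) : OLq Om q f -> 0 < e -> OLdist ps Om f f < e.
Proof.
move=> [hf _] e0; have [J [eta eta0]] := dist_small Om hps e0; apply => j _.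
have pj := ps_gt0 hps j.
rewrite (@eq_intp _ _ Om (ps j) _ (fun z => 0 * f z)); last first.
  by move=> z _; rewrite subrr mul0r.
by rewrite intpZ// cabs0 powR0 ?gt_eqF// mul0e lee_fin ltW.
Qed.

Lemma totally_unbounded_dense :
  (forall zeta, bdry Om zeta -> exists f, OLq Om q f /\ tends_to_infty_at Om zeta f) ->
  OL_dense ps Om q [set g | OLq Om q g /\ totally_unbounded Om g].
Proof.
move=> peak f0 hf0 e e0.
(* Without a crossing ball total unboundedness is vacuous and [f0] itself will do; otherwise [i0]
   serves as default below. *)
have [[i0 ci0]|none] := pselect (exists i, ball_crossing i); last first.
  exists f0; split => //; last exact: OLdist_refl_lt.
  by split => //; apply/totally_unboundedP => i ci; case: none; exists i.
have /choice[phi hphi] : forall i, exists f, OLq Om q f /\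
    (ball_crossing i -> forall M : R, exists z, ball_component i z /\ M < cabs (f z)).
  move=> i; have [ci|ni] := pselect (ball_crossing i); last by exists f0.
  have [zeta [bz [cl _]]] := ball_component_boundary ci.
  have [f [hf inf]] := peak _ bz; exists f; split => // _ M; have [d d0 hd] := inf M.
  have [z [Ez ez]] := cl _ (nbhs_eball zeta d0); exists z; split => //.
  by apply: hd => //; have [] := connected_component_sub Ez.
(* Every pair of a crossing ball and an integer level gets a stage of its own, so each component is
   visited with all levels; all other codes repeat the default pair. *)
pose dec c := if unpickle c is Some (i, M) then
  if pselect (ball_crossing i) then (i, M) else (i0, 0%N) else (i0, 0%N).
have hdec c : ball_crossing (dec c).1.
  by rewrite /dec; case: (unpickle c) => [[i M]|//]; case: pselect.
have [|||c M|g [hg fg unb]] := @exists_close_large_on R n Om q ps oOm bOm hps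
    (fun c => ball_component (dec c).1) (fun c => (dec c).2%:R) (fun c => phi (dec c).1)
    _ _ _ _ f0 e hf0 e0.
- by move=> c; have [] := hphi (dec c).1.
- by move=> c z /connected_component_sub[].
- by [].
- by have [_] := hphi (dec c).1; apply.
exists g; split => //; split => //; apply/totally_unboundedP => i ci M.
have := unb (pickle (i, (Num.Def.trunc M).+1)); rewrite /dec pickleK.
case: pselect => [_|/(_ ci)//] /= [z [Ez Mz]].
by exists z; split => //; apply: lt_trans Mz; exact: truncnS_gt.
Qed.

(** Centre [c], radius [r] of a ball that leaves [Om], and radius [s] of a concentric ball inside
    [Om]. The last entry is the integer bound, which matters in [extends_bounded] only. *)
Definition extension_ball (i : {ffun 'I_n -> rat * rat} * rat * rat * nat) : Prop :=
  let: (c, r, s, _) := i in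
  [/\ 0 < ratr s :> R, ratr s <= ratr r :> R, rball (rat_point c : Cn) (ratr s) `<=` Om &
      ~ (rball (rat_point c : Cn) (ratr r) `<=` Om)].

Definition extends_bounded (i : {ffun 'I_n -> rat * rat} * rat * rat * nat) f : Prop :=
  let: (c, r, s, M) := i in
  exists F : Cn -> R[i]^o, [/\ holomorphic_on (rball (rat_point c) (ratr r)) F,
    (forall z, rball (rat_point c) (ratr r) z -> cabs (F z) <= M%:R) &
    forall z, rball (rat_point c) (ratr s) z -> F z = f z].

(** An extension to an arbitrary [U] is holomorphic at some point [zeta] outside [Om] in the closure
    of a component on which it equals [f], and bounded near [zeta]. A rational centre in that
    component, close to [zeta], carries a small ball inside the component and a larger one that
    contains [zeta] and lies in the region of boundedness. *)
Lemma singular_everywhereP f : holomorphic_on Om f -> singular_everywhere Om f <->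
  forall i, extension_ball i -> ~ extends_bounded i f.
Proof.
move=> hf; split=> [sing [[[c r] s] M] [s0 sr sOm nOm] [F [hF _ Ff]]|H].
  have sub : rball (rat_point c : Cn) (ratr s) `<=` rball (rat_point c) (ratr r).
    by move=> z; rewrite /rball /=; move/lt_le_trans; apply.
  apply: (sing (rball (rat_point c) (ratr r)) (rball (rat_point c) (ratr s))).
  - exact: open_rball.
  - exact: open_rball.
  - exact: connected_rball.
  - by exists (rat_point c); exact: rball_center.
  - by move=> z zs; split; [exact: sub|exact: sOm].
  - by move=> /setIidPl.
  - by exists F.
move=> U V oU oV cU [v Vv] VU UO [F [hF FV]].
have [zeta [Uz nO cz FE]] := extension_boundary oOm oU oV cU Vv VU UO hf hF FV.
have [d d0 [dU [M hM]]] := holomorphic_locally_bounded oU hF Uz.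
have d4 : 0 < d / 4 by rewrite divr_gt0.
have d8 : 0 < d / 8 by rewrite divr_gt0.
have oE := @open_connected_component _ _ _ v (openI oU oOm).
have [c [hc [t t0 ht]]] := closure_rat_point oE cz d4.
pose m := Num.min t (d / 4).
have m0 : 0 < m by rewrite lt_min t0.
have m4 : 0 < m / 4 by rewrite divr_gt0.
have [r] := exists_rat_near (d / 2) d8; rewrite ltr_distlC => /andP[r1 r2].
have [s] := exists_rat_near (m / 2) m4; rewrite ltr_distlC => /andP[s1 s2].
have md : m <= d / 4 by rewrite ge_min lexx orbT.
have mt : m <= t by rewrite ge_min lexx.
move: hc; rewrite /rball /= => hc.
have cs : rball (rat_point c) (ratr r) `<=` rball zeta d by apply: rball_sub; lra.
have st : rball (rat_point c) (ratr s) `<=` connected_component (U `&` Om) v.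
  by move=> z zs; apply: ht; move: zs; rewrite /rball /=; lra.
apply: (H (c, r, s, (Num.Def.trunc M).+1)).
  split; [lra|lra| |].
    by move=> z /st /connected_component_sub[].
  by move=> h; apply/nO/h; rewrite /rball /= rnormB; lra.
exists F; split.
- by apply: holomorphic_onS hF => z /cs/dU.
- by move=> z /cs/hM/le_trans; apply; apply/ltW; exact: truncnS_gt.
- by move=> z /st; exact: FE.
Qed.

(** Otherwise functions [g k] tending to [f] have extensions [F k] with the common bound [M]. On
    half of the inner ball point evaluations are uniformly controlled, so the [F k] are uniformly
    Cauchy there, and Vitali's theorem yields a limit on the whole outer ball; the bound and the
    agreement with [f] on the inner ball pass to it. *)
Lemma OL_open_not_extends_bounded i : extension_ball i ->
  OL_open ps Om q [set f | ~ extends_bounded i f].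
Proof.
case: i => [[[c r] s] M] [s0 sr sOm _] f hf nf; apply: contrapT => no.
pose B : set Cn := rball (rat_point c) (ratr r).
pose b : set Cn := rball (rat_point c) (ratr s).
have s2 : 0 < ratr s / 2 :> R by rewrite divr_gt0.
have s8 : 0 < ratr s / 2 / 4 :> R by rewrite divr_gt0.
(* The factor [4^-1] keeps the distances in the range required by [eval_close]. *)
have e0 k : 0 < 4^-1 * k.+1%:R^-1 :> R by rewrite mulr_gt0 ?invr_gt0 ?ltr0n.
have near k : exists g, [/\ OLq Om q g, OLdist ps Om f g < 4^-1 * k.+1%:R^-1 &
    extends_bounded (c, r, s, M) g].
  apply: contrapT => none; apply: no; exists (4^-1 * k.+1%:R^-1) => // g hg fg ext.
  by apply: none; exists g.
have /choice[g hg] := near.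
have /choice[F hF] : forall k, exists F : Cn -> R[i]^o, [/\ holomorphic_on B F,
    forall z, B z -> cabs (F z) <= M%:R & forall z, b z -> F z = g k z].
  by move=> k; have [_ _] := hg k.
have Fol k : holomorphic_on B (F k) by have [] := hF k.
have FM k z : B z -> cabs (F k z) <= M%:R by have [_ + _] := hF k; apply.
have Fg k z : b z -> F k z = g k z by have [_ _] := hF k; apply.
have e4 k : 4^-1 * k.+1%:R^-1 <= 4^-1 :> R.
  by rewrite ler_piMr ?invr_ge0// invf_le1 ?ler1n ?ltr0n.
have [C C0 hC] := eval_close oOm bOm hps s8.
have Fc z : rball (rat_point c) (ratr s / 2) z -> forall k,
    cabs (f z - F k z) <= C * (4^-1 * k.+1%:R^-1).
  move=> zs k; have [hgk fg _] := hg k.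
  have zb : rball z (ratr s / 2) `<=` b.
    by apply: rball_sub; move: zs; rewrite /rball /=; lra.
  rewrite Fg; last by apply: zb; exact: rball_center.
  apply: (hC f (g k) _ hf hgk (ltW (e0 k)) (e4 k) fg z).
  exact: subset_trans (polybox_sub_rball s2) (subset_trans zb sOm).
have [||G [hG FG]] := @vitali_limit R n B F (rat_point c) (@connected_rball _ _ _ _)
    (rball_center _ (lt_le_trans s0 sr)) Fol.
- move=> z Bz; have [d d0 hd] := open_rball_sub (@open_rball _ _ _ _) Bz.
  by exists d => //; split => //; exists M%:R => k w /hd; exact: FM.
- exists (ratr s / 2) => // e ep.
  have [N hN] := exists_inv_nat_lt (divr_gt0 ep C0).
  exists N => j k Nj Nk z zs.
  have small l : (N <= l)%N -> C * (4^-1 * l.+1%:R^-1) <= e / 2.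
    move=> Nl; have : l.+1%:R^-1 <= N.+1%:R^-1 :> R.
      by rewrite lef_pV2 ?posrE ?ltr0n// ler_nat.
    move/le_lt_trans/(_ hN); rewrite ltr_pdivlMr// => h.
    by rewrite mulrCA (mulrC C); move: (_ * C) h => y h; lra.
  have := cabs_trans (f z) (F j z) (F k z); rewrite (cabsB (F j z) (f z)).
  by have := le_trans (Fc z zs j) (small _ Nj); have := le_trans (Fc z zs k) (small _ Nk); lra.
apply: nf; exists G; split => //.
- move=> z Bz; apply/ler_addgt0Pr => e ep; have [N hN] := FG z Bz e ep.
  have := hN N (leqnn _); have := FM N z Bz; rewrite cabsB.
  by have := cabs_dist (G z) (F N z); lra.
- move=> z bz; apply/subr0_eq/cabs_le_all_eq0 => e ep.
  have e2 : 0 < e / 2 by rewrite divr_gt0.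
  have [d d0 hd] := OL_eval_continuous hf (sOm _ bz) e2.
  have [N hN] := exists_inv_nat_lt d0.
  have Bz : B z by move: bz; rewrite /b /B /rball /=; move/lt_le_trans; apply.
  have [N' hN'] := FG z Bz _ e2.
  pose k := maxn N N'.
  have [hgk fg _] := hg k.
  have kd : 4^-1 * k.+1%:R^-1 < d.
    have x0 : 0 < k.+1%:R^-1 :> R by rewrite invr_gt0 ltr0n.
    have : k.+1%:R^-1 <= N.+1%:R^-1 :> R.
      by rewrite lef_pV2 ?posrE ?ltr0n// ler_nat ltnS leq_maxl.
    by move: x0 hN; move: (k.+1%:R^-1) (N.+1%:R^-1) => x y; lra.
  have := hd _ hgk (lt_trans fg kd); have := hN' k (leq_maxr _ _); rewrite Fg//.
  by have := cabs_trans (g k z) (G z) (f z); rewrite (cabsB (G z) (g k z)) (cabsB (f z)); lra.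
Qed.

Lemma singular_everywhere_Gdelta :
  OL_Gdelta ps Om q [set h | OLq Om q h /\ singular_everywhere Om h].
Proof.
pose U k : set (Cn -> R[i]^o) := if unpickle k is Some i
  then [set f | extension_ball i -> ~ extends_bounded i f] else setT.
exists U; split.
  move=> k f hf; rewrite /U; case: (unpickle k) => [i|]; last by exists 1.
  have [ei|ni] := pselect (extension_ball i); last by exists 1 => // g _ _ /ni.
  move=> /(_ ei) /(OL_open_not_extends_bounded ei hf)[d d0 hd].
  by exists d => // g hg fg _; exact: hd.
move=> g hg; have [hol _] := hg; split=> [[_ /(singular_everywhereP hol) sg] k|Ug].
  by rewrite /U; case: (unpickle k) => [i|//]; exact: sg.
split => //; apply/(singular_everywhereP hol) => i.
by have := Ug (pickle i); rewrite /U pickleK.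
Qed.

End Topology.

Theorem theorem4 (R : realType) (n : nat) (Om : set (Cn R n))
    (q : \bar R) (ps : nat -> R) :
  open Om -> bounded_Cn Om -> (1%:E < q)%E -> exponent_seq q ps ->
  (forall zeta, bdry Om zeta ->
     exists f, OLq Om q f /\ tends_to_infty_at Om zeta f) ->
  [/\ OL_dense ps Om q [set g | OLq Om q g /\ totally_unbounded Om g],
      OL_Gdelta ps Om q [set g | OLq Om q g /\ totally_unbounded Om g],
      OL_dense ps Om q [set h | OLq Om q h /\ singular_everywhere Om h] &
      OL_Gdelta ps Om q [set h | OLq Om q h /\ singular_everywhere Om h]].
Proof.
move=> oOm bOm _ hps peak.
have dense := totally_unbounded_dense oOm bOm hps peak.
split => //.
- exact: totally_unbounded_Gdelta.
- move=> f hf e e0; have [g [hg [_ tu] fg]] := dense f hf e e0.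
  exists g; split => //; split => //; have [hol _] := hg.
  exact: totally_unbounded_singular.
- exact: singular_everywhere_Gdelta.
Qed.
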